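(* Let $A,B,D,\widetilde{A},\widetilde{B},\widetilde{D}$ be C$^*$-algebras with inclusions $A\subseteq\widetilde{A}$, $B\subseteq\widetilde{B}$, $D\subseteq\widetilde{D}$, $D\subseteq A$, $D\subseteq B$, $\widetilde{D}\subseteq\widetilde{A}$, $\widetilde{D}\subseteq\widetilde{B}$ which are compatible, i.e. the two composite inclusions $D\hookrightarrow A\hookrightarrow\widetilde{A}$ and $D\hookrightarrow\widetilde{D}\hookrightarrow\widetilde{A}$ coincide, and the two composite inclusions $D\hookrightarrow B\hookrightarrow\widetilde{B}$ and $D\hookrightarrow\widetilde{D}\hookrightarrow\widetilde{B}$ coincide. Let $\lambda:A*_DB\to\widetilde{A}*_{\widetilde{D}}\widetilde{B}$ be the resulting $*$-homomorphism of full amalgamated free product C$^*$-algebras. Suppose there are conditional expectations $E^A_D:A\to D$ and $E^B_D:B\to D$ with $E^B_D$ faithful. Suppose there are $\tilde{d}\in\widetilde{D}$, $a\in A$ and $b\in B$ satisfying $a\tilde{d}\in A$, $\tilde{d}b\in B$, $$D(\tilde{d}b)\cap Db=\{0\}\qquad\text{and}\qquad E^A_D(\tilde{d}^*a^*a\tilde{d})\,b\neq0.$$ Then $\lambda$ is not injective.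
   Context: Products $a\tilde{d}$ are taken in $\widetilde{A}$ and products $\tilde{d}b$ in $\widetilde{B}$; $D(\tilde{d}b)=\{d\tilde{d}b: d\in D\}$ and $Db=\{db:d\in D\}$. Given C$^*$-algebras $A,B,D$ with injective $*$-homomorphisms $\phi_A:D\to A$ and $\phi_B:D\to B$, the full amalgamated free product $A*_DB$ is the C$^*$-algebra equipped with injective $*$-homomorphisms $\sigma_A:A\to A*_DB$ and $\sigma_B:B\to A*_DB$ such that $\sigma_A\circ\phi_A=\sigma_B\circ\phi_B$, $A*_DB$ is generated by $\sigma_A(A)\cup\sigma_B(B)$, and whenever $\mathfrak{C}$ is a C$^*$-algebra and $\pi_A:A\to\mathfrak{C}$, $\pi_B:B\to\mathfrak{C}$ are $*$-homomorphisms with $\pi_A\circ\phi_A=\pi_B\circ\phi_B$, there is a $*$-homomorphism $\pi:A*_DB\to\mathfrak{C}$ with $\pi\circ\sigma_A=\pi_A$ and $\pi\circ\sigma_B=\pi_B$. The map $\lambda$ is the one obtained from this universal property applied to the compositions $A\hookrightarrow\widetilde{A}\to\widetilde{A}*_{\widetilde{D}}\widetilde{B}$ and $B\hookrightarrow\widetilde{B}\to\widetilde{A}*_{\widetilde{D}}\widetilde{B}$. *)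

(* Defs.v *)
From HB Require Import structures.
From mathcomp Require Import all_boot all_order all_algebra.
From mathcomp Require Import complex.
From mathcomp Require Import all_classical all_reals all_analysis.

Set Implicit Arguments.
Unset Strict Implicit.
Unset Printing Implicit Defensive.

Import Order.TTheory GRing.Theory Num.Theory.
Import numFieldNormedType.Exports.

Local Open Scope classical_set_scope.
Local Open Scope ring_scope.
Local Open Scope complex_scope.

Reserved Notation "x ** y" (at level 40, left associativity).

(* MathComp rings are unital, whereas C*-algebras need not be, so the product
   is added directly on top of a complex Banach space.  The norm takes its
   values in the nonnegative reals of R[i]. *)
HB.mixin Record CompleteNormedModule_isCStarAlg (R : realType) V
    & CompleteNormedModule R[i] V := {
  cmul : V -> V -> V;
  cstar : V -> V;
  cmulA : associative cmul;
  cmulDl : left_distributive cmul +%R;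
  cmulDr : right_distributive cmul +%R;
  cscaleAl : forall (k : R[i]) x y, k *: cmul x y = cmul (k *: x) y;
  cscaleAr : forall (k : R[i]) x y, k *: cmul x y = cmul x (k *: y);
  cstarK : involutive cstar;
  cstarD : {morph cstar : x y / x + y};
  cstarZ : forall (k : R[i]) x, cstar (k *: x) = Num.conj k *: cstar x;
  cstarM : forall x y, cstar (cmul x y) = cmul (cstar y) (cstar x);
  ler_norm_cmul : forall x y, `|cmul x y| <= `|x| * `|y|;
  norm_cstar_cmul : forall x, `|cmul (cstar x) x| = `|x| ^+ 2
}.

#[short(type="cstarAlgType")]
HB.structure Definition CStarAlg (R : realType) :=
  {V of CompleteNormedModule_isCStarAlg R V & CompleteNormedModule R[i] V}.

Notation "x ** y" := (cmul x y) : ring_scope.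

HB.mixin Record isStarHom (R : realType) (A B : cstarAlgType R)
    (f : A -> B) := {
  starhomM : {morph f : x y / x ** y};
  starhom_star : {morph f : x / cstar x}
}.

HB.structure Definition StarHom (R : realType) (A B : cstarAlgType R) :=
  {f of isStarHom R A B f & @GRing.Linear R[i] A B *:%R f}.

Notation "{ 'starhom' A -> B }" := (StarHom.type A B)
  (at level 0, A at level 98, B at level 99) : type_scope.

Definition cpositive (R : realType) (A : cstarAlgType R) (x : A) : Prop :=
  exists y : A, x = cstar y ** y.

Record cstar_subalgebra (R : realType) (A : cstarAlgType R) (S : set A)
    : Prop := CStarSubalgebra {
  subalg_closed : closed S;
  subalg0 : S 0;
  subalgD : forall x y, S x -> S y -> S (x + y);
  subalgZ : forall (k : R[i]) x, S x -> S (k *: x);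
  subalgM : forall x y, S x -> S y -> S (x ** y);
  subalg_star : forall x, S x -> S (cstar x)
}.

Definition cstar_gen (R : realType) (A : cstarAlgType R) (G : set A) : set A :=
  \bigcap_(S in [set S | cstar_subalgebra S /\ G `<=` S]) S.

(* D is regarded as a subalgebra of A through iota.  Complete positivity is
   automatic, for a positive bimodule map. *)
Record conditional_expectation (R : realType) (A D : cstarAlgType R)
    (iota : {starhom D -> A}) (E : A -> D) : Prop := ConditionalExpectation {
  condexp_linear : linear E;
  condexp_id : forall d, E (iota d) = d;
  condexp_pos : forall x, cpositive x -> cpositive (E x);
  condexp_contr : forall x, `|E x| <= `|x|;
  condexp_modl : forall d x, E (iota d ** x) = d ** E x;
  condexp_modr : forall x d, E (x ** iota d) = E x ** d
}.

Definition faithful (R : realType) (A D : cstarAlgType R) (E : A -> D) : Prop :=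
  forall x, cpositive x -> E x = 0 -> x = 0.

(* (F, sigmaA, sigmaB) is the full amalgamated free product A *_D B; it is
   determined by these properties up to a unique compatible isomorphism. *)
Record full_amalgamated_free_product (R : realType) (A B D : cstarAlgType R)
    (phiA : {starhom D -> A}) (phiB : {starhom D -> B})
    (F : cstarAlgType R) (sigmaA : {starhom A -> F}) (sigmaB : {starhom B -> F})
    : Prop := FullAmalgamatedFreeProduct {
  afp_injl : injective sigmaA;
  afp_injr : injective sigmaB;
  afp_amalg : sigmaA \o phiA = sigmaB \o phiB;
  afp_gen : cstar_gen (range sigmaA `|` range sigmaB) = setT;
  afp_univ : forall (C : cstarAlgType R)
      (piA : {starhom A -> C}) (piB : {starhom B -> C}),
    piA \o phiA = piB \o phiB ->
    exists pi : {starhom F -> C}, pi \o sigmaA = piA /\ pi \o sigmaB = piB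
}.

(* Main.v *)
(* If lambda is injective, then (a dt) b = a (dt b) already holds in A *_D B, and
   one may multiply by (a dt)^* on the left.  So it suffices that an equality
   a b = a' b' in A *_D B implies E_A(a) b = E_A(a') b' in B: the common value
   E_A((a dt)^* a dt) b = E_A((a dt)^* a) (dt b) then lies in both Db and
     D(dt b).

   This implication is read off a representation of A *_D B.  Let K be the GNS
   space of a positive functional on B, and let A and B act on
     K + A'K + B'A'K + A'B'A'K + ...,   A' = ker E_A,  B' = ker E_B,
   tensor products over D being understood: A acts on the sums of the first and
   second, third and fourth, ... summands as on A (x)_D M = M + A'M, and B acts
   on K and on the sums of the second and third, ... summands.  The compression
   of a b to K is then E_A(a) b.  Positivity of the inner product amounts to
   complete positivity of the conditional expectations. *)
Require Import Defs.
From HB Require Import structures.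
From mathcomp Require Import all_boot all_order all_algebra.
From mathcomp Require Import complex.
From mathcomp Require Import all_classical all_reals all_analysis.
From mathcomp Require Import ring lra freeg.
Set Implicit Arguments.
Unset Strict Implicit.
Unset Printing Implicit Defensive.
Import Order.TTheory GRing.Theory Num.Theory.
Import numFieldNormedType.Exports.
Local Open Scope classical_set_scope.
Local Open Scope complex_scope.
Local Open Scope ring_scope.

(** * Adjointable operators *)

(** The universal property only tests against C*-algebras, so the representation has to act by
    bounded operators on a genuine Hilbert space, and a positive functional that does not vanish at
    a given element has to be found; both are built from scratch. Certificates replace spectral
    theory: a sum of polynomials q^2 and X q^2 is nonnegative at every positive operator. The
    families (1 - X)(1 - X^n) and 1 - n X^n (1 - X) serve twice, for y^* y >= 0 in a C*-algebra and
    for complete positivity. The latter is the obstacle, since E is only known to be a positive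
    bimodule map. For vectors m_i = d_i m over one vector m, the bimodule law reduces it to E(z^* z)
    >= 0, but the m_i need not lie over one vector. A negative part of the Gram operator T would
    show in the growth of high powers of 1 - c T, and this growth can be excluded one vector at a
    time and then for sums by the triangle inequality. *)

Section RealNorm.
Context (R : realType).

(** Norms over [R[i]] are complex numbers. [cabs] and [nm] are their real forms, to which infima,
    real square roots and linear arithmetic apply. *)
Definition cabs (k : R[i]) : R := complex.Re `|k|.

Lemma cabsE k : `|k| = (cabs k)%:C.
Proof. by rewrite /cabs RRe_real // ger0_real. Qed.

Lemma cabs_ge0 k : 0 <= cabs k.
Proof. by rewrite -ler0c -cabsE. Qed.

Lemma cabsM k l : cabs (k * l) = cabs k * cabs l.
Proof. by apply: complexI; rewrite rmorphM /= -!cabsE normrM. Qed.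

Lemma cabsD k l : cabs (k + l) <= cabs k + cabs l.
Proof. by rewrite -lecR rmorphD /= -!cabsE ler_normD. Qed.

Lemma cabsN k : cabs (- k) = cabs k.
Proof. by rewrite /cabs normrN. Qed.

Lemma cabs0 : cabs 0 = 0.
Proof. by rewrite /cabs normr0. Qed.

Lemma cabsV k : cabs k^-1 = (cabs k)^-1.
Proof. by apply: complexI; rewrite fmorphV /= -!cabsE normfV. Qed.

Lemma cabs_eq0 k : cabs k = 0 -> k = 0.
Proof. by move=> k0; apply/eqP; rewrite -normr_eq0 cabsE k0. Qed.

Lemma cabs_conj k : cabs k^* = cabs k.
Proof. by rewrite /cabs norm_conjC. Qed.

Lemma cabs_real (r : R) : cabs r%:C = `|r|.
Proof. by rewrite /cabs normc_def /= expr0n addr0 sqrtr_sqr. Qed.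

Definition nm (V : normedModType R[i]) (x : V) : R := complex.Re `|x|.

Context (V : normedModType R[i]).
Implicit Types x y : V.

Lemma nmE x : `|x| = (nm x)%:C.
Proof. by rewrite /nm RRe_real // ger0_real. Qed.

Lemma nm_ge0 x : 0 <= nm x.
Proof. by rewrite -ler0c -nmE. Qed.

Lemma nmD x y : nm (x + y) <= nm x + nm y.
Proof. by rewrite -lecR rmorphD /= -!nmE ler_normD. Qed.

Lemma nmN x : nm (- x) = nm x.
Proof. by rewrite /nm normrN. Qed.

Lemma nmB x y : nm (x - y) <= nm x + nm y.
Proof. by rewrite -(nmN y) nmD. Qed.

Lemma nm_distC x y : nm (x - y) = nm (y - x).
Proof. by rewrite -opprB nmN. Qed.

Lemma nm0 : nm (0 : V) = 0.
Proof. by rewrite /nm normr0. Qed.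

Lemma nm_eq0 x : nm x = 0 -> x = 0.
Proof. by move=> x0; apply/eqP; rewrite -normr_eq0 nmE x0. Qed.

Lemma nmZ (k : R[i]) x : nm (k *: x) = cabs k * nm x.
Proof.
by apply: complexI; rewrite rmorphM /= -!nmE normrZ cabsE.
Qed.

Lemma nmZr (k : R) x : nm (k%:C *: x) = `|k| * nm x.
Proof. by rewrite nmZ cabs_real. Qed.

Lemma nm_small x : (forall e, 0 < e -> nm x <= e) -> x = 0.
Proof.
move=> xe; apply/nm_eq0/le_anti; rewrite nm_ge0 andbT.
by apply/ler_addgt0Pl => e e0; rewrite addr0 xe.
Qed.

Lemma ballnm x y (e : R) : ball x e%:C y <-> nm (x - y) < e.
Proof. by rewrite -ball_normE /= nmE ltcR. Qed.

Lemma cauchy_nmP (F : set_system V) : ProperFilter F ->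
  cauchy F <-> forall e, 0 < e ->
    exists2 A, F A & forall x y, A x -> A y -> nm (x - y) <= e.
Proof.
move=> FF; split=> [/cauchyP Fc e e0|Fc].
  have [|x Fx] := Fc (e / 2)%:C; first by rewrite ltcR divr_gt0.
  exists (ball x (e / 2)%:C) => // y z /ballnm xy /ballnm xz.
  rewrite -(subrKA x) (le_trans (nmD _ _)) // [e]splitr lerD //.
    by rewrite nm_distC ltW.
  exact: ltW.
apply/cauchyP => e e0.
have eE : (complex.Re e)%:C = e by rewrite RRe_real // gtr0_real.
have Re0 : 0 < complex.Re e by rewrite -ltcR eE.
have [|A FA Ae] := Fc (complex.Re e / 2); first by rewrite divr_gt0.
have [x Ax] := filter_ex FA; exists x; rewrite -eE.
apply: filterS FA => y Ay; apply/ballnm; rewrite (le_lt_trans (Ae _ _ Ax Ay))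
  //.
by rewrite ltr_pdivrMr // ltr_pMr // ltr1n.
Qed.

Lemma cvg_nmP (F : set_system V) (y : V) : Filter F ->
  F --> y <-> forall e, 0 < e -> F [set x | nm (y - x) <= e].
Proof.
move=> FF; split=> [/cvgrPdist_le Fy e e0|Fy].
  have := Fy e%:C; rewrite ltcR => /(_ e0); apply: filterS => x.
  by rewrite /= nmE lecR.
apply/cvgrPdist_le => e e0.
have eE : (complex.Re e)%:C = e by rewrite RRe_real // gtr0_real.
have Re0 : 0 < complex.Re e by rewrite -ltcR eE.
by apply: filterS (Fy _ Re0) => x /=; rewrite nmE -[X in _ -> _ <= X]eE lecR.
Qed.

End RealNorm.

(* Bounded adjointable operators for a form [ip] with values in a normed
   module: both the multipliers of a C*-algebra ([ip x y = x^* y]) and the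
   bounded operators on a Hilbert space are of this kind. *)
Record ipspace (R : realType) := IpSpace {
  ipcar :> completeNormedModType R[i];
  ipval : normedModType R[i];
  ip : ipcar -> ipcar -> ipval;
  ipDl : forall x y z, ip (x + y) z = ip x z + ip y z;
  ipDr : forall x y z, ip x (y + z) = ip x y + ip x z;
  ipZl : forall k x y, ip (k *: x) y = Num.conj k *: ip x y;
  ipZr : forall k x y, ip x (k *: y) = k *: ip x y;
  ip_nm : forall x, nm (ip x x) = nm x ^+ 2;
  ip_cs : forall x y, nm (ip x y) <= nm x * nm y
}.

Section Adjop.
Context (R : realType) (E : ipspace R).
Implicit Types x y z : E.

Lemma ip0l y : ip (0 : E) y = 0.
Proof. by rewrite -(scale0r (0 : E)) ipZl conjC0 scale0r. Qed.

Lemma ip0r y : ip y (0 : E) = 0.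
Proof. by rewrite -(scale0r (0 : E)) ipZr scale0r. Qed.

Lemma ipNl x y : ip (- x) y = - ip x y.
Proof. by apply/eqP; rewrite -addr_eq0 -ipDl addNr ip0l. Qed.

Lemma ipNr x y : ip x (- y) = - ip x y.
Proof. by apply/eqP; rewrite -addr_eq0 -ipDr addNr ip0r. Qed.

Lemma ipBl x y z : ip (x - y) z = ip x z - ip y z.
Proof. by rewrite ipDl ipNl. Qed.

Lemma ipBr x y z : ip x (y - z) = ip x y - ip x z.
Proof. by rewrite ipDr ipNr. Qed.

Lemma ip_inj x y : (forall z, ip x z = ip y z) -> x = y.
Proof.
move=> xy; apply/eqP; rewrite -subr_eq0; apply/eqP/nm_eq0/eqP.
by rewrite -sqrf_eq0 -ip_nm {1}ipBl xy subrr nm0.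
Qed.

Lemma ip_injr x y : (forall z, ip z x = ip z y) -> x = y.
Proof.
move=> xy; apply/eqP; rewrite -subr_eq0; apply/eqP/nm_eq0/eqP.
by rewrite -sqrf_eq0 -ip_nm ipBr xy subrr nm0.
Qed.

(** Both halves are stated because the values of [ip] lie in a bare normed module, where no
    hermitian symmetry relates [ip x y] to [ip y x]. *)
Definition adjoint_pair (T S : E -> E) :=
  (forall x y, ip (T x) y = ip x (S y)) /\
  (forall x y, ip (S x) y = ip x (T y)).

Definition opbound (T : E -> E) (M : R) := forall x, nm (T x) <= M * nm x.

Definition adjointable (T : E -> E) :=
  (exists S, adjoint_pair T S) /\ (exists M, opbound T M).

(** The boolean form of the property makes operators a subtype of functions, with extensional
    equality and a choice structure. Linearity is no field: it follows from the adjoint, see [aopD]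
    and [aopZ]. *)
Record adjop := Adjop { aop :> E -> E; aopP : `[< adjointable aop >] }.

HB.instance Definition _ := [isSub for aop].
HB.instance Definition _ := [Choice of adjop by <:].

Lemma adjopP (T S : adjop) : (forall x, T x = S x) -> T = S.
Proof. by move=> TS; apply: val_inj; apply/funext. Qed.

Lemma adjop_adj (T : adjop) : exists S, adjoint_pair T S.
Proof. by have /asboolP[] := aopP T. Qed.

Lemma adjop_bd (T : adjop) : exists M, opbound T M.
Proof. by have /asboolP[] := aopP T. Qed.

(** Since |S x|^2 = |ip x (T (S x))| <= |x| M |S x|, one factor |S x| can be cancelled. *)
Lemma opbound_adj T S M : 0 <= M -> adjoint_pair T S -> opbound T M ->
  opbound S M.
Proof.
move=> M0 [TS ST] TM x.
have [->|Sx0] := eqVneq (nm (S x)) 0; first by rewrite mulr_ge0 ?nm_ge0.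
have Sx : 0 < nm (S x) by rewrite lt0r Sx0 nm_ge0.
rewrite -(ler_pM2r Sx) -expr2 -ip_nm ST (le_trans (ip_cs _ _)) //.
by rewrite mulrAC [M * _ * _]mulrC ler_wpM2l ?nm_ge0.
Qed.

Lemma opbound_max T M : opbound T M -> opbound T (Num.max M 0).
Proof.
move=> TM x; apply: (le_trans (TM x)).
by rewrite ler_wpM2r ?nm_ge0 // le_max lexx.
Qed.

Definition adj_fun (T : adjop) : E -> E := projT1 (cid (adjop_adj T)).

Lemma adj_funP (T : adjop) : adjoint_pair T (adj_fun T).
Proof. by rewrite /adj_fun; case: cid. Qed.

Fact adj_fun_adjointable (T : adjop) : `[< adjointable (adj_fun T) >].
Proof.
apply/asboolP; have [TS ST] := adj_funP T; split; first by exists T.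
have [M TM] := adjop_bd T; exists (Num.max M 0).
apply: opbound_adj (adj_funP T) (opbound_max TM).
by rewrite le_max lexx orbT.
Qed.

Definition adj (T : adjop) := Adjop (adj_fun_adjointable T).

Lemma adjl (T : adjop) x y : ip (T x) y = ip x (adj T y).
Proof. exact: (adj_funP T).1. Qed.

Lemma adjr (T : adjop) x y : ip (adj T x) y = ip x (T y).
Proof. exact: (adj_funP T).2. Qed.

Lemma aopD (T : adjop) x y : T (x + y) = T x + T y.
Proof. by apply: ip_inj => z; rewrite ipDl !adjl ipDl. Qed.

Lemma aopZ (T : adjop) k x : T (k *: x) = k *: T x.
Proof. by apply: ip_inj => z; rewrite ipZl !adjl ipZl. Qed.

Lemma aop0 (T : adjop) : T 0 = 0.
Proof. by have := aopZ T 0 0; rewrite !scale0r. Qed.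

Fact op_zero_subproof : `[< adjointable (fun=> 0) >].
Proof.
apply/asboolP; split.
  by exists (fun=> 0); split=> x y; rewrite ip0l ip0r.
by exists 0 => x; rewrite nm0 mul0r.
Qed.
Fact op_one_subproof : `[< adjointable id >].
Proof.
by apply/asboolP; split; [exists id|exists 1 => x; rewrite mul1r].
Qed.
Fact op_opp_subproof (T : adjop) : `[< adjointable (fun x => - T x) >].
Proof.
apply/asboolP; split.
  by exists (fun x => - adj T x); split=> x y; rewrite ipNl ipNr ?adjr ?adjl.
by have [M TM] := adjop_bd T; exists M => x; rewrite nmN.
Qed.
Fact op_add_subproof (T S : adjop) : `[< adjointable (fun x => T x + S x) >].
Proof.
apply/asboolP; split.
  exists (fun x => adj T x + adj S x).
  by split=> x y; rewrite ipDl ipDr ?adjr ?adjl.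
have [M TM] := adjop_bd T; have [N SN] := adjop_bd S; exists (M + N) => x.
by rewrite (le_trans (nmD _ _)) // mulrDl lerD.
Qed.
Fact op_scale_subproof k (T : adjop) : `[< adjointable (fun x => k *: T x) >].
Proof.
apply/asboolP; split.
  exists (fun x => Num.conj k *: adj T x).
  by split=> x y; rewrite ipZl ipZr ?conjCK ?adjr ?adjl.
have [M TM] := adjop_bd T; exists (cabs k * M) => x.
by rewrite nmZ -mulrA ler_wpM2l ?cabs_ge0.
Qed.
Fact op_mul_subproof (T S : adjop) : `[< adjointable (fun x => T (S x)) >].
Proof.
apply/asboolP; split.
  by exists (fun x => adj S (adj T x)); split=> x y; rewrite ?adjr ?adjl.
have [M TM] := adjop_bd T; have [N SN] := adjop_bd S.
exists (Num.max M 0 * N) => x.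
rewrite (le_trans (opbound_max TM _)) // -mulrA ler_wpM2l //.
by rewrite le_max lexx orbT.
Qed.

Definition op_zero := Adjop op_zero_subproof.
Definition op_one := Adjop op_one_subproof.
Definition op_opp T := Adjop (op_opp_subproof T).
Definition op_add T S := Adjop (op_add_subproof T S).
Definition op_scale k T := Adjop (op_scale_subproof k T).
Definition op_mul T S := Adjop (op_mul_subproof T S).

Fact op_addA : associative op_add.
Proof. by move=> T S U; apply: adjopP => x /=; rewrite addrA. Qed.
Fact op_addC : commutative op_add.
Proof. by move=> T S; apply: adjopP => x /=; rewrite addrC. Qed.
Fact op_add0 : left_id op_zero op_add.
Proof. by move=> T; apply: adjopP => x /=; rewrite add0r. Qed.
Fact op_addN : left_inverse op_zero op_opp op_add.
Proof. by move=> T; apply: adjopP => x /=; rewrite addNr. Qed.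

HB.instance Definition _ := GRing.isZmodule.Build adjop op_addA op_addC op_add0
  op_addN.

Fact op_scaleA a b T : op_scale a (op_scale b T) = op_scale (a * b) T.
Proof. by apply: adjopP => x /=; rewrite scalerA. Qed.
Fact op_scale1 : left_id 1 op_scale.
Proof. by move=> T; apply: adjopP => x /=; rewrite scale1r. Qed.
Fact op_scaleDr : right_distributive op_scale +%R.
Proof. by move=> k T S; apply: adjopP => x /=; rewrite scalerDr. Qed.
Fact op_scaleDl T : {morph op_scale^~ T : a b / a + b}.
Proof. by move=> a b; apply: adjopP => x /=; rewrite scalerDl. Qed.

HB.instance Definition _ :=
  GRing.Zmodule_isLmodule.Build R[i] adjop op_scaleA op_scale1 op_scaleDr
    op_scaleDl.

Lemma aopE_add (T S : adjop) x : (T + S) x = T x + S x. Proof. by []. Qed.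
Lemma aopE_opp (T : adjop) x : (- T) x = - T x. Proof. by []. Qed.

Definition opn (T : adjop) : R := inf [set M | 0 <= M /\ opbound T M].

Lemma opn_has_inf (T : adjop) : has_inf [set M | 0 <= M /\ opbound T M].
Proof.
split; last by exists 0 => M [].
have [M TM] := adjop_bd T; exists (Num.max M 0); split.
  by rewrite le_max lexx orbT.
exact: opbound_max.
Qed.

Lemma opn_ge0 (T : adjop) : 0 <= opn T.
Proof. by apply: lb_le_inf => [|M []//]; case: (opn_has_inf T). Qed.

Lemma opn_le (T : adjop) M : 0 <= M -> opbound T M -> opn T <= M.
Proof. by move=> M0 TM; apply: ge_inf; [case: (opn_has_inf T)|]. Qed.

Lemma opnP (T : adjop) x : nm (T x) <= opn T * nm x.
Proof.
have [/nm_eq0 ->|x0] := eqVneq (nm x) 0; first by rewrite aop0 nm0 mulr0.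
have xp : 0 < nm x by rewrite lt0r x0 nm_ge0.
rewrite -ler_pdivrMr //; apply: lb_le_inf; first by case: (opn_has_inf T).
by move=> M [_ TM]; rewrite ler_pdivrMr.
Qed.


Fact opn_normD T S : (opn (T + S))%:C <= (opn T)%:C + (opn S)%:C :> R[i].
Proof.
rewrite -rmorphD lecR; apply: opn_le; first by rewrite addr_ge0 ?opn_ge0.
by move=> x; rewrite (le_trans (nmD _ _)) // mulrDl lerD ?opnP.
Qed.

Fact opn_eq0 T : (opn T)%:C = 0 :> R[i] -> T = 0.
Proof.
move=> /complexI T0; apply: adjopP => x; apply: nm_eq0; apply/le_anti.
by rewrite nm_ge0 andbT (le_trans (opnP _ _)) // T0 mul0r.
Qed.

Lemma opnZ_le k T : opn (k *: T) <= cabs k * opn T.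
Proof.
apply: opn_le => [|x]; first by rewrite mulr_ge0 ?cabs_ge0 ?opn_ge0.
by rewrite nmZ -mulrA ler_wpM2l ?opnP ?cabs_ge0.
Qed.

Fact opn_normZ (k : R[i]) T : (opn (k *: T))%:C = `|k| * (opn T)%:C :> R[i].
Proof.
rewrite cabsE -rmorphM; congr (_ %:C); apply/le_anti; rewrite opnZ_le /=.
have [->|k0] := eqVneq k 0; first by rewrite cabs0 mul0r opn_ge0.
have kp : 0 < cabs k by rewrite lt0r cabs_ge0 andbT; apply: contraNneq k0 =>
  /cabs_eq0->.
have := opnZ_le k^-1 (k *: T).
by rewrite scalerA mulVf // scale1r cabsV mulrC ler_pdivlMr // mulrC.
Qed.

HB.instance Definition _ := Lmodule_isNormed.Build R[i] adjop
  opn_normD opn_normZ opn_eq0.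

Lemma nm_opn (T : adjop) : nm T = opn T.
Proof. by []. Qed.

Lemma aop_nm (T : adjop) x : nm (T x) <= nm T * nm x.
Proof. by rewrite nm_opn opnP. Qed.

Lemma aop_nm_le (T : adjop) M : 0 <= M -> opbound T M -> nm T <= M.
Proof. by move=> ? ?; rewrite nm_opn opn_le. Qed.

Lemma opn_adj_le (T : adjop) : nm (adj T) <= nm T.
Proof.
apply: aop_nm_le; rewrite ?nm_ge0 //.
by apply: opbound_adj (adj_funP T) _; [rewrite nm_ge0|exact: aop_nm].
Qed.

Lemma adjK (T : adjop) : adj (adj T) = T.
Proof. by apply: adjopP => x; apply: ip_injr => z; rewrite -adjl adjr. Qed.

Lemma adj_nm (T : adjop) : nm (adj T) = nm T.
Proof. by apply/le_anti; rewrite opn_adj_le /= -{1}(adjK T) opn_adj_le. Qed.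

Lemma adj_eq (T S : adjop) : (forall x y, ip (T x) y = ip x (S y)) -> adj T = S.
Proof.
by move=> TS; apply: adjopP => y; apply: ip_injr => z; rewrite -adjl TS.
Qed.

Lemma adj_add : {morph adj : T S / T + S}.
Proof. by move=> T S; apply: adj_eq => x y; rewrite ipDl ipDr !adjl. Qed.

Lemma adj_opp : {morph adj : T / - T}.
Proof. by move=> T; apply: adj_eq => x y; rewrite ipNl ipNr !adjl. Qed.

(** For a Cauchy filter both T x and [adj T x] converge at every x. The two pointwise limits are
    again adjoint to each other, and the uniform Cauchy estimate survives pointwise limits, which
    gives boundedness and convergence in norm. *)
Fact adjop_complete (F : set_system adjop) :
  ProperFilter F -> cauchy F -> cvg F.
Proof.
move=> FF /cauchy_nmP Fc.
(* The isometry [g] stands for [id] or [adj], so that one argument yields the limit operator and the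
   limit of the adjoints. *)
have pt_F (g : adjop -> adjop) x : {morph g : T S / T - S} ->
    (forall T, nm (g T) = nm T) -> cvg ((fun T : adjop => g T x) @ F).
  move=> gB g_nm; apply: cauchy_cvg; apply/cauchy_nmP => e e0.
  have [|A FA Ae] := Fc (e / (nm x + 1)).
    by rewrite divr_gt0 // ltr_wpDl ?nm_ge0.
  exists [set y | exists2 T : adjop, A T & y = g T x].
    by apply: (@filterS _ F _ A) => // T AT; exists T.
  move=> _ _ [T AT ->] [S AS ->]; rewrite -aopE_opp -aopE_add -gB.
  rewrite (le_trans (aop_nm _ _)) // g_nm.
  rewrite (@le_trans _ _ (e / (nm x + 1) * nm x)) ?ler_wpM2r ?nm_ge0 ?Ae //.
  rewrite mulrAC ler_pdivrMr ?ltr_wpDl ?nm_ge0 //.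
  by rewrite ler_wpM2l ?lerDl // ltW.
pose limit (g : adjop -> adjop) x := lim ((fun T : adjop => g T x) @ F).
have limitF (g : adjop -> adjop) x e : {morph g : T S / T - S} ->
    (forall T, nm (g T) = nm T) -> 0 < e ->
    F [set T : adjop | nm (limit g x - g T x) <= e].
  by move=> gB g_nm e0; have /cvg_nmP := pt_F g x gB g_nm; apply.
pose L := limit id; pose L' := limit adj.
have LF x e : 0 < e -> F [set T : adjop | nm (L x - T x) <= e].
  exact: (limitF id).
have L'F x e : 0 < e -> F [set T : adjop | nm (L' x - adj T x) <= e].
  by apply: (limitF adj) => [T S|T]; [rewrite adj_add adj_opp|exact: adj_nm].
have limit_adj (g g' : adjop -> adjop) x y :
    (forall x e, 0 < e -> F [set T : adjop | nm (limit g x - g T x) <= e]) ->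
    (forall x e, 0 < e -> F [set T : adjop | nm (limit g' x - g' T x) <= e]) ->
    (forall T, ip (g T x) y = ip x (g' T y)) ->
    ip (limit g x) y = ip x (limit g' y).
  move=> gF g'F gg'; apply/eqP; rewrite -subr_eq0; apply/eqP/nm_small => e e0.
  pose d := e / (nm x + nm y + 1).
  have d0 : 0 < d by rewrite divr_gt0 // ltr_wpDl ?addr_ge0 ?nm_ge0.
  have [T [/= gT g'T]] := filter_ex (filterI (gF x d d0) (g'F y d d0)).
  have -> : ip (limit g x) y - ip x (limit g' y) =
      ip (limit g x - g T x) y - ip x (limit g' y - g' T y).
    by rewrite ipBl ipBr gg' opprB addrA subrK.
  rewrite (le_trans (nmB _ _)) // (@le_trans _ _ (d * nm y + nm x * d)) //.
    rewrite lerD // (le_trans (ip_cs _ _)) //;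
      first by rewrite ler_wpM2r ?nm_ge0.
    by rewrite ler_wpM2l ?nm_ge0.
  rewrite [nm x * d]mulrC -mulrDr /d mulrAC ler_pdivrMr.
    by rewrite ler_wpM2l ?(ltW e0) // [nm y + _]addrC lerDl.
  by rewrite ltr_wpDl ?addr_ge0 ?nm_ge0.
have LL' x y : ip (L x) y = ip x (L' y).
  by apply: limit_adj => // T; exact: adjl.
have L'L x y : ip (L' x) y = ip x (L y).
  by apply: limit_adj => // T; exact: adjr.
have LA e A : 0 < e -> F A ->
  (forall T S : adjop, A T -> A S -> nm (T - S) <= e) ->
    forall T, A T -> forall x, nm (L x - T x) <= e * nm x.
  move=> e0 FA Ae T AT x; apply/ler_addgt0Pl => d d0.
  have [S [/= LS AS]] := filter_ex (filterI (LF x d d0) FA).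
  rewrite -(subrKA (S x)) (le_trans (nmD _ _)) // lerD //.
  rewrite -aopE_opp -aopE_add (le_trans (aop_nm _ _)) // ler_wpM2r ?nm_ge0 //.
  exact: Ae.
have Ladj : `[< adjointable L >].
  apply/asboolP; split; first by exists L'.
  have [A FA A1] := Fc 1 ltr01; have [T AT] := filter_ex FA.
  exists (1 + nm T) => x; rewrite -(subrK (T x) (L x)) (le_trans (nmD _ _)) //.
  by rewrite mulrDl lerD ?aop_nm // (LA _ _ ltr01 FA A1).
apply/cvg_ex; exists (Adjop Ladj); apply/cvg_nmP => e e0.
have [A FA Ae] := Fc e e0; apply: (@filterS _ F _ A) => // T AT /=.
by apply: aop_nm_le; [exact: ltW|exact: (LA e A e0 FA Ae T AT)].
Qed.

HB.instance Definition _ := Uniform_isComplete.Build adjop adjop_complete.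

Fact adj_mulA : associative op_mul.
Proof. by move=> T S U; apply: adjopP. Qed.
Fact adj_mulDl : left_distributive op_mul +%R.
Proof. by move=> T S U; apply: adjopP. Qed.
Fact adj_mulDr : right_distributive op_mul +%R.
Proof. by move=> T S U; apply: adjopP => x; rewrite /= -aopD. Qed.
Fact adj_scaleAl k (T S : adjop) : k *: op_mul T S = op_mul (k *: T) S.
Proof. by apply: adjopP. Qed.
Fact adj_scaleAr k (T S : adjop) : k *: op_mul T S = op_mul T (k *: S).
Proof. by apply: adjopP => x; rewrite /= -aopZ. Qed.
Fact adj_scale k (T : adjop) : adj (k *: T) = Num.conj k *: adj T.
Proof. by apply: adj_eq => x y; rewrite ipZl ipZr adjl. Qed.
Fact adj_mul (T S : adjop) : adj (op_mul T S) = op_mul (adj S) (adj T).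
Proof. by apply: adj_eq => x y; rewrite /= !adjl. Qed.
Fact adj_nm_mul (T S : adjop) : nm (op_mul T S) <= nm T * nm S.
Proof.
apply: aop_nm_le => [|x]; first by rewrite mulr_ge0 ?nm_ge0.
by rewrite (le_trans (aop_nm T _)) // -mulrA ler_wpM2l ?nm_ge0 ?aop_nm.
Qed.
Fact adj_norm_mul (T S : adjop) : `|op_mul T S| <= `|T| * `|S|.
Proof. by rewrite !nmE -rmorphM lecR adj_nm_mul. Qed.
(** Only [ip_cs] is involved: |T x|^2 = |ip x (T^* T x)| <= |T^* T| |x|^2, so the square root of
    |T^* T| is a bound for T. *)
Fact adj_norm_star (T : adjop) : `|op_mul (adj T) T| = `|T| ^+ 2.
Proof.
rewrite !nmE -rmorphXn; congr (_%:C); apply/le_anti/andP; split.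
  by rewrite (le_trans (adj_nm_mul _ _)) // adj_nm.
rewrite -[leRHS]sqr_sqrtr ?nm_ge0 // ler_pXn2r ?nnegrE ?sqrtr_ge0 ?nm_ge0 //.
apply: aop_nm_le => [|x]; first exact: sqrtr_ge0.
rewrite -(@ler_pXn2r _ 2) ?nnegrE ?mulr_ge0 ?sqrtr_ge0 ?nm_ge0 //.
rewrite exprMn sqr_sqrtr ?nm_ge0 // -ip_nm adjl (le_trans (ip_cs _ _)) //.
rewrite mulrC [in leRHS]expr2 mulrA ler_wpM2r ?nm_ge0 //.
exact: (aop_nm (op_mul (adj T) T)).
Qed.

HB.instance Definition _ := CompleteNormedModule_isCStarAlg.Build R adjop
  adj_mulA adj_mulDl adj_mulDr adj_scaleAl adj_scaleAr adjK adj_add adj_scale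
  adj_mul adj_norm_mul adj_norm_star.

End Adjop.

(** * Positivity in C*-algebras *)

Lemma geometric_small (R : realType) (q d : R) : 0 <= q < 1 -> 0 < d ->
  exists n, q ^+ n <= d.
Proof.
move=> /andP[q0 q1] d0.
have /cvgrPdist_le/(_ d d0)[n _ nd] : (geometric 1 q) @ \oo --> (0 : R).
  by apply: cvg_geometric; rewrite ger0_norm.
exists n; have := nd n (leqnn _).
by rewrite /= sub0r normrN mul1r ger0_norm ?exprn_ge0.
Qed.

Section SeqComplete.
Context (R : realType) (V : completeNormedModType R[i]).

Lemma seq_complete (y : nat -> V) :
  (forall e, 0 < e -> exists n, forall m, (n <= m)%N -> nm (y m - y n) <= e) ->
  exists l, forall e, 0 < e ->
    exists n, forall m, (n <= m)%N -> nm (l - y m) <= e.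
Proof.
move=> yc; have : cvg (y @ \oo).
  apply: cauchy_cvg; apply/cauchy_nmP => e e0.
  have [|n nP] := yc (e / 2); first by rewrite divr_gt0.
  exists [set y m | m in [set m | n <= m]%N].
    by exists n => // m /= nm; exists m.
  move=> _ _ [m nm <-] [p np <-]; rewrite -(subrKA (y n)) (le_trans (nmD _ _))
    //.
  by rewrite [e]splitr lerD ?nP // nm_distC nP.
move=> /cvg_ex[l /cvg_nmP yl]; exists l => e e0.
by have [n _ nP] := yl e e0; exists n => m /nP.
Qed.

Lemma geom_complete (y : nat -> V) (c q : R) : 0 <= q < 1 ->
  (forall n, nm (y n.+1 - y n) <= c * q ^+ n) ->
  exists l, forall e, 0 < e ->
    exists n, forall m, (n <= m)%N -> nm (l - y m) <= e.
Proof.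
move=> /[dup] q01 /andP[q0 q1] yq; apply: seq_complete => e e0.
have q1' : 0 < 1 - q by rewrite subr_gt0.
have c0 : 0 <= c.
  by have := yq 0%N; rewrite expr0 mulr1; apply: le_trans; exact: nm_ge0.
(* Once q^n is below this number, the geometric tail c q^n / (1 - q) is at most e; [c + 1] avoids a
   division by zero. *)
have d0 : 0 < e * (1 - q) / (c + 1) by rewrite divr_gt0 ?mulr_gt0 // ltr_wpDl.
have [n nP] := geometric_small q01 d0.
exists n => m nm.
have {m nm} [m ->] : exists p, m = (n + p)%N by exists (m - n)%N;
  rewrite subnKC.
have : nm (y (n + m)%N - y n) <= c * q ^+ n * (1 - q ^+ m) / (1 - q).
  elim: m => [|m ih]; first by rewrite addn0 subrr nm0 expr0 subrr mulr0 mul0r.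
  rewrite addnS -(subrKA (y (n + m)%N)) (le_trans (nmD _ _)) //.
  rewrite (le_trans (lerD (yq _) ih)) // ler_pdivlMr // mulrDl divfK ?gt_eqF //.
  rewrite exprD exprS; lra.
move=> /le_trans -> //; rewrite ler_pdivrMr //.
rewrite (@le_trans _ _ (c * q ^+ n)) //.
  by rewrite ler_piMr ?mulr_ge0 ?exprn_ge0 // gerBl exprn_ge0.
rewrite (le_trans (ler_wpM2l c0 nP)) // mulrA ler_pdivrMr ?ltr_wpDl //.
by rewrite mulrC ler_wpM2l ?mulr_ge0 // ?lerDl // ltW.
Qed.

End SeqComplete.

(** * Norm, adjoint and square roots in a C*-algebra without unit *)

Section CStarBasics.
Context (R : realType) (A : cstarAlgType R).
Implicit Types x y z : A.

Lemma cmul0r x : 0 ** x = 0.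
Proof. by apply: (addrI (0 ** x)); rewrite -cmulDl !addr0. Qed.
Lemma cmulr0 x : x ** 0 = 0.
Proof. by apply: (addrI (x ** 0)); rewrite -cmulDr !addr0. Qed.
Lemma cmulNl x y : (- x) ** y = - (x ** y).
Proof. by apply/eqP; rewrite -addr_eq0 -cmulDl addNr cmul0r. Qed.
Lemma cmulNr x y : x ** (- y) = - (x ** y).
Proof. by apply/eqP; rewrite -addr_eq0 -cmulDr addNr cmulr0. Qed.
Lemma cmulBl x y z : (x - y) ** z = x ** z - y ** z.
Proof. by rewrite cmulDl cmulNl. Qed.
Lemma cmulBr x y z : x ** (y - z) = x ** y - x ** z.
Proof. by rewrite cmulDr cmulNr. Qed.
Lemma cstar0 : cstar 0 = 0 :> A.
Proof. by apply: (addrI (cstar (0 : A))); rewrite -cstarD !addr0. Qed.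
Lemma cstarN x : cstar (- x) = - cstar x.
Proof. by apply/eqP; rewrite -addr_eq0 -cstarD addNr cstar0. Qed.
Lemma cstarB x y : cstar (x - y) = cstar x - cstar y.
Proof. by rewrite cstarD cstarN. Qed.
Lemma conjCR (r : R) : Num.conj (r%:C) = r%:C :> R[i].
Proof. by rewrite conj_Creal // complex_real. Qed.
Lemma cstarZR (r : R) x : cstar (r%:C *: x) = r%:C *: cstar x.
Proof. by rewrite cstarZ conjCR. Qed.

Lemma nm_cmul x y : nm (x ** y) <= nm x * nm y.
Proof. by rewrite -lecR rmorphM /= -!nmE ler_norm_cmul. Qed.
Lemma nm_cstar_cmul x : nm (cstar x ** x) = nm x ^+ 2.
Proof. by apply: complexI; rewrite rmorphXn /= -!nmE norm_cstar_cmul. Qed.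
Lemma nm_cstar x : nm (cstar x) = nm x.
Proof.
suff le y : nm y <= nm (cstar y) by apply/le_anti;
  rewrite le andbT -{2}(cstarK x) le.
have [->|y0] := eqVneq (nm y) 0; first exact: nm_ge0.
have yp : 0 < nm y by rewrite lt0r y0 nm_ge0.
by rewrite -(ler_pM2r yp) -expr2 -nm_cstar_cmul nm_cmul.
Qed.
Lemma nm_cmul_cstar x : nm (x ** cstar x) = nm x ^+ 2.
Proof. by rewrite -{1}(cstarK x) nm_cstar_cmul nm_cstar. Qed.
Lemma nm_csqr x : cstar x = x -> nm (x ** x) = nm x ^+ 2.
Proof. by move=> xs; rewrite -nm_cstar_cmul xs. Qed.
Lemma cstar_cmul_eq0 x : cstar x ** x = 0 -> x = 0.
Proof. by move=> x0; apply/nm_eq0/eqP; rewrite -sqrf_eq0 -nm_cstar_cmul x0 nm0.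
  Qed.

(* [s] plays the role of 1 - (1 - x)^(1/2), which exists without a unit. *)
Lemma qsqrt x : cstar x = x -> nm x < 1 -> exists s,
  [/\ cstar s = s, s + s - s ** s = x & forall z, z ** x = x ** z -> z ** s =
    s ** z].
Proof.
move=> xs x1.
(* A fixed point of [T] satisfies 2 s - s^2 = x. The radius [q] is the smaller root of t^2 - 2 t +
   |x|, so [T] maps the ball of radius [q] into itself and contracts by the factor [q] there. *)
pose T s := 2^-1 *: (x + s ** s).
pose y n := iter n T 0.
pose q := 1 - Num.sqrt (1 - nm x).
have s0 : 0 <= Num.sqrt (1 - nm x) by exact: sqrtr_ge0.
have x0 := nm_ge0 x.
have sE : Num.sqrt (1 - nm x) ^+ 2 = 1 - nm x by rewrite sqr_sqrtr // subr_ge0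
  ltW.
have sp : 0 < Num.sqrt (1 - nm x) by rewrite sqrtr_gt0 subr_gt0.
have s1 : Num.sqrt (1 - nm x) <= 1.
  by rewrite -[leRHS]sqrtr1 ler_wsqrtr // lerBlDr lerDl.
have q01 : 0 <= q < 1 by rewrite /q; apply/andP; split; lra.
have /andP[q0 q1] := q01.
have qE : nm x + q ^+ 2 = 2 * q by rewrite /q sqrrB sE; lra.
have halfE : (2^-1 : R[i]) = (2^-1 : R)%:C by rewrite fmorphV rmorph_nat.
have nmT s : nm (T s) = 2^-1 * nm (x + s ** s).
  by rewrite /T halfE nmZr ger0_norm.
have yq n : nm (y n) <= q.
  elim: n => [|n ih]; first by rewrite /= nm0.
  rewrite /y iterS -/(y n) nmT.
  have := nmD x (y n ** y n); have := nm_cmul (y n) (y n).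
  have : nm (y n) * nm (y n) <= q ^+ 2 by rewrite expr2 ler_pM ?nm_ge0.
  lra.
have dist s t : nm s <= q -> nm t <= q -> nm (T s - T t) <= q * nm (s - t).
  move=> sq tq; rewrite /T -scalerBr halfE nmZr ger0_norm //.
  have -> : x + s ** s - (x + t ** t) = s ** (s - t) + (s - t) ** t.
    by rewrite cmulBr cmulBl subrKA opprD addrACA subrr add0r.
  have := nmD (s ** (s - t)) ((s - t) ** t).
  have := nm_cmul s (s - t); have := nm_cmul (s - t) t.
  have := nm_ge0 (s - t) => d0.
  have := ler_wpM2r d0 sq; have := ler_wpM2l d0 tq; lra.
have ydist n : nm (y n.+1 - y n) <= nm (y 1%N) * q ^+ n.
  elim: n => [|n ih]; first by rewrite expr0 mulr1 /y /= subr0.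
  rewrite /y iterS [in X in _ - X]iterS -/(y _) -/(y _).
  by rewrite (le_trans (dist _ _ _ _)) // exprS mulrCA ler_wpM2l.
have [s ys] := geom_complete q01 ydist.
have nms : nm s <= q.
  apply/ler_addgt0Pl => e e0; have [n /(_ n (leqnn _)) sn] := ys e e0.
  by rewrite -(subrK (y n) s) (le_trans (nmD _ _)) // lerD.
(* Lipschitz identities pass from the iterates to their limit; this gives self-adjointness and
   commutation of [s]. *)
have closedP (f : A -> A) c : 0 <= c ->
  (forall u v, nm (f u - f v) <= c * nm (u - v)) ->
    (forall n, f (y n) = 0) -> f s = 0.
  move=> c0 fc f0; apply: nm_small => e e0.
  have [|n /(_ n (leqnn _)) sn] := ys (e / (c + 1)).
    by rewrite divr_gt0 // ltr_wpDl.
  rewrite -(subr0 (f s)) -(f0 n) (le_trans (fc _ _)) //.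
  rewrite (le_trans (ler_wpM2l c0 sn)) // mulrA ler_pdivrMr ?ltr_wpDl //.
  by rewrite mulrC ler_wpM2l ?lerDl // ltW.
have ys_sa n : cstar (y n) = y n.
  elim: n => [|n ih]; first exact: cstar0.
  by rewrite /y iterS -/(y n) /T halfE cstarZR cstarD cstarM ih xs.
have Ts : T s = s.
  apply/eqP; rewrite -subr_eq0; apply/eqP/nm_small => e e0.
  have [|n nP] := ys (e / 2); first by rewrite divr_gt0.
  have -> : T s - s = (T s - T (y n)) - (s - y n.+1).
    by rewrite [y n.+1]/y iterS -/(y n) opprB addrA subrK.
  rewrite (le_trans (nmB _ _)) // [e]splitr lerD ?nP //.
  rewrite (le_trans (dist _ _ _ _)) // (le_trans _ (nP n _)) //.
  by rewrite ler_piMl ?nm_ge0 // ltW.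
exists s; split.
- apply/eqP; rewrite -subr_eq0; apply/eqP.
  apply: (closedP (fun s => cstar s - s) 2) => // [u v|n];
    last by rewrite ys_sa subrr.
  have -> : cstar u - u - (cstar v - v) = cstar (u - v) - (u - v).
    by rewrite cstarB !opprB [LHS]addrACA [RHS]addrACA; congr (_ + _);
      rewrite addrC.
  by rewrite (le_trans (nmB _ _)) // nm_cstar mulr_natl mulr2n.
- have : 2 *: s = x + s ** s by rewrite -{1}Ts /T scalerA divff // scale1r.
  by rewrite scaler_nat mulr2n => ->; rewrite addrK.
- move=> z zx; apply/eqP; rewrite -subr_eq0; apply/eqP.
  apply: (closedP (fun s => z ** s - s ** z) (2 * nm z)) => [|u v|n].
  + by rewrite mulr_ge0 // nm_ge0.
  + have -> : z ** u - u ** z - (z ** v - v ** z) = z ** (u - v) - (u - v) ** z.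
      by rewrite cmulBl cmulBr !opprB [LHS]addrACA [RHS]addrACA; congr (_ + _);
        rewrite addrC.
    have := nmB (z ** (u - v)) ((u - v) ** z).
    have := nm_cmul z (u - v); have := nm_cmul (u - v) z; lra.
  + apply/eqP; rewrite subr_eq0; apply/eqP.
    elim: n => [|n ih]; first by rewrite /y /= cmulr0 cmul0r.
    rewrite /y iterS -/(y n) /T -cscaleAl -cscaleAr cmulDl cmulDr zx;
      congr (_ *: (_ + _)).
    by rewrite cmulA ih -cmulA ih cmulA.
Qed.

End CStarBasics.

Section PolyEval.
Context (R : realType) (V : lmodType R[i]) (T : V -> V).
Hypothesis TD : forall u v, T (u + v) = T u + T v.
Hypothesis TZ : forall k v, T (k *: v) = k *: T v.
Implicit Types p q : {poly R}.

(** This is p(T) v. It is used for [T] a left multiplication in an algebra, and for [T] an operator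
    on a semi-inner product space. *)
Definition pev p v : V := \sum_(i < size p) (p`_i)%:C *: iter i T v.

Let T0 : T 0 = 0. Proof. by rewrite -(scale0r (0 : V)) TZ !scale0r. Qed.

Lemma pev_widen n p v : (size p <= n)%N ->
  pev p v = \sum_(i < n) (p`_i)%:C *: iter i T v.
Proof.
move=> pn; rewrite /pev (big_ord_widen n (fun i => (p`_i)%:C *: iter i T v)) //.
rewrite big_mkcond; apply: eq_bigr => i _; case: ifP => // /negbT.
by rewrite -leqNgt => pi; rewrite nth_default // scale0r.
Qed.

Lemma pevD p q v : pev (p + q) v = pev p v + pev q v.
Proof.
pose n := maxn (size p) (size q).
rewrite (@pev_widen n) ?size_polyD // (@pev_widen n p) ?leq_maxl //.
rewrite (@pev_widen n q) ?leq_maxr // -big_split; apply: eq_bigr => i _ /=.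
by rewrite coefD rmorphD scalerDl.
Qed.

Lemma pevZ (k : R) p v : pev (k *: p) v = k%:C *: pev p v.
Proof.
rewrite (@pev_widen (size p)) ?size_scale_leq // scaler_sumr.
by apply: eq_bigr => i _; rewrite coefZ rmorphM scalerA.
Qed.

Lemma pev0 v : pev 0 v = 0.
Proof. by rewrite /pev size_poly0 big_ord0. Qed.

Lemma pevN p v : pev (- p) v = - pev p v.
Proof. by rewrite -(scaleN1r p) pevZ rmorphN rmorph1 scaleN1r. Qed.

Lemma pev1 v : pev 1 v = v.
Proof. by rewrite /pev size_poly1 big_ord1 coefC eqxx scale1r. Qed.

Lemma pevXM p v : pev ('X * p) v = T (pev p v).
Proof.
have Tsum (n : nat) (F : nat -> V) : T (\sum_(i < n) F i) =
  \sum_(i < n) T (F i).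
  by elim: n => [|n ih]; rewrite ?big_ord0 // !big_ord_recr TD ih.
rewrite (@pev_widen (size p).+1); last first.
  by rewrite (leq_trans (size_polyMleq _ _)) // size_polyX.
rewrite big_ord_recl coefXM eqxx scale0r add0r /pev.
rewrite (Tsum _ (fun i => (p`_i)%:C *: iter i T v)).
by apply: eq_bigr => i _; rewrite coefXM /= TZ.
Qed.

Lemma pevXnM n p v : pev ('X^n * p) v = iter n T (pev p v).
Proof. by elim: n => [|n ih]; rewrite ?expr0 ?mul1r // exprS -mulrA pevXM ih.
  Qed.

Lemma pev_sum (n : nat) (F : nat -> {poly R}) v :
  pev (\sum_(i < n) F i) v = \sum_(i < n) pev (F i) v.
Proof. by elim: n => [|n ih]; rewrite ?big_ord0 ?pev0 // !big_ord_recr pevD ih.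
  Qed.

Lemma pevM p q v : pev (p * q) v = pev p (pev q v).
Proof.
rewrite -{1}(coefK p) poly_def mulr_suml
  (pev_sum _ (fun i => p`_i *: 'X^i * q)).
by apply: eq_bigr => i _; rewrite -scalerAl pevZ pevXnM.
Qed.

Lemma pevX v : pev 'X v = T v.
Proof. by rewrite -['X]mulr1 pevXM pev1. Qed.

End PolyEval.

(* Certificates of nonnegativity on the half line: the quadratic module
   generated by ['X]. *)
Inductive qmod (R : realType) : {poly R} -> Prop :=
| qmod_sq q : qmod (q ^+ 2)
| qmod_Xsq q : qmod ('X * q ^+ 2)
| qmod_add p q : qmod p -> qmod q -> qmod (p + q).

Section Qmod.
Context (R : realType).
Implicit Types p q : {poly R}.

Lemma qmodX p : qmod p -> qmod ('X * p).
Proof.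
elim=> [q|q|{}p q _ pP _ qP]; first exact: qmod_Xsq.
  by rewrite mulrA -expr2 -exprMn; exact: qmod_sq.
by rewrite mulrDr; exact: qmod_add.
Qed.

(** Both factors change sign at 1, and the product is (1 - X)^2 (1 + X + ... + X^(n-1)). *)
Lemma qmod_geom n : qmod ((1 - 'X) * (1 - 'X^n) : {poly R}).
Proof.
elim: n => [|n ih].
  by have := qmod_sq (0 : {poly R}); rewrite expr0n expr0 subrr mulr0.
rewrite (_ : _ * _ = 'X * ((1 - 'X) * (1 - 'X^n)) + (1 - 'X) ^+ 2); last first.
  by rewrite exprS; ring.
by apply: qmod_add; [exact: qmodX|exact: qmod_sq].
Qed.

(* [x ^ n (1 - x) <= 1 / n] for [0 <= x]. *)
Lemma qmod_peak n : qmod (1 - n%:R *: ('X^n * (1 - 'X)) : {poly R}).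
Proof.
elim: n => [|n ih].
  by have := qmod_sq (1 : {poly R}); rewrite expr1n scale0r subr0.
rewrite (_ : _ - _ = 'X * (1 - n%:R *: ('X^n * (1 - 'X))) +
                     (1 - 'X) * (1 - 'X^(n.+1))); last first.
  by rewrite -!mul_polyC !polyC_natr -[n.+1]addn1 natrD addn1 exprS; ring.
by apply: qmod_add; [exact: qmodX|exact: qmod_geom].
Qed.

End Qmod.

(** Exponential against linear growth: Bernoulli at the exponent 2^n, squared, grows quadratically.
    Only powers of 2 occur because the C*-identity computes the norms of just these powers of a
    self-adjoint element, see [nm_cpow2]. *)
Lemma pow2_bounded (R : realType) (r c : R) : 0 <= c -> 0 <= r ->
  (forall n, r ^+ (2 ^ n) <= 1 + (2 ^ n)%:R * c) -> r <= 1.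
Proof.
move=> c0 r0 rn; rewrite leNgt; apply/negP => r1.
have [d dE] : {d | d = r - 1} by exists (r - 1).
have d0 : 0 < d by rewrite dE subr_gt0.
have bern n : 1 + n%:R * d <= r ^+ n.
  elim: n => [|n ih]; first by rewrite mul0r addr0 expr0.
  have rE : r = 1 + d by rewrite dE addrC subrK.
  rewrite exprS {1}rE mulrDl mul1r -[n.+1%:R]natr1 mulrDl mul1r addrA lerD //.
  by rewrite ler_peMr ?(ltW d0) // exprn_ege1 // ltW.
(* With m = 2^n this is 2 c < m d^2, hence (1 + m d)^2 > 1 + 2 m c, against the hypothesis at
   2^(n+1) = 2 m. *)
have [n nP] : exists n, (2 * c / d ^+ 2) < (2 ^ n)%:R.
  exists (Num.bound (2 * c / d ^+ 2)).
  have b0 : 0 <= 2 * c / d ^+ 2 by rewrite divr_ge0 ?mulr_ge0 ?exprn_ge0 // ltW.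
  apply: (lt_le_trans (archi_boundP b0)).
  by rewrite ler_nat ltnW // ltn_expl.
have := rn n.+1; rewrite expnS mulnC exprM leNgt => /negP[].
rewrite ltr_pdivrMr ?exprn_gt0 // in nP.
have m0 : (0 : R) < (2 ^ n)%:R by rewrite ltr0n expn_gt0.
have : (1 + (2 ^ n)%:R * d) ^+ 2 <= (r ^+ (2 ^ n)) ^+ 2.
  by rewrite ler_pXn2r ?nnegrE ?exprn_ge0 // addr_ge0 // mulr_ge0 // ltW.
apply: lt_le_trans; rewrite natrM.
have := ltr_pM2l m0 (2 * c) ((2 ^ n)%:R * d ^+ 2); rewrite nP => /esym h.
have : 0 < 2 * ((2 ^ n)%:R * d) by rewrite mulr_gt0 // mulr_gt0.
by move: h; rewrite sqrrD expr1n mul1r exprMn expr2; lra.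
Qed.

(** * The positive cone of a unital C*-algebra *)

Section Unital.
Context (R : realType) (U : cstarAlgType R) (e : U).
Hypotheses (e1l : forall x, e ** x = x) (e1r : forall x, x ** e = x).
Implicit Types (x y z h g k q : U) (t c d : R).

Lemma cstar_unit : cstar e = e.
Proof. by have /(congr1 cstar) := e1r (cstar e); rewrite cstarM cstarK e1r. Qed.

(** Equality may fail, since the algebra may be zero. *)
Lemma nm_unit : nm e <= 1.
Proof.
have : nm e ^+ 2 = nm e by rewrite -nm_cstar_cmul cstar_unit e1l.
have [->|e0] := eqVneq (nm e) 0; first by [].
by rewrite expr2 -[X in _ = X]mulr1 => /(mulfI e0) ->.
Qed.

Lemma nm_scale_unit t : 0 <= t -> nm (t%:C *: e) <= t.
Proof. by move=> t0; rewrite nmZr ger0_norm // ler_piMr // nm_unit. Qed.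

Lemma cstar_scale_unit t : cstar (t%:C *: e) = t%:C *: e.
Proof. by rewrite cstarZR cstar_unit. Qed.

(* Norm form of "the spectrum of [h] is nonnegative". *)
Definition Pos h := cstar h = h /\
  forall d, 0 < d -> exists2 t, 0 <= t & nm (t%:C *: e - h) <= t + d.

Lemma Pos_raise h d t0 : Pos h -> 0 < d ->
  exists2 t, t0 <= t & 0 <= t /\ nm (t%:C *: e - h) <= t + d.
Proof.
move=> [_ hP] d0; have [t tp tP] := hP d d0.
exists (t + `|t0|); first by rewrite (le_trans (ler_norm _)) // lerDr.
split; first by rewrite addr_ge0.
rewrite rmorphD scalerDl addrAC (le_trans (nmD _ _)) // [leRHS]addrAC lerD //.
exact: nm_scale_unit.
Qed.

Lemma Pos_unit t : 0 <= t -> Pos (t%:C *: e).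
Proof.
move=> t0; split=> [|d d0]; first exact: cstar_scale_unit.
by exists t => //; rewrite subrr nm0 addr_ge0 // ltW.
Qed.

Lemma PosD h g : Pos h -> Pos g -> Pos (h + g).
Proof.
move=> [hs hP] [gs gP]; split=> [|d d0]; first by rewrite cstarD hs gs.
have d2 : 0 < d / 2 by rewrite divr_gt0.
have [t t0 tP] := hP _ d2; have [s s0 sP] := gP _ d2.
exists (t + s); first exact: addr_ge0.
rewrite rmorphD scalerDl opprD addrACA (le_trans (nmD _ _)) // [d]splitr.
by rewrite addrACA lerD.
Qed.

Lemma PosZ c h : 0 <= c -> Pos h -> Pos (c%:C *: h).
Proof.
rewrite le_eqVlt => /predU1P[<-|c0].
  by move=> _; rewrite scale0r -(scale0r e); exact: Pos_unit.
move=> [hs hP]; split=> [|d d0]; first by rewrite cstarZR hs.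
have [|t t0 tP] := hP (d / c); first exact: divr_gt0.
exists (c * t); first by rewrite mulr_ge0 // ltW.
rewrite rmorphM -scalerA -scalerBr nmZr gtr0_norm //.
by rewrite (le_trans (ler_wpM2l (ltW c0) tP)) // mulrDr mulrC [c * (d / c)]mulrC
  divfK ?gt_eqF.
Qed.

Lemma Pos_closed h : (forall c, 0 < c -> Pos (h + c%:C *: e)) -> Pos h.
Proof.
move=> hc; split=> [|d d0].
  have [/eqP] := hc 1 ltr01.
  by rewrite cstarD cstar_scale_unit => /eqP/addIr.
have d2 : 0 < d / 2 by rewrite divr_gt0.
have [_ /(_ _ d2)[t t0 tP]] := hc _ d2; exists t => //.
have -> : t%:C *: e - h = t%:C *: e - (h + (d / 2)%:C *: e) + (d / 2)%:C *: e.
  by rewrite opprD addrA subrK.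
rewrite (le_trans (nmD _ _)) //.
by have := nm_scale_unit (ltW d2); lra.
Qed.

(** The element u = k + i q satisfies u^* u = e, so |u| <= 1, and k is the mean of u and its
    adjoint. This is the device by which a sum of squares bounds a norm. *)
Lemma circle_le1 k q : cstar k = k -> cstar q = q -> k ** q = q ** k ->
  k ** k + q ** q = e -> nm k <= 1.
Proof.
move=> ks qs kq kqe; pose u := k + 'i *: q.
have us : cstar u = k - 'i *: q.
  by rewrite /u cstarD cstarZ ks qs conjCi scaleNr.
have uu : cstar u ** u = e.
  rewrite us /u cmulBl !cmulDr -!cscaleAl -!cscaleAr scalerA.
  rewrite -expr2 sqrCi scaleN1r kq opprD opprK.
  by rewrite addrA addrK.
have u1 : nm u <= 1.
  by rewrite -(@ler_pXn2r _ 2) ?nnegrE ?nm_ge0 // -nm_cstar_cmul uu expr1n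
    nm_unit.
have kE : k = (2^-1 : R)%:C *: (u + cstar u).
  rewrite us /u addrACA subrr addr0 -mulr2n -scalerMnr scalerMnl.
  by rewrite -rmorphMn -mulr_natr mulVf ?scale1r // pnatr_eq0.
rewrite kE nmZr ger0_norm // mulrC ler_pdivrMr // mul1r.
by rewrite (le_trans (nmD _ _)) // nm_cstar lerD.
Qed.

Lemma cmul_sub_unit q x : (e - q) ** (e - x) = e - q - x + q ** x.
Proof. by rewrite cmulBl !cmulBr e1l e1l e1r opprB addrA addrAC
  [e - x - q]addrAC. Qed.

Lemma sqrt_sub_unit x : cstar x = x -> nm x < 1 -> exists r,
  [/\ cstar r = r, r ** r = e - x & forall z, z ** x = x ** z -> z ** r =
    r ** z].
Proof.
move=> xs x1; have [s [ss sE sC]] := qsqrt xs x1; exists (e - s); split.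
- by rewrite cstarB cstar_unit ss.
- by rewrite cmul_sub_unit -sE opprB [RHS]addrCA [RHS]addrC opprD addrA.
- by move=> z zx; rewrite cmulBr cmulBl e1l e1r sC.
Qed.

(** For t > |k|^2 the element 1 - k^2 / t has a square root r that commutes with k. Then
    [circle_le1], applied to r and k / sqrt t, gives |r| <= 1, that is |t - k^2| <= t. *)
Lemma Pos_sq k : cstar k = k -> Pos (k ** k).
Proof.
move=> ks; split=> [|d d0]; first by rewrite cstarM ks.
pose t := nm k ^+ 2 + 1; have t0 : 0 < t by rewrite ltr_wpDl ?exprn_ge0 ?nm_ge0.
exists t; first exact: ltW.
pose x := t^-1%:C *: (k ** k).
have xs : cstar x = x by rewrite cstarZR cstarM ks.
have x1 : nm x < 1.
  rewrite nmZr gtr0_norm ?invr_gt0 // nm_csqr // mulrC ltr_pdivrMr // mul1r.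
  by rewrite ltrDl.
have [r [rs rr rC]] := sqrt_sub_unit xs x1.
have kr : k ** r = r ** k.
  by apply: rC; rewrite /x -cscaleAl -cscaleAr cmulA.
pose k' := (Num.sqrt t^-1)%:C *: k.
have r1 : nm r <= 1.
  apply: (@circle_le1 r k') => //; rewrite /k'.
  - by rewrite cstarZR ks.
  - by rewrite -cscaleAl -cscaleAr kr.
  - rewrite -cscaleAl -cscaleAr scalerA -rmorphM -expr2 sqr_sqrtr ?invr_ge0
      ?(ltW t0) //.
    by rewrite rr /x subrK.
have -> : t%:C *: e - k ** k = t%:C *: (r ** r).
  by rewrite rr scalerBr /x scalerA -rmorphM mulfV ?gt_eqF // scale1r.
rewrite nmZr gtr0_norm // nm_csqr // (@le_trans _ _ t) //;
  last by rewrite lerDl ltW.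
by rewrite ler_piMr ?(ltW t0) // expr_le1 ?nm_ge0.
Qed.

Definition cpow x n := iter n (cmul x) e.

Lemma iter_cmul x n y : iter n (cmul x) y = cpow x n ** y.
Proof. by elim: n => [|n ih]; rewrite /cpow ?e1l //= ih cmulA. Qed.

Lemma cpow_comm x n z : z ** x = x ** z -> z ** cpow x n = cpow x n ** z.
Proof.
move=> zx; elim: n => [|n ih]; rewrite /cpow /= ?e1l ?e1r // -/(cpow x n).
by rewrite cmulA zx -cmulA ih cmulA.
Qed.

Lemma cpowD x m n : cpow x (m + n) = cpow x m ** cpow x n.
Proof. by rewrite {1}/cpow iterD iter_cmul. Qed.

Lemma cpow_sa x n : cstar x = x -> cstar (cpow x n) = cpow x n.
Proof.
move=> xs; elim: n => [|n ih]; first exact: cstar_unit.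
by rewrite /cpow /= -/(cpow x n) cstarM ih xs cpow_comm.
Qed.

Lemma nm_cpow2 x n : cstar x = x -> nm (cpow x (2 ^ n)) = nm x ^+ (2 ^ n).
Proof.
move=> xs; elim: n => [|n ih]; first by rewrite expn0 expr1 /cpow /= e1r.
rewrite expnS mul2n -addnn cpowD nm_csqr ?cpow_sa // ih -exprM.
by rewrite muln2 addnn.
Qed.

(* Powers of [t - z^* z] and of [t - z z^*] are intertwined by [z], and for
   self-adjoint elements the norm is recovered from the growth of powers. *)
Lemma nm_swap z t M : 0 <= t -> 0 < M -> t <= M ->
  nm (t%:C *: e - z ** cstar z) <= M -> nm (t%:C *: e - cstar z ** z) <= M.
Proof.
move=> t0 M0 tM; set w' := _ - z ** _; set w := _ - _ ** z => w'M.
have ws : cstar w = w by rewrite cstarB cstar_scale_unit cstarM cstarK.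
have wz n : cstar z ** z ** cpow w n = cstar z ** (cpow w' n ** z).
  rewrite -!cmulA; congr (_ ** _).
  elim: n => [|n ih]; rewrite /cpow /= ?e1l ?e1r // -/(cpow w n) -/(cpow w' n).
  rewrite -cmulA -ih cmulA [RHS]cmulA; congr (_ ** _).
  by rewrite /w /w' cmulBr cmulBl -cscaleAl -cscaleAr e1l e1r cmulA.
have w'n n : nm (cpow w' n) <= M ^+ n.
  elim: n => [|n ih]; first by rewrite expr0 nm_unit.
  by rewrite /cpow /= -/(cpow w' n) (le_trans (nm_cmul _ _)) // exprS ler_pM
    ?nm_ge0.
pose c := nm z ^+ 2 / M.
have c0 : 0 <= c by rewrite divr_ge0 ?exprn_ge0 ?nm_ge0 // ltW.
(* By [wz], w^(n+1) = t w^n - z^* w'^n z. Each step thus multiplies the bound by at most M and adds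
   M^n |z|^2, so only a linear factor 1 + n c appears besides M^n. *)
have wn n : nm (cpow w n) <= M ^+ n * (1 + n%:R * c).
  elim: n => [|n ih]; first by rewrite expr0 mul0r addr0 mul1r nm_unit.
  rewrite {1}/cpow /= -/(cpow w n) {1}/w cmulBl -cscaleAl e1l wz.
  have h1 : nm (t%:C *: cpow w n) <= M * (M ^+ n * (1 + n%:R * c)).
    by rewrite nmZr ger0_norm // ler_pM ?nm_ge0.
  have h2 : nm (cstar z ** (cpow w' n ** z)) <= M ^+ n * nm z ^+ 2.
    rewrite (le_trans (nm_cmul _ _)) // nm_cstar expr2 mulrCA ler_wpM2l ?nm_ge0
      //.
    by rewrite (le_trans (nm_cmul _ _)) // ler_wpM2r ?nm_ge0.
  rewrite (le_trans (nmB _ _)) // (le_trans (lerD h1 h2)) //.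
  have -> : nm z ^+ 2 = M * c by rewrite /c mulrC divfK // gt_eqF.
  by rewrite exprS -natr1 le_eqVlt; apply/orP; left; apply/eqP; ring.
rewrite -[leRHS]mul1r -ler_pdivrMr //.
apply: (@pow2_bounded _ _ c) => //; first by rewrite divr_ge0 ?nm_ge0 // ltW.
move=> n; rewrite expr_div_n ler_pdivrMr ?exprn_gt0 // -nm_cpow2 //.
by rewrite [leRHS]mulrC.
Qed.

Lemma Pos_swap z c : 0 <= c -> Pos (z ** cstar z + c%:C *: e) ->
  Pos (cstar z ** z + c%:C *: e).
Proof.
move=> c0 zP; split=> [|d d0].
  by rewrite cstarD cstar_scale_unit cstarM cstarK.
(* Raising t above c makes t - c an admissible scalar for [nm_swap], which is applied with M = t +
   d. *)
have [t ct [t0 tP]] := Pos_raise (c + 1) zP d0; exists t => //.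
have tc0 : 0 <= t - c by lra.
have tE y : t%:C *: e - (y + c%:C *: e) = (t - c)%:C *: e - y.
  by rewrite rmorphB scalerBl opprD addrA addrAC.
by rewrite tE; rewrite tE in tP; apply: nm_swap => //; lra.
Qed.

Lemma cmulxD x u v : x ** (u + v) = x ** u + x ** v.
Proof. exact: cmulDr. Qed.
Lemma cmulxZ x (k : R[i]) u : x ** (k *: u) = k *: (x ** u).
Proof. by rewrite cscaleAr. Qed.

Let evl x p := pev (cmul x) p e.

Lemma pev_cmul x p y : pev (cmul x) p y = evl x p ** y.
Proof.
rewrite /evl /pev; elim/big_ind2: _ => [|u v u' v' -> ->|i _].
- by rewrite cmul0r.
- by rewrite cmulDl.
- by rewrite -cscaleAl iter_cmul.
Qed.

Lemma evlM x (p q : {poly R}) : evl x (p * q) = evl x p ** evl x q.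
Proof. by rewrite /evl (pevM (cmulxD x) (cmulxZ x)) pev_cmul. Qed.

Lemma evlX x : evl x 'X = x.
Proof. by rewrite /evl (pevX (cmulxD x) (cmulxZ x)) e1r. Qed.

Lemma evl_sa x p : cstar x = x -> cstar (evl x p) = evl x p.
Proof.
move=> xs; rewrite /evl /pev; elim/big_ind: _ => [|u v us vs|i _].
- exact: cstar0.
- by rewrite cstarD us vs.
- by rewrite cstarZR; congr (_ *: _); exact: cpow_sa.
Qed.

Lemma evl_comm x p z : z ** x = x ** z -> z ** evl x p = evl x p ** z.
Proof.
move=> zx; rewrite /evl /pev; elim/big_ind: _ => [|u v us vs|i _].
- by rewrite cmul0r cmulr0.
- by rewrite cmulDl cmulDr us vs.
- by rewrite -cscaleAr -cscaleAl -[iter _ _ e]/(cpow x i) cpow_comm.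
Qed.

(** At X = r^2 the generator X q^2 becomes the square of the self-adjoint element r q(r^2), so both
    generators fall under [Pos_sq]. *)
Lemma Pos_qmod r p : cstar r = r -> qmod p -> Pos (evl (r ** r) p).
Proof.
move=> rs; have xs : cstar (r ** r) = r ** r by rewrite cstarM rs.
elim=> [q|q|{}p q _ pP _ qP].
- by rewrite expr2 evlM; apply/Pos_sq/evl_sa.
- rewrite expr2 !evlM evlX; set Q := evl _ q.
  have rQ : r ** Q = Q ** r by apply: evl_comm; rewrite cmulA.
  have Qs : cstar Q = Q by exact: evl_sa.
  have -> : r ** r ** (Q ** Q) = (r ** Q) ** (r ** Q).
    by rewrite !cmulA; congr (_ ** _); rewrite -!cmulA rQ.
  by apply: Pos_sq; rewrite cstarM Qs rs rQ.
- by rewrite /evl pevD; exact: PosD.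
Qed.

Let evl1 x : evl x 1 = e.
Proof. by rewrite /evl pev1. Qed.

(** Up to the factor 2 this is the sum of the squares of the self-adjoint elements z + z^* and i (z
    - z^* ). *)
Lemma Pos_sym z : Pos (z ** cstar z + cstar z ** z).
Proof.
pose p := z + cstar z; pose q := 'i *: (z - cstar z).
have ps : cstar p = p by rewrite cstarD cstarK addrC.
have qs : cstar q = q.
  by rewrite cstarZ conjCi cstarB cstarK scaleNr -scalerN opprB.
have pq : p ** p + q ** q = (z ** cstar z + cstar z ** z) *+ 2.
  rewrite /p /q -cscaleAl -cscaleAr scalerA -expr2 sqrCi scaleN1r.
  rewrite cmulBl !cmulBr cmulDl !cmulDr !opprB.
  set a := z ** z; set b := z ** cstar z; set c := cstar z ** z; set d :=
    cstar z ** cstar z.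
  rewrite [c - d + _]addrC addrACA [a + b]addrC [b + a + _]addrACA subrr addr0.
  by rewrite [c + d + _]addrACA subrr addr0 mulrnDl !mulr2n.
have -> : z ** cstar z + cstar z ** z = (2^-1 : R)%:C *: (p ** p + q ** q).
  by rewrite pq -scalerMnr scalerMnl -rmorphMn -mulr_natr mulVf ?scale1r //
    pnatr_eq0.
by apply: PosZ => //; apply: PosD; exact: Pos_sq.
Qed.

(* With h = y^* y, x = 1 - h and z = y x^k, the product z^* z = x^(2k) h is at
   most c = 1 / (2k), so z z^* >= - c because z z^* + z^* z >= 0; hence also
   h >= z^* z >= - c. *)
Lemma Pos_cstar_cmul_small y : nm y < 1 -> Pos (cstar y ** y).
Proof.
move=> y1; set h := cstar y ** y.
have hs : cstar h = h by rewrite /h cstarM cstarK.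
have h1 : nm h < 1 by rewrite /h nm_cstar_cmul expr_lt1 ?nm_ge0.
have [r [rs rr _]] := sqrt_sub_unit hs h1.
have xs : cstar (r ** r) = r ** r by rewrite cstarM rs.
have hE : h = evl (r ** r) (1 - 'X).
  by rewrite /evl pevD pevN -/(evl _ _) -/(evl _ _) evl1 evlX rr subKr.
suff hk (k : nat) : (0 < k)%N -> Pos (h + (k.*2%:R^-1)%:C *: e).
  apply: Pos_closed => c c0; pose k := (Num.bound c^-1).+1.
  have kc : k.*2%:R^-1 <= c.
    rewrite invf_ple ?posrE // ?ltr0n ?double_gt0 //.
    rewrite (le_trans (ltW (archi_boundP _))) ?invr_ge0 ?(ltW c0) //.
    by rewrite ler_nat /k -addnn (leq_trans (leqnSn _)) // leq_addr.
  have -> : h + c%:C *: e = h + (k.*2%:R^-1)%:C *: e + (c - k.*2%:R^-1)%:C *: e.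
    by rewrite -addrA -scalerDl -rmorphD; congr (_ + _%:C *: _);
      rewrite addrC subrK.
  by apply: PosD; [exact: hk|apply: Pos_unit; rewrite subr_ge0].
move=> k0; set c := _^-1.
have N0 : 0 < k.*2%:R :> R by rewrite ltr0n double_gt0.
have c0 : 0 < c by rewrite invr_gt0.
pose X := evl (r ** r) 'X^k; pose z := y ** X.
pose f := evl (r ** r) ('X^(k.*2) * (1 - 'X)).
have zz : cstar z ** z = f.
  rewrite /z cstarM evl_sa // -cmulA (cmulA (cstar y)) -/h hE -!evlM;
    congr (evl _ _).
  by rewrite -addnn exprD; ring.
have cf : Pos (c%:C *: e - f).
  have -> : c%:C *: e - f = c%:C *:
    evl (r ** r) (1 - k.*2%:R *: ('X^(k.*2) * (1 - 'X))).
    rewrite /evl pevD pevN pevZ -/(evl _ _) -/(evl _ _) -/f evl1 scalerBr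
      scalerA.
    by rewrite -rmorphM mulVf ?gt_eqF // scale1r.
  by apply: PosZ; [exact: ltW|apply: Pos_qmod => //; exact: qmod_peak].
have zzc : Pos (z ** cstar z + c%:C *: e).
  have -> : z ** cstar z + c%:C *: e =
      (z ** cstar z + cstar z ** z) + (c%:C *: e - f).
    by rewrite zz addrA addrAC addrK.
  by apply: PosD => //; exact: Pos_sym.
have fc : Pos (f + c%:C *: e) by rewrite -zz; apply: Pos_swap => //; exact: ltW.
have hf : Pos (h - f).
  have -> : h - f = evl (r ** r) ((1 - 'X) * (1 - 'X^(k.*2))).
    rewrite hE /f /evl -pevN -pevD; congr (pev _ _ _); ring.
  by apply: Pos_qmod => //; exact: qmod_geom.
have -> : h + c%:C *: e = (h - f) + (f + c%:C *: e) by rewrite addrA subrK.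
exact: PosD.
Qed.

Lemma Pos_cstar_cmul y : Pos (cstar y ** y).
Proof.
pose c := nm y + 1; have c0 : 0 < c by rewrite ltr_wpDl ?nm_ge0.
have -> : cstar y ** y = (c ^+ 2)%:C *:
  (cstar (c^-1%:C *: y) ** (c^-1%:C *: y)).
  rewrite cstarZR -cscaleAl -cscaleAr !scalerA -!rmorphM.
  rewrite (_ : c ^+ 2 * (_ * _) = 1) ?scale1r // expr2 mulrACA mulfV ?gt_eqF //.
  by rewrite mulr1.
apply: PosZ; first by rewrite exprn_ge0 // ltW.
apply: Pos_cstar_cmul_small; rewrite nmZr gtr0_norm ?invr_gt0 //.
by rewrite mulrC ltr_pdivrMr // mul1r ltrDl.
Qed.

(** From |t - h| <= t + d / 2 it follows that h + d = (t + d)(1 - x) with |x| < 1. The added d makes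
    the inequality for x strict, as the square root of 1 - x requires. *)
Lemma Pos_sqrt h d : Pos h -> 0 < d -> exists k,
  [/\ cstar k = k, k ** k = h + d%:C *: e & forall z, z ** h = h ** z ->
    z ** k = k ** z].
Proof.
move=> hP d0; have hs := hP.1.
have d2 : 0 < d / 2 by rewrite divr_gt0.
have [t t1 [t0 tP]] := Pos_raise 1 hP d2.
have td0 : 0 < t + d by lra.
pose x := (t + d)^-1%:C *: (t%:C *: e - h).
have xs : cstar x = x by rewrite cstarZR cstarB cstar_scale_unit hs.
have x1 : nm x < 1.
  rewrite nmZr gtr0_norm ?invr_gt0 // mulrC ltr_pdivrMr // mul1r; lra.
have [r [rs rr rC]] := sqrt_sub_unit xs x1.
exists ((Num.sqrt (t + d))%:C *: r); split.
- by rewrite cstarZR rs.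
- rewrite -cscaleAl -cscaleAr scalerA -rmorphM -expr2 sqr_sqrtr ?(ltW td0) //.
  rewrite rr /x scalerBr scalerA -rmorphM mulfV ?gt_eqF // scale1r.
  by rewrite opprB addrCA rmorphD scalerDl addrAC subrr add0r.
- move=> z zh; rewrite -cscaleAr -cscaleAl rC // /x -cscaleAr -cscaleAl;
    congr (_ *: _).
  by rewrite cmulBr cmulBl -cscaleAr -cscaleAl e1l e1r zh.
Qed.

(** The constant 4 is crude. For w slightly above |h + g|, both h and w - h are positive; the
    squares h + w and 2 w - h add up to 3 w, so [circle_le1] gives |h + w| <= 3 w and hence |h| <= 4
    w. The estimate keeps a nonzero positive element away from the negative cone. *)
Lemma Pos_nm_le h g : Pos h -> Pos g -> nm h <= 4 * nm (h + g).
Proof.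
move=> hP gP; apply/ler_addgt0Pl => d d0.
pose w := nm (h + g) + d / 4.
have w0 : 0 < w by rewrite /w; have := nm_ge0 (h + g); lra.
suff : nm h <= 4 * w by rewrite /w; lra.
have whP : Pos (w%:C *: e - h).
  have -> : w%:C *: e - h = (w%:C *: e - (h + g)) + g.
    by rewrite opprD addrA subrK.
  apply: PosD => //; split=> [|d' d'0].
    by rewrite cstarB cstar_scale_unit cstarD hP.1 gP.1.
  exists w; first exact: ltW.
  by rewrite subKr /w; lra.
have [a [as_ aa aC]] := Pos_sqrt hP w0.
have [b [bs bb bC]] := Pos_sqrt whP w0.
have ah : a ** h = h ** a by rewrite aC.
have ab : a ** b = b ** a.
  by apply: bC; rewrite cmulBr cmulBl -cscaleAr -cscaleAl e1l e1r ah.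
pose s := Num.sqrt (3 * w)^-1.
have s2 : s * s = (3 * w)^-1 by rewrite -expr2 sqr_sqrtr // invr_ge0 mulr_ge0 //
  ltW.
have w30 : 0 < 3 * w by rewrite mulr_gt0.
have /circle_le1 : (s%:C *: a) ** (s%:C *: a) + (s%:C *: b) ** (s%:C *: b) = e.
  rewrite -!cscaleAl -!cscaleAr !scalerA -rmorphM s2 -scalerDr aa bb.
  have -> : h + w%:C *: e + (w%:C *: e - h + w%:C *: e) = (3 * w)%:C *: e.
    rewrite [w%:C *: e - h + _]addrAC addrCA [h + _ - h]addrAC subrr add0r.
    by rewrite -!scalerDl -!rmorphD; congr (_%:C *: _); ring.
  by rewrite scalerA -rmorphM mulVf ?gt_eqF // scale1r.
rewrite !cstarZR as_ bs -!cscaleAl -!cscaleAr ab => /(_ erefl erefl erefl).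
have s0 : 0 <= s by exact: sqrtr_ge0.
rewrite nmZr ger0_norm // => sa1.
have : nm (h + w%:C *: e) <= 3 * w.
  rewrite -aa nm_csqr // -[leRHS]mul1r -ler_pdivrMr // -s2 mulrC -expr2 -exprMn.
  by rewrite expr_le1 // mulr_ge0 ?nm_ge0.
have := nmB (h + w%:C *: e) (w%:C *: e); rewrite addrK.
have := nm_scale_unit (ltW w0); lra.
Qed.

End Unital.

(** * Positive functionals *)

Section HahnBanach.
Context (R : realType) (V : lmodType R[i]).
Implicit Types (p q f : V -> R) (x y h : V).

Definition sublinear p :=
  (forall x y, p (x + y) <= p x + p y) /\
  (forall t x, 0 <= t -> p (t%:C *: x) <= t * p x).

Lemma sublinear0 p : sublinear p -> p 0 = 0.
Proof.
move=> [pD pZ]; apply/le_anti/andP; split.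
  by have := pZ 0 0 (lexx _); rewrite scaler0 mul0r.
by have := pD 0 0; rewrite addr0 lerDl.
Qed.

Lemma sublinearZ p t x : sublinear p -> 0 <= t -> p (t%:C *: x) = t * p x.
Proof.
move=> pS; rewrite le_eqVlt => /predU1P[<-|t0].
  by rewrite scale0r mul0r sublinear0.
have [_ pZ] := pS; apply/le_anti; rewrite pZ ?(ltW t0) //=.
have := pZ t^-1 (t%:C *: x); rewrite invr_ge0 => /(_ (ltW t0)).
by rewrite scalerA -rmorphM mulVf ?gt_eqF // scale1r mulrC ler_pdivlMr // mulrC.
Qed.

Lemma sublinear_ge p x : sublinear p -> - p (- x) <= p x.
Proof.
by move=> pS; rewrite lerNl -subr_ge0 opprK -(sublinear0 pS) -(addNr x) pS.1.
Qed.

(** The values whose infimum lowers [p] in the direction -y. The resulting [shiftf p y] is sublinear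
    and below [p], and its value at -y is at most - p y; at a minimal [p] this forces additivity. *)
Definition shiftf_set p y x :=
  [set p (x + t%:C *: y) - t * p y | t in [set t | 0 <= t]].

Definition shiftf p y x := inf (shiftf_set p y x).

Lemma shiftf_has_inf p y x : sublinear p -> has_inf (shiftf_set p y x).
Proof.
move=> pS; split; first by exists (p (x + 0%:C *: y) - 0 * p y); exists 0 => /=.
exists (- p (- x)) => _ [t /= t0 <-].
rewrite lerBrDr -(sublinearZ _ pS t0) -{1}(addKr x (t%:C *: y)).
by rewrite addrC lerBlDr addrC; exact: pS.1.
Qed.

Lemma shiftf_le p y x t : sublinear p -> 0 <= t ->
  shiftf p y x <= p (x + t%:C *: y) - t * p y.
Proof.
by move=> pS t0; apply: ge_inf; [case: (shiftf_has_inf y x pS)|exists t].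
Qed.

Lemma le_shiftf p y x c :
  (forall t, 0 <= t -> c <= p (x + t%:C *: y) - t * p y) ->
  c <= shiftf p y x.
Proof.
move=> cp; apply: lb_le_inf; first by exists (p (x + 0%:C *: y) - 0 * p y);
  exists 0 => /=.
by move=> _ [t /= t0 <-]; exact: cp.
Qed.

Lemma shiftf_sublinear p y : sublinear p -> sublinear (shiftf p y).
Proof.
move=> pS; split=> [x x'|c x c0].
  rewrite -lerBlDr; apply: le_shiftf => t t0; rewrite lerBlDr -lerBlDl.
  apply: le_shiftf => s s0; rewrite lerBlDl.
  apply: (le_trans (shiftf_le _ _ pS (addr_ge0 t0 s0))).
  rewrite rmorphD scalerDl mulrDl addrACA.
  have := pS.1 (x + t%:C *: y) (x' + s%:C *: y); lra.
have [->|c0'] := eqVneq c 0.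
  rewrite mul0r scale0r (le_trans (shiftf_le _ _ pS (lexx 0))) //.
  by rewrite scale0r addr0 sublinear0 // mul0r subrr.
have cp : 0 < c by rewrite lt0r c0'.
rewrite mulrC -ler_pdivrMr //; apply: le_shiftf => t t0; rewrite ler_pdivrMr //.
rewrite (le_trans (shiftf_le _ _ pS (mulr_ge0 c0 t0))) //.
rewrite rmorphM -scalerA -scalerDr.
have := pS.2 c (x + t%:C *: y) c0; rewrite mulrBl -!mulrA [_ * c]mulrC
  [p y * c]mulrC mulrCA; lra.
Qed.

Lemma shiftf_lep p y x : sublinear p -> shiftf p y x <= p x.
Proof.
move=> pS; rewrite (le_trans (shiftf_le _ _ pS (lexx 0))) //.
by rewrite scale0r addr0 mul0r subr0.
Qed.

(* A minimal sublinear functional is additive, since it agrees with all its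
   [shiftf]s. *)
Lemma hahn_banach p h : sublinear p -> exists f,
  [/\ (forall x y, f (x + y) = f x + f y), (forall t x, f (t%:C *: x) =
    t * f x),
      (forall x, f x <= p x) & p h <= f h].
Proof.
move=> pS; pose q := shiftf p h; have qS :
  sublinear q by exact: shiftf_sublinear.
pose T := {f : V -> R | sublinear f /\ forall x, f x <= q x}.
pose r (f g : T) := `[< forall x, sval g x <= sval f x >].
have [||||m mmin] := @Zorn T r.
- by move=> f; apply/asboolP.
- move=> f g k /asboolP fg /asboolP gk; apply/asboolP => x.
  exact: le_trans (gk x) (fg x).
- move=> [f fP] [g gP] /asboolP fg /asboolP gf; apply: eq_exist; apply/funext =>
    x.
  by apply/le_anti; rewrite gf fg.
(* A nonempty chain is bounded by its pointwise infimum, which is finite because every member is at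
   least - q (- x); the empty chain is bounded by [q]. *)
- move=> A Atot; have [[f0 Af0]|A0] := pselect (A !=set0); last first.
    exists (exist _ q (conj qS (fun x => lexx _))) => s As.
    by exfalso; apply: A0; exists s.
  pose S x := [set sval f x | f in A].
  have Slb x (f : T) : A f -> - q (- x) <= sval f x.
    move=> Af; have [fS fq] := svalP f.
    by rewrite (le_trans _ (sublinear_ge x fS)) // lerN2.
  have Sinf x : has_inf (S x).
    split; first by exists (sval f0 x); exists f0.
    by exists (- q (- x)) => _ [f Af <-]; exact: Slb.
  have infS_le x (f : T) : A f -> inf (S x) <= sval f x.
    by move=> Af; apply: ge_inf; [case: (Sinf x)|exists f].
  have le_infS x c : (forall f : T, A f -> c <= sval f x) -> c <= inf (S x).
    move=> cf; apply: lb_le_inf; first by case: (Sinf x).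
    by move=> _ [f Af <-]; exact: cf.
  have gS : sublinear (fun x => inf (S x)).
    split=> [x y|t x t0].
      rewrite -lerBlDr; apply: (le_infS _ _) => f Af; rewrite lerBlDr -lerBlDl.
      apply: (le_infS _ _) => g Ag; rewrite lerBlDl.
      have [/asboolP fg|/asboolP gf] := Atot f g Af Ag.
        apply: (le_trans (infS_le _ g Ag));
          apply: (le_trans ((svalP g).1.1 _ _)).
        by rewrite lerD.
      apply: (le_trans (infS_le _ f Af)); apply: (le_trans ((svalP f).1.1 _ _)).
      by rewrite lerD.
    have [->|t0'] := eqVneq t 0.
      rewrite mul0r (le_trans (infS_le _ f0 Af0)) //.
      by rewrite (sublinearZ _ (svalP f0).1) ?mul0r.
    have tp : 0 < t by rewrite lt0r t0'.
    rewrite mulrC -ler_pdivrMr //; apply: (le_infS _ _) => f Af;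
      rewrite ler_pdivrMr //.
    by rewrite (le_trans (infS_le _ f Af)) // (sublinearZ _ (svalP f).1) //
      mulrC.
  have gq x : inf (S x) <= q x by exact: le_trans (infS_le x f0 Af0)
    ((svalP f0).2 x).
  pose P (f : V -> R) := sublinear f /\ forall x, f x <= q x.
  by exists (exist P _ (conj gS gq)) => f Af; apply/asboolP => x;
    exact: infS_le.
have [mS mq] := svalP m.
have madd x y : sval m (x + y) = sval m x + sval m y.
  apply/le_anti; rewrite mS.1 /= -lerBrDr.
  have sS : sublinear (shiftf (sval m) y) /\ forall x, shiftf (sval m) y x <= q
    x.
    by split=> [|z]; [exact: shiftf_sublinear|exact:
      le_trans (shiftf_lep _ _ mS) (mq z)].
  pose P (f : V -> R) := sublinear f /\ forall x, f x <= q x.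
  have mE : exist P _ sS = m by apply: mmin; apply/asboolP => z;
    exact: shiftf_lep.
  have := shiftf_le y x mS ler01; rewrite scale1r mul1r.
  by have /(congr1 (fun k : T => sval k x)) /= -> := mE; rewrite lerBrDr.
have m0 := sublinear0 mS.
have mN x : sval m (- x) = - sval m x.
  by apply/eqP; rewrite -addr_eq0 -madd addNr m0.
exists (sval m); split => // [t x|x|].
- have [t0|t0] := leP 0 t; first exact: sublinearZ.
  rewrite -[t]opprK rmorphN scaleNr mN sublinearZ ?mulNr //.
  by rewrite oppr_ge0 ltW.
- exact: le_trans (mq x) (shiftf_lep h x pS).
- rewrite -[sval m h]opprK -mN lerNr (le_trans (mq _)) //
    (le_trans (shiftf_le _ _ pS ler01)) //.
  by rewrite scale1r addNr mul1r sublinear0 // add0r.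
Qed.

End HahnBanach.

(** * Left multipliers as a unital envelope *)

Section Multipliers.
Context (R : realType) (B : cstarAlgType R).

Fact mult_Zl k (x y : B) : cstar (k *: x) ** y = Num.conj k *: (cstar x ** y).
Proof. by rewrite cstarZ cscaleAl. Qed.
Fact mult_Dl (x y z : B) : cstar (x + y) ** z = cstar x ** z + cstar y ** z.
Proof. by rewrite cstarD cmulDl. Qed.
Fact mult_Zr k (x y : B) : cstar x ** (k *: y) = k *: (cstar x ** y).
Proof. by rewrite cscaleAr. Qed.
Fact mult_cs (x y : B) : nm (cstar x ** y) <= nm x * nm y.
Proof. by rewrite (le_trans (nm_cmul _ _)) // nm_cstar. Qed.

(** B as a Hilbert module over itself. Its adjointable operators form a unital C*-algebra containing
    B through [lmult], so the theory of [Pos] becomes available when B has no unit. *)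
Definition mult_space : ipspace R :=
  @IpSpace R B B (fun x y => cstar x ** y) mult_Dl (fun x => cmulDr (cstar x))
    mult_Zl mult_Zr (@nm_cstar_cmul R B) mult_cs.

Fact lmult_subproof (x : B) :
  `[< @adjointable R mult_space (fun b => x ** b : mult_space) >].
Proof.
apply/asboolP; split.
  exists (fun b : B => cstar x ** b : mult_space).
  by split=> b c /=; rewrite cstarM ?cstarK cmulA.
by exists (nm x) => b; exact: nm_cmul.
Qed.

Definition lmult (x : B) : adjop mult_space := Adjop (lmult_subproof x).

Lemma lmultD x y : lmult (x + y) = lmult x + lmult y.
Proof. by apply: adjopP => b; exact: cmulDl. Qed.
Lemma lmultZ k x : lmult (k *: x) = k *: lmult x.
Proof. by apply: adjopP => b; rewrite /= cscaleAl. Qed.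
Lemma lmultM x y : lmult (x ** y) = lmult x ** lmult y.
Proof. by apply: adjopP => b; rewrite /= cmulA. Qed.
Lemma lmult_star x : lmult (cstar x) = cstar (lmult x).
Proof. by apply/esym/adj_eq => b c /=; rewrite cstarM cmulA. Qed.
(** The lower bound comes from applying the operator to x^*, since |x x^* | = |x|^2. *)
Lemma nm_lmult x : nm (lmult x) = nm x.
Proof.
apply/le_anti/andP; split.
  by apply: aop_nm_le; [exact: nm_ge0|move=> b; exact: nm_cmul].
have [->|x0] := eqVneq (nm x) 0; first exact: nm_ge0.
have xp : 0 < nm x by rewrite lt0r x0 nm_ge0.
rewrite -(ler_pM2r xp) -expr2 -nm_cmul_cstar -[X in _ * X]nm_cstar.
exact: (aop_nm (lmult x)).
Qed.

Let e : adjop mult_space := @op_one R mult_space.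
Let e1l (T : adjop mult_space) : e ** T = T. Proof. exact: adjopP. Qed.
Let e1r (T : adjop mult_space) : T ** e = T. Proof. exact: adjopP. Qed.

Lemma positive_cone : exists P : set B,
  [/\ forall y, P (cstar y ** y), (forall x y, P x -> P y -> P (x + y)),
      (forall t x, 0 <= t -> P x -> P (t%:C *: x)) &
      forall x y, P x -> P y -> nm x <= 4 * nm (x + y)].
Proof.
exists [set x | Pos e (lmult x)]; split=> [y|x y xP yP|t x t0 xP|x y xP yP] /=.
- by rewrite lmultM lmult_star; exact: Pos_cstar_cmul.
- by rewrite lmultD; exact: PosD.
- by rewrite lmultZ; exact: PosZ.
- by rewrite -!nm_lmult lmultD; exact: Pos_nm_le.
Qed.

End Multipliers.

Section States.
Context (R : realType) (B : cstarAlgType R).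

Record positive_functional (phi : B -> R[i]) : Prop := PositiveFunctional {
  pfD : forall x y, phi (x + y) = phi x + phi y;
  pfZ : forall k x, phi (k *: x) = k * phi x;
  pf_star : forall x, phi (cstar x) = Num.conj (phi x);
  pf_ge0 : forall x, 0 <= phi (cstar x ** x)
}.

(* Hahn-Banach for the distance to the negative cone yields a real functional
   nonnegative on the cone of positive elements. *)
Lemma positive_functional_exists (z : B) : z != 0 ->
  exists2 phi, positive_functional phi & phi (cstar z ** z) != 0.
Proof.
move=> z0; have [P [Psq PD PZ Pnm]] := positive_cone B.
have P0 : P 0 by rewrite -(cmulr0 (cstar 0)); exact: Psq.
(* The distance from x to the negative cone - P. It is at least |h| / 4 at a square h, by the last
   property of the cone. *)
pose q x := inf [set nm (x + g) | g in P].
have q_le x g : P g -> q x <= nm (x + g).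
  by move=> Pg; apply: ge_inf; [exists 0 => _ [? _ <-]; exact: nm_ge0|exists g].
have le_q x c : (forall g, P g -> c <= nm (x + g)) -> c <= q x.
  move=> cq; apply: lb_le_inf; first by exists (nm (x + 0)); exists 0.
  by move=> _ [g Pg <-]; exact: cq.
have qS : sublinear q.
  split=> [x y|t x t0].
    rewrite -lerBlDr; apply: (le_q _ _) => g Pg; rewrite lerBlDr -lerBlDl.
    apply: (le_q _ _) => g' Pg';
      rewrite lerBlDl (le_trans (q_le _ _ (PD _ _ Pg Pg'))) //.
    by rewrite addrACA nmD.
  have [->|t0'] := eqVneq t 0.
    by rewrite scale0r mul0r (le_trans (q_le _ _ P0)) // addr0 nm0.
  have tp : 0 < t by rewrite lt0r t0'.
  rewrite mulrC -ler_pdivrMr //; apply: (le_q _ _) => g Pg;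
    rewrite ler_pdivrMr //.
  rewrite (le_trans (q_le _ _ (PZ _ _ t0 Pg))) // -scalerDr nmZr ger0_norm //.
  by rewrite mulrC.
pose h := cstar z ** z.
have hs : cstar h = h by rewrite cstarM cstarK.
have [f [fD fZ fq fh]] := hahn_banach h qS.
have f0 : f 0 = 0 by have := fZ 0 0; rewrite scaler0 mul0r.
have fN x : f (- x) = - f x by apply/eqP; rewrite -addr_eq0 -fD addNr f0.
have fP x : P x -> 0 <= f x.
  move=> Px; rewrite -oppr_le0 -fN (le_trans (fq _)) // (le_trans (q_le _ _ Px))
    //.
  by rewrite addNr nm0.
have fh0 : 0 < f h.
  apply: lt_le_trans fh; have nh : 0 < nm h.
    rewrite nm_cstar_cmul exprn_gt0 // lt0r nm_ge0 andbT.
    by apply: contra_neq z0; exact: nm_eq0.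
  apply: (@lt_le_trans _ _ (nm h / 4)); first by rewrite divr_gt0.
  apply: (le_q _ _) => g Pg; rewrite ler_pdivrMr // mulrC.
  by apply: Pnm => //; exact: Psq.
(* Symmetrising makes g invariant under the star, so that its complexification [phi] below is
   hermitian and agrees with g on self-adjoint elements. *)
pose g x := f x + f (cstar x).
have gD x y : g (x + y) = g x + g y by rewrite /g cstarD !fD addrACA.
have gZ t x : g (t%:C *: x) = t * g x by rewrite /g cstarZR !fZ mulrDr.
have gN x : g (- x) = - g x by rewrite /g cstarN !fN opprD.
have g_star x : g (cstar x) = g x by rewrite /g cstarK addrC.
have gi x : g ('i *: cstar x) = - g ('i *: x).
  by rewrite -g_star cstarZ conjCi cstarK scaleNr gN.
pose phi x := (g x)%:C - 'i * (g ('i *: x))%:C.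
have phi_sa x : cstar x = x -> phi x = (g x)%:C.
  move=> xs; have := gi x; rewrite xs => /eqP;
    rewrite -addr_eq0 -mulr2n mulrn_eq0 /=.
  by move=> /eqP g0; rewrite /phi g0 mulr0 subr0.
exists phi; last first.
  rewrite phi_sa // -/h /g hs; apply: contraTneq fh0 => /complexI g0.
  by rewrite -leNgt; lra.
split=> [x y|k x|x|x].
- by rewrite /phi scalerDr !gD !rmorphD mulrDr opprD addrACA.
- have kE : k = (complex.Re k)%:C + 'i * (complex.Im k)%:C by rewrite -complexiE
    -complexE.
  move: kE; set a := complex.Re k; set b := complex.Im k => kE; rewrite /phi.
  have kx : k *: x = a%:C *: x + b%:C *: ('i *: x).
    by rewrite {1}kE scalerDl scalerA mulrC.
  have ikx : 'i *: (k *: x) = a%:C *: ('i *: x) + - (b%:C *: x).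
    rewrite kx scalerDr !scalerA [_ * a%:C]mulrC [_ * b%:C]mulrC -mulrA.
    by rewrite -expr2 sqrCi mulrN1 scaleNr.
  have gk : g (k *: x) = a * g x + b * g ('i *: x) by rewrite kx gD !gZ.
  have gik : g ('i *: (k *: x)) = a * g ('i *: x) - b * g x by rewrite ikx gD gN
    !gZ.
  rewrite gk gik kE; move: (g x) (g ('i *: x)) => u v.
  rewrite rmorphD rmorphB !rmorphM /=.
  rewrite -[LHS](subrK (b%:C * v%:C * (1 + 'i ^+ 2))) {2}sqrCi subrr mulr0
    addr0.
  by ring.
- by rewrite /phi g_star gi rmorphB rmorphM /= conjCi !conjCR rmorphN mulNr
    mulrN.
- rewrite phi_sa; last by rewrite cstarM cstarK.
  by rewrite ler0c /g cstarM cstarK addr_ge0 ?fP.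
Qed.

End States.

(** * Completion of a semi-inner product space *)

Lemma complex_filter_complete (R : realType) (T : Type) (F : set_system T)
    (z : T -> R[i]) : ProperFilter F ->
  (forall e, 0 < e -> exists2 A, F A & forall s t, A s -> A t ->
    cabs (z s - z t) <= e) ->
  exists l, forall e, 0 < e -> F [set t | cabs (l - z t) <= e].
Proof.
move=> FF zc.
have real_lim (g : R[i] -> R) : (forall u v, `|g u - g v| <= cabs (u - v)) ->
    exists l, forall e, 0 < e -> F [set t | `|l - g (z t)| <= e].
  move=> gc; have : cvg ((g \o z) @ F).
    apply/cauchy_cvgP/cauchyP => e e0.
    have [|A FA Ae] := zc (e / 2); first by rewrite divr_gt0.
    have [s As] := filter_ex FA; exists (g (z s)); near_simpl.
    apply: (@filterS _ F _ A) => // t At; rewrite -ball_normE /=.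
    rewrite (le_lt_trans (gc _ _)) // (le_lt_trans (Ae _ _ As At)) //.
    by rewrite ltr_pdivrMr // ltr_pMr // ltr1n.
  by move=> /cvg_ex[l /cvgrPdist_le lP]; exists l => e e0; exact: lP.
have [a aP] : exists l, forall e, 0 < e ->
  F [set t | `|l - complex.Re (z t)| <= e].
  apply: real_lim => u v; rewrite -raddfB /= -lecR -cabsE.
  exact: normc_ge_Re.
have [b bP] : exists l, forall e, 0 < e ->
  F [set t | `|l - complex.Im (z t)| <= e].
  apply: real_lim => u v; rewrite -raddfB /= -lecR -cabsE.
  have := normc_ge_Re ((u - v) * 'i%C).
  by rewrite ReiNIm normrN normrM complexiE normCi mulr1.
exists (a +i* b) => e e0.
have e2 : 0 < e / 2 by rewrite divr_gt0.
apply: filterS (filterI (aP _ e2) (bP _ e2)) => t [/= ae be].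
have -> : a +i* b - z t = (a - complex.Re (z t))%:C + 'i *
  (b - complex.Im (z t))%:C.
  rewrite -complexiE; case: (z t) => c d /=.
  by simpc.
rewrite (le_trans (cabsD _ _)) // cabsM !cabs_real.
have -> : cabs 'i = 1 :> R by apply: complexI; rewrite -cabsE normCi.
by rewrite mul1r [e]splitr lerD.
Qed.

Record psdspace (R : realType) := PsdSpace {
  psdcar :> lmodType R[i];
  pform : psdcar -> psdcar -> R[i];
  pformDr : forall x y z, pform x (y + z) = pform x y + pform x z;
  pformZr : forall k x y, pform x (k *: y) = k * pform x y;
  pform_conj : forall x y, pform y x = Num.conj (pform x y);
  pform_ge0 : forall x, 0 <= pform x x
}.

Section Psd.
Context (R : realType) (V : psdspace R).
Implicit Types x y z : V.
Local Notation f := (@pform R V).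

Lemma pformDl x y z : f (x + y) z = f x z + f y z.
Proof. by rewrite pform_conj pformDr rmorphD /= -!pform_conj. Qed.
Lemma pformZl k x y : f (k *: x) y = Num.conj k * f x y.
Proof. by rewrite pform_conj pformZr rmorphM /= -pform_conj. Qed.
Lemma pform0r x : f x 0 = 0.
Proof. by have := pformZr 0 x 0; rewrite scaler0 mul0r. Qed.
Lemma pform0l x : f 0 x = 0.
Proof. by rewrite pform_conj pform0r conjC0. Qed.
Lemma pformNr x y : f x (- y) = - f x y.
Proof. by apply/eqP; rewrite -addr_eq0 -pformDr addNr pform0r. Qed.
Lemma pformNl x y : f (- x) y = - f x y.
Proof. by apply/eqP; rewrite -addr_eq0 -pformDl addNr pform0l. Qed.
Lemma pformBr x y z : f x (y - z) = f x y - f x z.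
Proof. by rewrite pformDr pformNr. Qed.
Lemma pformBl x y z : f (x - y) z = f x z - f y z.
Proof. by rewrite pformDl pformNl. Qed.

Definition psq x : R := complex.Re (f x x).
Lemma psqE x : f x x = (psq x)%:C.
Proof. by rewrite /psq RRe_real // ger0_real // pform_ge0. Qed.
Lemma psq_ge0 x : 0 <= psq x.
Proof. by rewrite -ler0c -psqE pform_ge0. Qed.

Definition pnorm x : R := Num.sqrt (psq x).
Lemma pnorm_ge0 x : 0 <= pnorm x.
Proof. exact: sqrtr_ge0. Qed.
Lemma pnorm2 x : pnorm x ^+ 2 = psq x.
Proof. by rewrite sqr_sqrtr // psq_ge0. Qed.
Lemma pnorm0 : pnorm 0 = 0.
Proof. by rewrite /pnorm /psq pform0r /= sqrtr0. Qed.

Lemma pnorm_le x c : 0 <= c -> psq x <= c ^+ 2 -> pnorm x <= c.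
Proof. by move=> c0 xc; rewrite -(@ler_pXn2r _ 2) ?nnegrE ?pnorm_ge0 // pnorm2.
  Qed.

Lemma cabs_sqr (k : R[i]) : k * Num.conj k = (cabs k ^+ 2)%:C.
Proof. by rewrite rmorphXn /= -cabsE normCK. Qed.

Lemma pform_cs x y : cabs (f x y) <= pnorm x * pnorm y.
Proof.
set w := f y x.
have quad (t : R) : 0 <= psq x - 2 * t * cabs w ^+ 2 + t ^+ 2 * cabs w ^+ 2 *
  psq y.
  have := pform_ge0 (x - (t%:C * w) *: y).
  rewrite pformBr !pformBl !pformZl !pformZr (pform_conj y x) -/w rmorphM /=
    conjCR.
  rewrite -ler0c; congr (_ <= _); have := cabs_sqr w; move: (cabs w ^+ 2) =>
    m mE.
  have -> : psq x - 2 * t * m + t ^+ 2 * m * psq y =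
    psq x - t * m - t * m + t * t * m * psq y by ring.
  rewrite !rmorphD !rmorphN !rmorphM /= -mE -!psqE; ring.
have m0 : 0 <= cabs w ^+ 2 by rewrite exprn_ge0 // cabs_ge0.
have -> : cabs (f x y) = cabs w by rewrite /w pform_conj cabs_conj.
rewrite -(@ler_pXn2r _ 2) ?nnegrE ?mulr_ge0 ?pnorm_ge0 ?cabs_ge0 // exprMn
  !pnorm2.
have := psq_ge0 y; rewrite le_eqVlt => /predU1P[y0|y0].
  rewrite -y0 mulr0 leNgt; apply/negP => m1.
  (* If y is a null vector, the quadratic bound is affine in t, and this t makes its value -1. *)
  have := quad ((psq x + 1) / (2 * cabs w ^+ 2)); rewrite -y0 mulr0 addr0.
  have -> : 2 * ((psq x + 1) / (2 * cabs w ^+ 2)) * cabs w ^+ 2 = psq x + 1.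
    by field; rewrite -sqrf_eq0 gt_eqF.
  lra.
have := quad (psq y)^-1.
have -> : psq x - 2 * (psq y)^-1 * cabs w ^+ 2 + (psq y)^-1 ^+ 2 * cabs w ^+ 2 *
  psq y =
   psq x - cabs w ^+ 2 / psq y by field; rewrite gt_eqF.
by rewrite subr_ge0 ler_pdivrMr.
Qed.

Lemma pnormD x y : pnorm (x + y) <= pnorm x + pnorm y.
Proof.
apply: pnorm_le; first by rewrite addr_ge0 ?pnorm_ge0.
have -> : psq (x + y) = psq x + psq y + complex.Re (f x y + f y x).
  by rewrite /psq !pformDl !pformDr !raddfD /= addrACA addrA addrAC; lra.
have -> : complex.Re (f x y + f y x) = 2 * complex.Re (f x y).
  by rewrite (pform_conj x y) raddfD /=; case: (f x y) => a b /=; lra.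
have : complex.Re (f x y) <= cabs (f x y).
  rewrite (le_trans (ler_norm _)) // -lecR -cabsE; exact: normc_ge_Re.
have := pform_cs x y; rewrite sqrrD !pnorm2; lra.
Qed.

Lemma pnormZ k x : pnorm (k *: x) = cabs k * pnorm x.
Proof.
have -> : pnorm (k *: x) = Num.sqrt (cabs k ^+ 2 * psq x).
  congr (Num.sqrt _); apply: complexI.
  by rewrite rmorphM /= -cabs_sqr -!psqE pformZl pformZr mulrCA mulrA.
by rewrite sqrtrM ?exprn_ge0 ?cabs_ge0 // sqrtr_sqr ger0_norm ?cabs_ge0.
Qed.

End Psd.

(* The completion of a semi-inner product space [V], realised as the space of
   conjugate linear functionals on [V] that are norm limits of vectors of [V].
     *)
Section Hilbert.
Context (R : realType) (V : psdspace R).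
Implicit Types x y z u v : V.
Local Notation f := (@pform R V).

Definition approx (h : V -> R[i]) e v := forall x, cabs (h x - f x v) <= e *
  pnorm x.

Definition approximable (h : V -> R[i]) := forall e, 0 < e ->
  exists v, approx h e v.

Record hilb := Hilb { hfun :> V -> R[i]; hfunP : `[< approximable hfun >] }.

HB.instance Definition _ := [isSub for hfun].
HB.instance Definition _ := [Choice of hilb by <:].

Lemma hilbP (g h : hilb) : (forall x, g x = h x) -> g = h.
Proof. by move=> gh; apply: val_inj; apply/funext. Qed.

Lemma hilb_approx (h : hilb) e : 0 < e -> exists v, approx h e v.
Proof. by have /asboolP := hfunP h; apply. Qed.

Fact hilb0_subproof : `[< approximable (fun=> 0) >].
Proof.
apply/asboolP => e e0; exists 0 => x.
by rewrite pform0r subr0 cabs0 mulr_ge0 ?pnorm_ge0 // ltW.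
Qed.
Fact hilbN_subproof (h : hilb) : `[< approximable (fun x => - h x) >].
Proof.
apply/asboolP => e e0; have [v hv] := hilb_approx h e0; exists (- v) => x.
by rewrite pformNr -opprD cabsN.
Qed.
Fact hilbD_subproof (g h : hilb) : `[< approximable (fun x => g x + h x) >].
Proof.
apply/asboolP => e e0; have e2 : 0 < e / 2 by rewrite divr_gt0.
have [u gu] := hilb_approx g e2; have [v hv] := hilb_approx h e2.
exists (u + v) => x; rewrite pformDr opprD addrACA (le_trans (cabsD _ _)) //.
by rewrite [e]splitr mulrDl lerD.
Qed.
Fact hilbZ_subproof k (h : hilb) : `[< approximable (fun x => k * h x) >].
Proof.
apply/asboolP => e e0; have k1 : 0 < cabs k + 1 by rewrite ltr_wpDl ?cabs_ge0.
have [|v hv] := hilb_approx h (e := e / (cabs k + 1));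
  first by rewrite divr_gt0.
exists (k *: v) => x; rewrite pformZr -mulrBr cabsM.
rewrite (le_trans (ler_wpM2l (cabs_ge0 k) (hv x))) // mulrA ler_wpM2r ?pnorm_ge0
  //.
by rewrite mulrA ler_pdivrMr // mulrC ler_wpM2l ?(ltW e0) // lerDl.
Qed.
Fact embed_subproof v : `[< approximable (fun x => f x v) >].
Proof.
apply/asboolP => e e0; exists v => x.
by rewrite subrr cabs0 mulr_ge0 ?pnorm_ge0 // ltW.
Qed.

Definition hilb0 := Hilb hilb0_subproof.
Definition hilbN h := Hilb (hilbN_subproof h).
Definition hilbD g h := Hilb (hilbD_subproof g h).
Definition hilbZ k h := Hilb (hilbZ_subproof k h).
Definition embed v := Hilb (embed_subproof v).

Fact hilbDA : associative hilbD.
Proof. by move=> g h k; apply: hilbP => x /=; rewrite addrA. Qed.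
Fact hilbDC : commutative hilbD.
Proof. by move=> g h; apply: hilbP => x /=; rewrite addrC. Qed.
Fact hilb0D : left_id hilb0 hilbD.
Proof. by move=> g; apply: hilbP => x /=; rewrite add0r. Qed.
Fact hilbND : left_inverse hilb0 hilbN hilbD.
Proof. by move=> g; apply: hilbP => x /=; rewrite addNr. Qed.
HB.instance Definition _ := GRing.isZmodule.Build hilb hilbDA hilbDC hilb0D
  hilbND.

Fact hilbZA a b h : hilbZ a (hilbZ b h) = hilbZ (a * b) h.
Proof. by apply: hilbP => x /=; rewrite mulrA. Qed.
Fact hilb1Z : left_id 1 hilbZ.
Proof. by move=> h; apply: hilbP => x /=; rewrite mul1r. Qed.
Fact hilbZDr : right_distributive hilbZ +%R.
Proof. by move=> k g h; apply: hilbP => x /=; rewrite mulrDr. Qed.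
Fact hilbZDl h : {morph hilbZ^~ h : a b / a + b}.
Proof. by move=> a b; apply: hilbP => x /=; rewrite mulrDl. Qed.
HB.instance Definition _ :=
  GRing.Zmodule_isLmodule.Build R[i] hilb hilbZA hilb1Z hilbZDr hilbZDl.

Implicit Types g h : hilb.

Lemma cabs_small (k : R[i]) c : 0 <= c ->
  (forall e, 0 < e -> cabs k <= e * c) -> k = 0.
Proof.
move=> c0 kc; apply/cabs_eq0/le_anti; rewrite cabs_ge0 andbT.
apply/ler_addgt0Pl => e e0; rewrite addr0.
have [|] := boolP (0 < e / (c + 1)); last by rewrite divr_gt0 // ltr_wpDl.
move=> /kc /le_trans -> //; rewrite mulrAC ler_pdivrMr ?ltr_wpDl //.
by rewrite ler_wpM2l ?lerDl // ltW.
Qed.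

Lemma hfunD h x y : h (x + y) = h x + h y.
Proof.
apply/eqP; rewrite -subr_eq0; apply/eqP.
apply: (@cabs_small _ (pnorm (x + y) + (pnorm x + pnorm y))) => [|e e0].
  by rewrite !addr_ge0 ?pnorm_ge0.
have [v hv] := hilb_approx h e0.
have -> : h (x + y) - (h x + h y) =
    (h (x + y) - f (x + y) v) - ((h x - f x v) + (h y - f y v)).
  by rewrite pformDl; ring.
rewrite (le_trans (cabsD _ _)) // mulrDr lerD // cabsN.
by rewrite (le_trans (cabsD _ _)) // mulrDr lerD.
Qed.

Lemma hfunZ h k x : h (k *: x) = Num.conj k * h x.
Proof.
apply/eqP; rewrite -subr_eq0; apply/eqP.
apply: (@cabs_small _ (pnorm (k *: x) + cabs k * pnorm x)) => [|e e0].
  by rewrite !addr_ge0 ?mulr_ge0 ?cabs_ge0 ?pnorm_ge0.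
have [v hv] := hilb_approx h e0.
have -> : h (k *: x) - Num.conj k * h x =
    (h (k *: x) - f (k *: x) v) - Num.conj k * (h x - f x v).
  by rewrite pformZl; ring.
rewrite (le_trans (cabsD _ _)) // [leRHS]mulrDr lerD // cabsN cabsM cabs_conj.
by rewrite mulrCA ler_wpM2l ?cabs_ge0.
Qed.

Lemma hfunB h x y : h (x - y) = h x - h y.
Proof. by rewrite hfunD -scaleN1r hfunZ rmorphN rmorph1 mulN1r. Qed.

Lemma approx_dist h a b u v : approx h a u -> approx h b v -> 0 <= a ->
  0 <= b ->
  pnorm (u - v) <= a + b.
Proof.
move=> hu hv a0 b0; have [/eqP->|uv0] := boolP (pnorm (u - v) == 0).
  exact: addr_ge0.
have uvp : 0 < pnorm (u - v) by rewrite lt0r uv0 pnorm_ge0.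
rewrite -(ler_pM2r uvp) -expr2 pnorm2 (@le_trans _ _ (cabs (f (u - v) (u - v))))
  //.
  by rewrite psqE cabs_real ler_norm.
have -> : f (u - v) (u - v) =
    (h (u - v) - f (u - v) v) - (h (u - v) - f (u - v) u).
  by rewrite pformBr; ring.
by rewrite (le_trans (cabsD _ _)) // cabsN addrC mulrDl lerD.
Qed.

Lemma approx_bound h b v x : approx h b v -> 0 <= b ->
  cabs (h x) <= (b + pnorm v) * pnorm x.
Proof.
move=> hv b0; rewrite -(subrK (f x v) (h x)) (le_trans (cabsD _ _)) // mulrDl
  lerD //.
by rewrite [leRHS]mulrC pform_cs.
Qed.

(* Characterises the inner product [c] of [g] and [h] up to all errors. *)
Definition hip_spec g h c := forall u v a b, 0 <= a -> 0 <= b ->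
  approx g a u -> approx h b v -> cabs (c - f u v) <= a * pnorm v + b * pnorm
    u + a * b.

(** A functional h represents the vector with <x, h> = h x, so the inner product is the limit of
    h(a_n) along vectors a_n that approximate g within 1 / (n + 1). *)
Lemma hip_exists g h : exists c, hip_spec g h c.
Proof.
have inv0 (n : nat) : (0 : R) < n.+1%:R^-1 by rewrite invr_gt0.
have inv_small (e : R) : 0 < e -> \forall n \near \oo, n.+1%:R^-1 <= e.
  by move=> e0; near=> n; apply: ltW; near: n;
    exact: near_infty_natSinv_lt (PosNum e0).
have [a aP] := choice (fun n => hilb_approx g (inv0 n)).
have [w hw] := hilb_approx h ltr01.
have c10 : 0 < 1 + pnorm w by rewrite ltr_pwDl ?pnorm_ge0.
have [|c cP] := @complex_filter_complete R nat \oo (fun n => h (a n)) _.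
  move=> e e0; pose d := e / (1 + pnorm w) / 2.
  have d0 : 0 < d by rewrite !divr_gt0.
  exists [set n | n.+1%:R^-1 <= d]; first exact: inv_small.
  move=> m n /= md nd; rewrite -hfunB (le_trans (approx_bound _ hw ler01)) //.
  have := approx_dist (aP m) (aP n) (ltW (inv0 m)) (ltW (inv0 n)) =>
    /le_trans amn.
  by rewrite mulrC -ler_pdivlMr // amn // [leRHS]splitr lerD.
exists c => u v s t s0 t0 gu hv.
apply/ler_addgt0Pl => e e0.
have tv0 : 0 < t + pnorm v + 1 by rewrite ltr_wpDl // addr_ge0 ?pnorm_ge0.
have e2 : 0 < e / 2 by rewrite divr_gt0.
have d0 : 0 < e / 2 / (t + pnorm v + 1) by rewrite divr_gt0.
have [n [/= cn nd]] := filter_ex (filterI (cP _ e2) (inv_small _ d0)).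
have -> : c - f u v = (c - h (a n)) + h (a n - u) + (h u - f u v).
  by rewrite hfunB; ring.
have h1 : cabs (h (a n - u)) <= e / 2 + s * pnorm v + s * t.
  rewrite (le_trans (approx_bound _ hv t0)) //.
  have au := approx_dist (aP n) gu (ltW (inv0 n)) s0.
  have tv : 0 <= t + pnorm v by rewrite addr_ge0 ?pnorm_ge0.
  rewrite (le_trans (ler_wpM2l tv au)) // mulrDr -addrA lerD //.
    rewrite (le_trans (ler_wpM2l tv nd)) // mulrCA ler_piMr ?(ltW e2) //.
    by rewrite ler_pdivrMr // mul1r lerDl.
  by rewrite [leLHS]mulrC mulrDr addrC.
have := cabsD (c - h (a n) + h (a n - u)) (h u - f u v).
have := cabsD (c - h (a n)) (h (a n - u)); have := hv u; lra.
Unshelve. all: by end_near. Qed.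

Definition hip g h : R[i] := projT1 (cid (hip_exists g h)).

Lemma hipP g h : hip_spec g h (hip g h).
Proof. by rewrite /hip; case: cid. Qed.

Lemma hip_unique g h c : hip_spec g h c -> c = hip g h.
Proof.
move=> cP; apply/eqP; rewrite -subr_eq0; apply/eqP.
have [u1 gu1] := hilb_approx g ltr01; have [v1 hv1] := hilb_approx h ltr01.
(* An approximant with error d <= 1 lies within 1 + d <= 2 of the fixed one with error 1. Hence each
   of the two candidates differs from <u, v> by at most d m / 2. *)
pose m := 2 * ((2 + pnorm v1) + (2 + pnorm u1) + 1).
have m0 : 0 <= m by rewrite /m !(mulr_ge0, addr_ge0) // pnorm_ge0.
apply/cabs_eq0/le_anti; rewrite cabs_ge0 andbT.
apply/ler_addgt0Pl => e e0; rewrite addr0.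
pose d := Num.min 1 (e / (m + 1)).
have d0 : 0 < d by rewrite lt_min ltr01 divr_gt0 // ltr_wpDl.
have d1 : d <= 1 by rewrite ge_min lexx.
have dm : d * m <= e.
  have : d <= e / (m + 1) by rewrite ge_min lexx orbT.
  rewrite ler_pdivlMr ?ltr_wpDl //; nra.
have [u gu] := hilb_approx g d0; have [v hv] := hilb_approx h d0.
have pu : pnorm u <= 2 + pnorm u1.
  have := approx_dist gu gu1 (ltW d0) ler01; have := pnormD (u - u1) u1.
  by rewrite subrK; lra.
have pv : pnorm v <= 2 + pnorm v1.
  have := approx_dist hv hv1 (ltW d0) ler01; have := pnormD (v - v1) v1.
  by rewrite subrK; lra.
have h1 := cP u v d d (ltW d0) (ltW d0) gu hv.
have h2 := hipP (ltW d0) (ltW d0) gu hv.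
have -> : c - hip g h = (c - f u v) - (hip g h - f u v) by ring.
rewrite (le_trans (cabsD _ _)) // cabsN (le_trans (lerD h1 h2)) //.
apply: le_trans dm; rewrite /m.
have := ler_wpM2l (ltW d0) pu; have := ler_wpM2l (ltW d0) pv.
have := ler_wpM2l (ltW d0) d1; lra.
Qed.

Lemma hip_conj g h : hip h g = Num.conj (hip g h).
Proof.
apply/esym/hip_unique => u v a b a0 b0 hu gv.
have -> : Num.conj (hip g h) - f u v = Num.conj (hip g h - f v u).
  by rewrite rmorphB /= -pform_conj.
by rewrite cabs_conj (le_trans (hipP b0 a0 gv hu)) // [b * a]mulrC addrAC; lra.
Qed.

Lemma hip_embedl v h : hip (embed v) h = h v.
Proof.
apply/esym/hip_unique => u w a b a0 b0 vu hw.
have -> : h v - f u w = (h v - f v w) + f (v - u) w by rewrite pformBl; ring.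
have vu' : pnorm (v - u) <= a.
  have v0 : approx (embed v) 0 v by move=> x /=; rewrite subrr cabs0 mul0r.
  by have := approx_dist v0 vu (lexx 0) a0; rewrite add0r.
have := cabsD (h v - f v w) (f (v - u) w); have := hw v; have :=
  pform_cs (v - u) w.
have := pnormD (v - u) u; rewrite subrK.
have := ler_wpM2r (pnorm_ge0 w) vu'; have := ler_wpM2l b0 vu'.
have : pnorm v <= pnorm (v - u) + pnorm u ->
  b * pnorm v <= b * (pnorm (v - u) + pnorm u).
  by move=> vv; rewrite ler_wpM2l.
rewrite mulrDr; move=> i1 i2 i3 /i1 i4; lra.
Qed.

(** An inner product is thereby replaced by the evaluation h u with an error linear in that of u.
    Since evaluation is visibly linear in h, the linearity of [hip] follows by letting the error
    tend to zero. *)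
Lemma hip_eval g h : exists2 c, 0 <= c &
  forall a u, 0 <= a -> approx g a u -> cabs (hip g h - h u) <= a * c.
Proof.
have [v1 hv1] := hilb_approx h ltr01; exists (pnorm v1 + 3).
  by rewrite addr_ge0 ?pnorm_ge0.
move=> a u a0 gu; apply/ler_addgt0Pl => e e0.
have pu0 := pnorm_ge0 u.
have pu1 : 0 < 2 * pnorm u + 1 by rewrite ltr_wpDl // mulr_ge0.
pose b := Num.min 1 (e / (2 * pnorm u + 1)).
have b0 : 0 < b by rewrite lt_min ltr01 divr_gt0.
have b1 : b <= 1 by rewrite ge_min lexx.
have bu : b * (2 * pnorm u + 1) <= e by rewrite -ler_pdivlMr // ge_min lexx
  orbT.
have [v hv] := hilb_approx h b0.
have pv : pnorm v <= 2 + pnorm v1.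
  have := approx_dist hv hv1 (ltW b0) ler01; have := pnormD (v - v1) v1.
  by rewrite subrK; lra.
have -> : hip g h - h u = (hip g h - f u v) - (h u - f u v) by ring.
rewrite (le_trans (cabsD _ _)) // cabsN.
have := hipP a0 (ltW b0) gu hv; have := hv u.
have := ler_wpM2l a0 pv; have := ler_wpM2l a0 b1; lra.
Qed.

Lemma hipDr g h k : hip g (h + k) = hip g h + hip g k.
Proof.
have [c c0 cP] := hip_eval g h; have [d d0 dP] := hip_eval g k.
have [b b0 bP] := hip_eval g (h + k).
apply/eqP; rewrite -subr_eq0; apply/eqP.
apply: (@cabs_small _ (b + (c + d))) => [|e e0]; first by rewrite !addr_ge0.
have [u gu] := hilb_approx g e0.
have -> : hip g (h + k) - (hip g h + hip g k) =
    (hip g (h + k) - (h + k) u) - ((hip g h - h u) + (hip g k - k u)).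
  by rewrite -[(h + k) u]/(h u + k u); ring.
rewrite (le_trans (cabsD _ _)) // mulrDr lerD ?bP ?(ltW e0) // cabsN.
by rewrite (le_trans (cabsD _ _)) // mulrDr lerD ?cP ?dP ?(ltW e0).
Qed.

Lemma hipZr a g h : hip g (a *: h) = a * hip g h.
Proof.
have [c c0 cP] := hip_eval g h; have [b b0 bP] := hip_eval g (a *: h).
apply/eqP; rewrite -subr_eq0; apply/eqP.
apply: (@cabs_small _ (b + cabs a * c)) => [|e e0].
  by rewrite addr_ge0 // mulr_ge0 // cabs_ge0.
have [u gu] := hilb_approx g e0.
have -> : hip g (a *: h) - a * hip g h =
    (hip g (a *: h) - (a *: h) u) - a * (hip g h - h u).
  by rewrite -[(a *: h) u]/(a * h u); ring.
rewrite (le_trans (cabsD _ _)) // [leRHS]mulrDr lerD ?bP ?(ltW e0) // cabsN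
  cabsM.
by rewrite mulrCA ler_wpM2l ?cabs_ge0 // cP // ltW.
Qed.

Lemma hip_ge0 h : 0 <= hip h h.
Proof.
have [c c0 cP] := hip_eval h h.
have hE : (complex.Re (hip h h))%:C = hip h h.
  by rewrite RRe_real // CrealE -hip_conj.
rewrite -hE ler0c; apply/ler_addgt0Pl => e e0.
have [u1 hu1] := hilb_approx h ltr01.
pose m := c + (2 + pnorm u1).
have m0 : 0 < m by rewrite ltr_wpDl // ltr_pwDl ?pnorm_ge0.
pose d := Num.min 1 (e / m).
have d0 : 0 < d by rewrite lt_min ltr01 divr_gt0.
have d1 : d <= 1 by rewrite ge_min lexx.
have dm : d * m <= e by rewrite -ler_pdivlMr // ge_min lexx orbT.
have [u hu] := hilb_approx h d0.
have pu : pnorm u <= 2 + pnorm u1.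
  have := approx_dist hu hu1 (ltW d0) ler01; have := pnormD (u - u1) u1.
  by rewrite subrK; lra.
have : cabs (hip h h - f u u) <= e.
  have -> : hip h h - f u u = (hip h h - h u) + (h u - f u u) by ring.
  rewrite (le_trans (cabsD _ _)) // (le_trans _ dm) // mulrDr lerD ?cP ?(ltW d0)
    //.
  by rewrite (le_trans (hu u)) // ler_wpM2l // ltW.
rewrite -hE psqE -rmorphB cabs_real ler_distlC => /andP[_ he].
by have := psq_ge0 u; lra.
Qed.

Definition hilb_psd : psdspace R := PsdSpace hipDr hipZr hip_conj hip_ge0.

Lemma pnorm_embed v : pnorm (embed v : hilb_psd) = pnorm v.
Proof. by congr Num.sqrt; rewrite /psq /= hip_embedl. Qed.

Lemma hfun_le h x : cabs (h x) <= pnorm x * pnorm (h : hilb_psd).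
Proof. by rewrite -hip_embedl -pnorm_embed; exact: (@pform_cs _ hilb_psd). Qed.

(** The hypothesis says that 0 approximates h with error e, so [hip_spec] bounds <h, h> by e^2. *)
Lemma hilb_norm_le h e : 0 <= e -> (forall x, cabs (h x) <= e * pnorm x) ->
  pnorm (h : hilb_psd) <= e.
Proof.
move=> e0 he; apply: pnorm_le => //.
have h0 : approx h e 0 by move=> x; rewrite pform0r subr0.
have := hipP e0 e0 h0 h0; rewrite pform0r subr0 pnorm0 mulr0 !add0r -expr2.
apply: le_trans; rewrite -[hip h h]/(@pform _ hilb_psd h h) psqE cabs_real.
exact: ler_norm.
Qed.

Fact hilb_normD g h : (pnorm (g + h : hilb_psd))%:C <=
  (pnorm (g : hilb_psd))%:C + (pnorm (h : hilb_psd))%:C :> R[i].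
Proof. by rewrite -rmorphD lecR; exact: pnormD. Qed.
Fact hilb_normZ (a : R[i]) h :
  (pnorm (a *: h : hilb_psd))%:C = `|a| * (pnorm (h : hilb_psd))%:C :> R[i].
Proof. by rewrite cabsE -rmorphM; congr (_%:C);
  exact: (@pnormZ _ hilb_psd). Qed.
Fact hilb_norm_eq0 h : (pnorm (h : hilb_psd))%:C = 0 :> R[i] -> h = 0.
Proof.
move=> /complexI h0; apply: hilbP => x; apply/cabs_eq0/le_anti.
by rewrite cabs_ge0 andbT (le_trans (hfun_le h x)) // h0 mulr0.
Qed.

HB.instance Definition _ := Lmodule_isNormed.Build R[i] hilb
  hilb_normD hilb_normZ hilb_norm_eq0.

Lemma nm_hilb h : nm h = pnorm (h : hilb_psd).
Proof. by []. Qed.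

Fact hilb_complete (F : set_system hilb) : ProperFilter F -> cauchy F -> cvg F.
Proof.
move=> FF /cauchy_nmP Fc.
have Fx x : exists l, forall e, 0 < e -> F [set h : hilb | cabs (l - h x) <= e].
  apply: complex_filter_complete => e e0.
  have p1 : 0 < pnorm x + 1 by rewrite ltr_wpDl ?pnorm_ge0.
  have [|A FA Ae] := Fc (e / (pnorm x + 1)); first by rewrite divr_gt0.
  exists A => // g h Ag Ah; rewrite (le_trans (hfun_le (g - h) x)) // -nm_hilb.
  rewrite (le_trans (ler_wpM2l (pnorm_ge0 x) (Ae _ _ Ag Ah))) // mulrC.
  by rewrite mulrAC ler_pdivrMr // ler_wpM2l ?(ltW e0) // lerDl.
have [l lP] := choice Fx.
have lA e A : 0 < e -> F A ->
  (forall g h : hilb, A g -> A h -> nm (g - h) <= e) ->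
    forall g : hilb, A g -> forall x, cabs (l x - g x) <= e * pnorm x.
  move=> e0 FA Ae g Ag x; apply/ler_addgt0Pl => d d0.
  have [h [/= lh Ah]] := filter_ex (filterI (lP x d d0) FA).
  have -> : l x - g x = (l x - h x) + (h - g) x.
    by rewrite -[(h - g) x]/(h x - g x); ring.
  rewrite (le_trans (cabsD _ _)) // lerD // (le_trans (hfun_le (h - g) x)) //.
  by rewrite mulrC ler_wpM2r ?pnorm_ge0 // -nm_hilb Ae.
have lapp : `[< approximable l >].
  apply/asboolP => e e0; have e2 : 0 < e / 2 by rewrite divr_gt0.
  have [A FA Ae] := Fc _ e2; have [g Ag] := filter_ex FA.
  have [v gv] := hilb_approx g e2; exists v => x.
  have -> : l x - f x v = (l x - g x) + (g x - f x v) by ring.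
  rewrite (le_trans (cabsD _ _)) // [e]splitr mulrDl lerD //.
  exact: (lA _ _ e2 FA Ae).
apply/cvg_ex; exists (Hilb lapp); apply/cvg_nmP => e e0.
have [A FA Ae] := Fc e e0; apply: (@filterS _ F _ A) => // g Ag /=.
by rewrite nm_hilb; apply: hilb_norm_le; [exact: ltW|exact: (lA _ _ e0 FA Ae)].
Qed.

HB.instance Definition _ := Uniform_isComplete.Build hilb hilb_complete.

Fact hilb_nm_ip h : cabs (hip h h) = nm h ^+ 2.
Proof.
rewrite nm_hilb pnorm2 -[hip h h]/(@pform _ hilb_psd h h) psqE cabs_real.
by rewrite ger0_norm // psq_ge0.
Qed.
Fact hilb_cs g h : cabs (hip g h) <= nm g * nm h.
Proof. exact: (@pform_cs _ hilb_psd). Qed.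
Fact hipDl g h k : hip (g + h) k = hip g k + hip h k.
Proof. exact: (@pformDl _ hilb_psd). Qed.
Fact hipZl a g h : hip (a *: g) h = Num.conj a * hip g h.
Proof. exact: (@pformZl _ hilb_psd). Qed.

Definition hilbert : ipspace R :=
  @IpSpace R hilb (R[i] : numFieldType)^o hip hipDl hipDr hipZl
    (fun a g h => hipZr a g h) hilb_nm_ip hilb_cs.

End Hilbert.

(** * Representations modulo null vectors *)

(* A representation by maps which respect the algebra operations only modulo
   the null vectors of the form. *)
Record weakrep (R : realType) (A : cstarAlgType R) (V : psdspace R)
    (act : A -> V -> V) : Prop := WeakRep {
  wr_adj : forall a u v, pform (act a u) v = pform u (act (cstar a) v);
  wr_add : forall a b u v,
    pform u (act (a + b) v) = pform u (act a v) + pform u (act b v);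
  wr_scale : forall k a u v, pform u (act (k *: a) v) = k * pform u (act a v);
  wr_mul : forall a b u v, pform u (act (a ** b) v) = pform u (act a (act b v))
}.

Section WeakRep.
Context (R : realType) (A : cstarAlgType R) (V : psdspace R) (act : A -> V ->
  V).
Hypothesis actP : weakrep act.
Implicit Types (a b : A) (u v x : V) (g h : hilb V).
Local Notation f := (@pform R V).

Lemma wr_psq a v : f (act a v) (act a v) = f v (act (cstar a ** a) v).
Proof. by rewrite (wr_adj actP) (wr_mul actP). Qed.

(** Boundedness is automatic: for s with 2 s - s^2 = a^* a, the nonnegative number |v - s v|^2
    equals |v|^2 - |a v|^2. *)
Lemma wr_contr_small a v : nm a < 1 -> psq (act a v) <= psq v.
Proof.
move=> a1; have hs : cstar (cstar a ** a) = cstar a ** a by rewrite cstarM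
  cstarK.
have h1 : nm (cstar a ** a) < 1 by rewrite nm_cstar_cmul expr_lt1 ?nm_ge0.
have [s [ss sE _]] := qsqrt hs h1.
have := pform_ge0 (v - act s v).
rewrite pformBr !pformBl (wr_adj actP) ss (wr_adj actP) ss -(wr_mul actP).
have -> : f v (act (s ** s) v) = f v (act s v) + f v (act s v) - f v
  (act (cstar a ** a) v).
  have -> : s ** s = s + s + (-1) *: (cstar a ** a) by rewrite -sE scaleN1r
    subKr.
  by rewrite !(wr_add actP) (wr_scale actP) mulN1r.
have -> : f v v - f v (act s v) - (f v (act s v) -
   (f v (act s v) + f v (act s v) - f v (act (cstar a ** a) v))) =
   f v v - f v (act (cstar a ** a) v) by ring.
by rewrite -wr_psq !psqE -rmorphB ler0c subr_ge0.
Qed.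

Lemma wr_contr a v : pnorm (act a v) <= nm a * pnorm v.
Proof.
apply: pnorm_le; first by rewrite mulr_ge0 ?nm_ge0 ?pnorm_ge0.
suff le t : nm a < t -> psq (act a v) <= t ^+ 2 * psq v.
  rewrite exprMn pnorm2 leNgt; apply/negP => lt.
  have v0 : 0 < psq (act a v) :=
    le_lt_trans (mulr_ge0 (exprn_ge0 2 (nm_ge0 a)) (psq_ge0 v)) lt.
  pose d := psq (act a v) - nm a ^+ 2 * psq v.
  have d0 : 0 < d by rewrite subr_gt0.
  pose q := (2 * nm a + 1) * psq v.
  have q0 : 0 <= q by rewrite mulr_ge0 ?psq_ge0 // addr_ge0 // mulr_ge0 ?nm_ge0.
  pose e := Num.min 1 (d / (q + 1)).
  have e0 : 0 < e by rewrite lt_min ltr01 divr_gt0 // ltr_wpDl.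
  have e1 : e <= 1 by rewrite ge_min lexx.
  have eq : e * (q + 1) <= d by rewrite -ler_pdivlMr ?ltr_wpDl // ge_min lexx
    orbT.
  have := le (nm a + e); rewrite ltrDl => /(_ e0).
  rewrite leNgt => /negP[]; rewrite -(subrK (nm a ^+ 2 * psq v) (psq (act a v)))
    -/d.
  have ee : e ^+ 2 <= e by rewrite expr2 ler_piMr // ltW.
  have := ler_wpM2r (psq_ge0 v) ee.
  have -> : (nm a + e) ^+ 2 * psq v = nm a ^+ 2 * psq v + 2 * nm a * e * psq v +
    e ^+ 2 * psq v by ring.
  have : e * (q + 1) = 2 * nm a * e * psq v + e * psq v + e by rewrite /q; ring.
  lra.
move=> at_; have t0 : 0 < t := le_lt_trans (nm_ge0 a) at_.
have := @wr_contr_small (t^-1%:C *: a) v.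
rewrite nmZr gtr0_norm ?invr_gt0 // mulrC ltr_pdivrMr // mul1r => /(_ at_).
suff -> : psq (act (t^-1%:C *: a) v) = t^-1 ^+ 2 * psq (act a v).
  by rewrite exprVn mulrC ler_pdivrMr ?exprn_gt0 // mulrC.
apply: complexI; rewrite rmorphM /= -!psqE !wr_psq cstarZR -cscaleAl -cscaleAr
  scalerA.
by rewrite (wr_scale actP) -rmorphM expr2.
Qed.

Lemma wr_approx a h e v : approx h e v -> 0 <= e ->
  approx (fun x => h (act (cstar a) x)) (e * nm a) (act a v).
Proof.
move=> hv e0 x; have -> : f x (act a v) = f (act (cstar a) x) v.
  by rewrite (wr_adj actP) cstarK.
rewrite (le_trans (hv _)) // -mulrA ler_wpM2l //.
by rewrite -(nm_cstar a) wr_contr.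
Qed.

Fact rep_subproof a h : `[< approximable (fun x => h (act (cstar a) x)) >].
Proof.
apply/asboolP => e e0; have a1 : 0 < nm a + 1 by rewrite ltr_wpDl ?nm_ge0.
have [|v hv] := hilb_approx h (e := e / (nm a + 1)); first by rewrite divr_gt0.
exists (act a v) => x; rewrite (le_trans (wr_approx a hv _ x)) //.
  by rewrite divr_ge0 // ltW.
rewrite ler_wpM2r ?pnorm_ge0 // mulrAC ler_pdivrMr //.
by rewrite ler_wpM2l ?(ltW e0) // lerDl.
Qed.

(** Because h x stands for <x, h>, moving a to the other side turns its action into precomposition
    with the action of its adjoint. *)
Definition rep_fun a h : hilb V := Hilb (rep_subproof a h).

Lemma rep_funE a h x : rep_fun a h x = h (act (cstar a) x).
Proof. by []. Qed.

Lemma rep_adj a g h : hip (rep_fun a g) h = hip g (rep_fun (cstar a) h).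
Proof.
have [c c0 cP] := hip_eval (rep_fun a g) h.
have [d d0 dP] := hip_eval g (rep_fun (cstar a) h).
apply/eqP; rewrite -subr_eq0; apply/eqP.
apply: (@cabs_small _ _ (nm a * c + d)) => [|e e0].
  by rewrite addr_ge0 // mulr_ge0 // nm_ge0.
have [u gu] := hilb_approx g e0.
have -> : hip (rep_fun a g) h - hip g (rep_fun (cstar a) h) =
    (hip (rep_fun a g) h - h (act a u)) -
    (hip g (rep_fun (cstar a) h) - rep_fun (cstar a) h u).
  by rewrite rep_funE cstarK; ring.
rewrite (le_trans (cabsD _ _)) // cabsN mulrDr lerD ?dP ?(ltW e0) // mulrA.
by apply: cP; [rewrite mulr_ge0 ?nm_ge0 // ltW|apply: wr_approx => //;
  exact: ltW].
Qed.

Lemma rep_nm a h : nm (rep_fun a h) <= nm a * nm h.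
Proof.
rewrite nm_hilb; apply: hilb_norm_le => [|x].
  by rewrite mulr_ge0 ?nm_ge0.
rewrite rep_funE (le_trans (hfun_le _ _)) // mulrAC ler_wpM2r ?pnorm_ge0 //.
by rewrite -(nm_cstar a) wr_contr.
Qed.

Fact rep_adjointable a : `[< @adjointable R (hilbert V) (rep_fun a) >].
Proof.
apply/asboolP; split.
  exists (rep_fun (cstar a)); split=> g h; rewrite /= rep_adj //.
  by rewrite cstarK.
by exists (nm a) => h; exact: rep_nm.
Qed.

Definition rep a : adjop (hilbert V) := Adjop (rep_adjointable a).

(** Here x - y is a null vector, and points of the completion are bounded by the seminorm. This
    turns the identities of [weakrep] into true identities of operators. *)
Lemma hfun_weak h x y : (forall u, f u x = f u y) -> h x = h y.
Proof.
move=> xy; apply/eqP; rewrite -subr_eq0 -hfunB; apply/eqP/cabs_eq0/le_anti.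
rewrite cabs_ge0 andbT (le_trans (hfun_le _ _)) //.
by rewrite /pnorm /psq pformBr xy subrr /= sqrtr0 mul0r.
Qed.

Fact repD : {morph rep : a b / a + b}.
Proof.
move=> a b; apply: adjopP => h; apply: hilbP => x.
transitivity (h (act (cstar a) x + act (cstar b) x)); last exact: hfunD.
apply: (@hfun_weak h) => u.
by rewrite cstarD (wr_add actP) pformDr.
Qed.

Fact repZ (k : R[i]) : {morph rep : a / k *: a}.
Proof.
move=> a; apply: adjopP => h; apply: hilbP => x.
transitivity (h (Num.conj k *: act (cstar a) x)); last by rewrite hfunZ conjCK.
apply: (@hfun_weak h) => u.
by rewrite cstarZ (wr_scale actP) pformZr.
Qed.

Fact repM : {morph rep : a b / a ** b}.
Proof.
move=> a b; apply: adjopP => h; apply: hilbP => x.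
by apply: (@hfun_weak h) => u; rewrite cstarM (wr_mul actP).
Qed.

Fact rep_star : {morph rep : a / cstar a}.
Proof. by move=> a; apply/esym/adj_eq => g h; exact: rep_adj. Qed.

Fact rep_linear : linear rep.
Proof. by move=> k a b; rewrite repD repZ. Qed.

HB.instance Definition _ := GRing.isLinear.Build R[i] A (adjop (hilbert V)) _
  rep rep_linear.
HB.instance Definition _ := isStarHom.Build R A (adjop (hilbert V)) rep repM
  rep_star.

Definition starrep : {starhom A -> adjop (hilbert V)} := rep.

Lemma starrep_embed a v : starrep a (embed v) = embed (act a v).
Proof.
apply: hilbP => x; rewrite /= (wr_adj actP); congr (f _ (act _ _)).
exact: cstarK.
Qed.

End WeakRep.

(** * Complete positivity of conditional expectations *)

Section CondExp.
Context (R : realType) (X D : cstarAlgType R) (phi : {starhom D -> X})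
  (E : X -> D).
Hypothesis EP : conditional_expectation phi E.
Implicit Types (x y : X) (d : D).

Lemma condexpD x y : E (x + y) = E x + E y.
Proof. by rewrite -{1}(scale1r x) (condexp_linear EP) scale1r. Qed.
Lemma condexp0 : E 0 = 0.
Proof. by apply: (addrI (E 0)); rewrite -condexpD !addr0. Qed.
Lemma condexpZ k x : E (k *: x) = k *: E x.
Proof. by rewrite -{1}(addr0 (k *: x)) (condexp_linear EP) condexp0 addr0. Qed.
Lemma condexpN x : E (- x) = - E x.
Proof. by rewrite -scaleN1r condexpZ scaleN1r. Qed.
Lemma condexpB x y : E (x - y) = E x - E y.
Proof. by rewrite condexpD condexpN. Qed.

Lemma condexp_sq x : exists d, E (cstar x ** x) = cstar d ** d.
Proof. by apply: (condexp_pos EP); exists x. Qed.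

Lemma condexp_sq_sa x : cstar (E (cstar x ** x)) = E (cstar x ** x).
Proof. by have [d ->] := condexp_sq x; rewrite cstarM cstarK. Qed.

(** Polarisation: each E(z^* z) is self-adjoint by positivity, and z = x + y together with z = x + i
    y determine the mixed terms. *)
Lemma condexp_herm x y : cstar (E (cstar y ** x)) = E (cstar x ** y).
Proof.
have cancel (p q r s q' r' : D) : p + q + (r + s) = p + q' + (r' + s) ->
  q + r = q' + r'.
  by rewrite !addrA => /addIr; rewrite -!addrA => /addrI.
have sum_sa z : cstar (E (cstar x ** z)) + cstar (E (cstar z ** x)) =
    E (cstar x ** z) + E (cstar z ** x).
  have := condexp_sq_sa (x + z).
  rewrite cstarD cmulDl !cmulDr !condexpD !cstarD !condexp_sq_sa.
  exact: cancel.
have diff_sa : cstar (E (cstar y ** x)) - cstar (E (cstar x ** y)) =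
    E (cstar x ** y) - E (cstar y ** x).
  have := sum_sa ('i *: y).
  rewrite cstarZ conjCi -cscaleAl -cscaleAr !condexpZ !cstarZ rmorphN /= conjCi
    opprK.
  rewrite !scaleNr addrC -!scalerBr => h.
  by apply: (@scalerI _ D 'i _ _ _ h); exact: neq0Ci.
have {}sum_sa := sum_sa y.
have : cstar (E (cstar y ** x)) *+ 2 = E (cstar x ** y) *+ 2.
  have := congr2 +%R sum_sa diff_sa.
  by rewrite addrC addrA subrK addrACA subrr addr0 -!mulr2n.
move=> h2; have h : (2 : R[i]) *: cstar (E (cstar y ** x)) = (2 : R[i]) *:
  E (cstar x ** y).
  by rewrite !scaler_nat.
by apply: (@scalerI _ D 2 _ _ _ h); rewrite pnatr_eq0.
Qed.

(** There may be no unit to insert into [condexp_herm]. Elements coming from D are inserted instead,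
    which shows that the difference of the two sides is annihilated by every c in D, in particular
    by its own adjoint. *)
Lemma condexp_star x : E (cstar x) = cstar (E x).
Proof.
apply/eqP; rewrite -subr_eq0; apply/eqP.
pose d := E (cstar x) - cstar (E x).
have h1 c : c ** E (cstar x) = c ** cstar (E x).
  have -> : c ** cstar (E x) = cstar (E x ** cstar c) by rewrite cstarM cstarK.
  rewrite -(condexp_modr EP) -{2}(cstarK x) condexp_herm starhom_star cstarK.
  by rewrite (condexp_modl EP).
by apply: cstar_cmul_eq0; rewrite -/d {2}/d cmulBr h1 subrr.
Qed.

End CondExp.

(** * Positivity of a form on sums of vectors *)

Section Form.
Context (R : realType) (V : psdspace R) (x : V -> V).
Hypothesis xD : forall u v, x (u + v) = x u + x v.
Hypothesis xZ : forall k u, x (k *: u) = k *: x u.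
Hypothesis x_adj : forall u v, pform (x u) v = pform u (x v).
Hypothesis x_ge0 : forall u, 0 <= pform u (x u).
Implicit Types (u v : V) (p q : {poly R}).

Lemma pev_adj p u v : pform (pev x p u) v = pform u (pev x p v).
Proof.
have iter_adj n w z : pform (iter n x w) z = pform w (iter n x z).
  by elim: n w z => //= n ih w z; rewrite x_adj ih -iterSr.
rewrite /pev.
have sum_adj n (c : nat -> R) : pform (\sum_(i < n) (c i)%:C *: iter i x u) v =
    pform u (\sum_(i < n) (c i)%:C *: iter i x v).
  elim: n => [|n ih]; first by rewrite !big_ord0 pform0l pform0r.
  by rewrite !big_ord_recr /= pformDl pformDr ih pformZl pformZr conjCR
    iter_adj.
exact: (sum_adj _ (fun i => p`_i)).
Qed.

Lemma pev_addv p u v : pev x p (u + v) = pev x p u + pev x p v.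
Proof.
have iterD n : iter n x (u + v) = iter n x u + iter n x v.
  by elim: n => //= n ->; rewrite xD.
by rewrite /pev -big_split; apply: eq_bigr => i _; rewrite iterD scalerDr.
Qed.

Lemma pev_scalev p k u : pev x p (k *: u) = k *: pev x p u.
Proof.
have iterZ n : iter n x (k *: u) = k *: iter n x u.
  by elim: n => //= n ->; rewrite xZ.
rewrite /pev scaler_sumr; apply: eq_bigr => i _.
by rewrite iterZ !scalerA mulrC.
Qed.

Lemma qmod_form_ge0 p u : qmod p -> 0 <= pform u (pev x p u).
Proof.
move=> pP; elim: pP u => [q u|q u|{}p q _ ihp _ ihq u].
- by rewrite expr2 (pevM xD xZ) -pev_adj pform_ge0.
- rewrite mulrC expr2 -mulrA [q * 'X]mulrC !(pevM xD xZ) -pev_adj.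
  by rewrite (pevX xD xZ) x_ge0.
- by rewrite pevD pformDr addr_ge0.
Qed.

(** A certificate yields a semi-inner product in its own right, whose seminorm obeys the triangle
    inequality. *)
Definition qmod_psd p (pP : qmod p) : psdspace R.
Proof.
refine (@PsdSpace R V (fun u v => pform u (pev x p v)) _ _ _ _).
- by move=> u v w; rewrite pev_addv pformDr.
- by move=> k u v; rewrite pev_scalev pformZr.
- by move=> u v; rewrite -pev_adj [LHS]pform_conj.
- by move=> u; exact: qmod_form_ge0.
Defined.

Lemma Re_ge0 (w : R[i]) : 0 <= w -> 0 <= complex.Re w.
Proof. by move=> w0; rewrite -ler0c RRe_real // ger0_real. Qed.

(* High powers of [x] concentrate on the part of the spectrum where [1 - x] is
   small or negative. *)
Lemma form_concentrate n (us : 'I_n -> V) (u := \sum_(i < n) us i) :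
  (forall i k, 0 <= pform (iter k x (us i))
    (iter k x (us i) - x (iter k x (us i)))) ->
  0 <= pform u (u - x u).
Proof.
move=> us0; pose S := \sum_(i < n) pnorm (us i).
pose fk k : {poly R} := 'X^(k.*2) * (1 - 'X).
(* In the form of 1 - 2k X^(2k) (1 - X) no [us i] is longer than before, because by hypothesis
   x^(2k) (1 - x) is nonnegative at [us i]. The triangle inequality then bounds the length of [u] by
   [S], uniformly in k. *)
have peak k : psq u - k.*2%:R * complex.Re (pform u (pev x (fk k) u)) <= S ^+ 2.
  have gP := @qmod_peak R k.*2; rewrite -/(fk k) in gP.
  have QE v : @psq _ (qmod_psd gP) v =
      psq v - k.*2%:R * complex.Re (pform v (pev x (fk k) v)).
    rewrite /psq /= pevD pevN pevZ pev1 pformBr pformZr raddfB /=;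
      congr (_ - _).
    by rewrite rmorph_nat !mulr_natl raddfMn.
  have usg i : @pnorm _ (qmod_psd gP) (us i) <= pnorm (us i).
    apply: ler_wsqrtr; rewrite QE lerBlDr lerDl mulr_ge0 //; apply: Re_ge0.
    rewrite /fk -addnn exprD -mulrA (pevXnM xD xZ).
    have iterE m v : iter m x v = pev x 'X^m v.
      by rewrite -['X^m]mulr1 (pevXnM xD xZ) pev1.
    rewrite iterE -pev_adj -iterE mulrC (pevM xD xZ) -iterE pevD pevN pev1
      (pevX xD xZ).
    exact: us0.
  have QS m (w : 'I_m -> V) :
      @pnorm _ (qmod_psd gP) (\sum_(i < m) w i) <= \sum_(i < m) @pnorm _
        (qmod_psd gP) (w i).
    elim: m w => [|m ih] w; first by rewrite !big_ord0
      (@pnorm0 _ (qmod_psd gP)).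
    rewrite !big_ord_recr /= (le_trans (@pnormD _ (qmod_psd gP) _ _)) // lerD2r.
    exact: ih.
  rewrite -QE -(@pnorm2 _ (qmod_psd gP)) ler_pXn2r ?nnegrE ?pnorm_ge0 //.
    by rewrite (le_trans (QS _ _)) // ler_sum.
  by apply: sumr_ge0 => i _; exact: pnorm_ge0.
pose w := pform u (u - x u).
have wE : (complex.Re w)%:C = w.
  rewrite RRe_real // /w pformBr psqE; apply: rpredB.
    by rewrite complex_real.
  by rewrite ger0_real.
rewrite -/w -wE ler0c leNgt; apply/negP => w0.
(* The certificate (1 - X)(1 - X^(2k)) gives x^(2k) (1 - x) <= 1 - x as forms. So if w is negative,
   the left side of [peak] grows at least like 2k |w|. *)
have fw k : complex.Re (pform u (pev x (fk k) u)) <= complex.Re w.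
  rewrite -subr_ge0 -raddfB; apply: Re_ge0.
  have -> : w = pform u (pev x (1 - 'X) u).
    by rewrite pevD pevN pev1 (pevX xD xZ).
  rewrite -pformBr -pevN -pevD (_ : _ - _ = (1 - 'X) * (1 - 'X^(k.*2)));
    last first.
    by rewrite /fk; ring.
  exact: qmod_form_ge0 (@qmod_geom R k.*2).
pose k := Num.bound (S ^+ 2 / - complex.Re w).
have nw0 : 0 < - complex.Re w by rewrite oppr_gt0.
have kS : S ^+ 2 < k%:R * - complex.Re w.
  rewrite -ltr_pdivrMr // archi_boundP // divr_ge0 ?(ltW nw0) //.
  by rewrite exprn_ge0 // sumr_ge0 // => i _; exact: pnorm_ge0.
have := peak k; have := psq_ge0 u.
have kk : (k%:R : R) <= k.*2%:R by rewrite ler_nat -addnn leq_addr.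
have k0 : (0 : R) <= k.*2%:R by [].
have := ler_wpM2l k0 (fw k); have := ler_wpM2r (ltW nw0) kk; lra.
Qed.

End Form.

Section CompletelyPositive.
Context (R : realType) (X D : cstarAlgType R) (phi : {starhom D -> X})
  (E : X -> D).
Hypothesis EP : conditional_expectation phi E.
Context (V : psdspace R) (act : D -> V -> V).
Hypothesis actP : weakrep act.
Context (n : nat) (a : 'I_n -> X).
Local Notation H := (hilb V).
Local Notation N := ('I_n -> hilb V).
Local Notation pi := (starrep actP).
Local Notation G i j := (E (cstar (a i) ** a j)).

Let tform (u v : N) : R[i] := \sum_i hip (u i) (v i).

Fact tformDr u v w : tform u (v + w) = tform u v + tform u w.
Proof. by rewrite /tform -big_split; apply: eq_bigr => i _; exact: hipDr. Qed.
Fact tformZr k u v : tform u (k *: v) = k * tform u v.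
Proof. by rewrite /tform mulr_sumr; apply: eq_bigr => i _; exact: hipZr. Qed.
Fact tform_conj u v : tform v u = Num.conj (tform u v).
Proof. by rewrite /tform rmorph_sum; apply: eq_bigr => i _;
  exact: hip_conj. Qed.
Fact tform_ge0 u : 0 <= tform u u.
Proof. by apply: sumr_ge0 => i _; exact: hip_ge0. Qed.

Definition tuple_psd : psdspace R :=
  @PsdSpace R N tform tformDr tformZr tform_conj tform_ge0.

Let G_star i j : cstar (G i j) = G j i.
Proof. by rewrite -(condexp_star EP) cstarM cstarK. Qed.

Let T (u : N) : N := fun i => \sum_j pi (G i j) (u j).

Let TD u v : T (u + v) = T u + T v.
Proof.
apply/funext => i; rewrite -[RHS]/(T u i + T v i) /T -big_split;
  apply: eq_bigr => j _.
exact: (aopD (pi (G i j)) (u j) (v j)).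
Qed.

Let TZ k u : T (k *: u) = k *: T u.
Proof.
apply/funext => i; rewrite -[RHS]/(k *: T u i) /T scaler_sumr.
by apply: eq_bigr => j _; exact: (aopZ (pi (G i j)) k (u j)).
Qed.

Lemma hip_sumr (I : finType) (F : I -> H) (h : H) :
  hip h (\sum_i F i) = \sum_i hip h (F i).
Proof.
apply: (big_ind2 (fun x y => hip h x = y)) => // [|x1 y1 x2 y2 <- <-];
  last exact: hipDr.
by have := hipZr 0 h 0; rewrite scaler0 mul0r.
Qed.

Lemma hip_suml (I : finType) (F : I -> H) (h : H) :
  hip (\sum_i F i) h = \sum_i hip (F i) h.
Proof.
by rewrite hip_conj hip_sumr rmorph_sum; apply: eq_bigr => i _ /=;
  rewrite -hip_conj.
Qed.

Let pi_adj d g h : hip (pi d g) h = hip g (pi (cstar d) h).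
Proof. exact: rep_adj. Qed.

Let T_adj u v : tform (T u) v = tform u (T v).
Proof.
rewrite /tform.
under eq_bigr do rewrite hip_suml; under [RHS]eq_bigr do rewrite hip_sumr.
rewrite exchange_big; apply: eq_bigr => i _; apply: eq_bigr => j _.
by rewrite pi_adj G_star.
Qed.

(** The double sum bounds the form of the Gram operator [T], so x = 1 - c T is a positive form. The
    positive part of [T] corresponds to x < 1 and a negative part would correspond to x > 1; the
    summand 1 keeps the inverse meaningful. *)
Let c : R := (1 + \sum_i \sum_j nm (G i j))^-1.
Let gsum_ge0 : 0 <= \sum_i \sum_j nm (G i j).
Proof. by apply: sumr_ge0 => i _; apply: sumr_ge0 => j _; exact: nm_ge0. Qed.
Let c0 : 0 < c.
Proof. by rewrite invr_gt0 ltr_pwDl. Qed.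

Let x (u : N) : N := u - c%:C *: T u.

Let xD u v : x (u + v) = x u + x v.
Proof. by rewrite /x TD scalerDr opprD addrACA. Qed.
Let xZ k u : x (k *: u) = k *: x u.
Proof. by rewrite /x TZ scalerBr !scalerA [c%:C * _]mulrC. Qed.
Let x_adj u v : @pform _ tuple_psd (x u) v = @pform _ tuple_psd u (x v).
Proof.
rewrite /x pformBl pformBr pformZl pformZr conjCR; congr (_ - _ * _).
exact: T_adj.
Qed.

Let T_le u : cabs (tform u (T u)) <= (\sum_i \sum_j nm (G i j)) * @psq _
  tuple_psd u.
Proof.
have cabs_sum (I : finType) (F : I -> R[i]) :
  cabs (\sum_i F i) <= \sum_i cabs (F i).
  apply: (big_ind2 (fun x y => cabs x <= y)) => // [|z1 y1 z2 y2 h1 h2].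
    by rewrite cabs0.
  by rewrite (le_trans (cabsD _ _)) // lerD.
have psqE' : @psq _ tuple_psd u = \sum_i nm (u i) ^+ 2.
  rewrite /psq /= /tform raddf_sum; apply: eq_bigr => i _ /=.
  by rewrite nm_hilb pnorm2.
have u2 i : nm (u i) ^+ 2 <= @psq _ tuple_psd u.
  rewrite psqE' (bigD1 i) //= lerDl; apply: sumr_ge0 => j _.
  by rewrite exprn_ge0 // nm_ge0.
have uu i j : nm (u i) * nm (u j) <= @psq _ tuple_psd u.
  have := u2 i; have := u2 j; have := sqr_ge0 (nm (u i) - nm (u j));
    rewrite sqrrB; lra.
rewrite (le_trans (cabs_sum _ _)) // mulr_suml ler_sum // => i _.
rewrite hip_sumr (le_trans (cabs_sum _ _)) // mulr_suml ler_sum // => j _.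
rewrite (le_trans (hilb_cs _ _)) //.
have := rep_nm actP (G i j) (u j) => h1.
rewrite (le_trans (ler_wpM2l (nm_ge0 _) h1)) // mulrCA ler_wpM2l ?nm_ge0 //.
Qed.

Let x_ge0 u : 0 <= @pform _ tuple_psd u (x u).
Proof.
have TE : (complex.Re (tform u (T u)))%:C = tform u (T u).
  by rewrite RRe_real // CrealE -tform_conj T_adj.
rewrite /x pformBr pformZr -[X in _ - _ * X]TE psqE -rmorphM -rmorphB ler0c
  subr_ge0.
rewrite mulrC ler_pdivrMr ?ltr_pwDl // mulrDr mulr1 mulrC.
have := T_le u; rewrite -TE cabs_real => h1.
have := ler_norm (complex.Re (tform u (T u))); have := @psq_ge0 _ tuple_psd u;
  lra.
Qed.

Let piD d1 d2 (h : H) : pi (d1 + d2) h = pi d1 h + pi d2 h.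
Proof. by rewrite raddfD. Qed.
Let piZ k d (h : H) : pi (k *: d) h = k *: pi d h.
Proof. by rewrite linearZ. Qed.
Let piM d1 d2 (h : H) : pi (d1 ** d2) h = pi d1 (pi d2 h).
Proof. by rewrite starhomM. Qed.
Let piB d1 d2 (h : H) : pi (d1 - d2) h = pi d1 h - pi d2 h.
Proof. by rewrite raddfB. Qed.
Let pi_sum (F : 'I_n -> D) (h : H) : pi (\sum_i F i) h = \sum_i pi (F i) h.
Proof.
apply: (big_ind2 (fun d g => pi d h = g)) => // [|d1 g1 d2 g2 <- <-];
  last exact: piD.
by rewrite raddf0.
Qed.

(* The form of [T] at (l_j m + d_j m)_j is the value at m of E (z^* z), where
   z = sum_j a_j (l_j + d_j). *)
Let column (m : H) (w : N) := exists (l : 'I_n -> R[i]) (d : 'I_n -> D),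
  forall j, w j = l j *: m + pi (d j) m.

Let column_x m w : column m w -> column m (x w).
Proof.
move=> [l [d w_ld]].
exists l; exists (fun j => d j - c%:C *: \sum_i (l i *: G j i + G j i ** d i))
  => j.
rewrite piB piZ pi_sum /x.
rewrite -[LHS]/(w j - c%:C *: T w j) {1}w_ld -addrA; congr (_ + (_ - _ *: _)).
by apply: eq_bigr => i _; rewrite w_ld aopD aopZ piD piZ piM.
Qed.

Let column_ge0 m w : column m w -> 0 <= tform w (T w).
Proof.
move=> [l [d w_ld]].
pose z i := l i *: a i + a i ** phi (d i).
have [e eE] := condexp_sq EP (\sum_i z i).
have : 0 <= hip m (pi (E (cstar (\sum_i z i) ** \sum_i z i)) m).
  by rewrite eE piM -pi_adj; exact: hip_ge0.
congr (_ <= _).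
have zz i j : hip m (pi (E (cstar (z i) ** z j)) m) =
  hip (w i) (pi (G i j) (w j)).
  rewrite !w_ld aopD aopZ !hipDr !hipDl !hipZr !hipZl !pi_adj -!piM.
  rewrite /z cstarD cstarZ cstarM -starhom_star cmulDl !cmulDr -!cscaleAl
    -!cscaleAr.
  rewrite !(condexpD EP) !(condexpZ EP) !cmulA !(condexp_modr EP).
  rewrite -[phi _ ** _ ** a j]cmulA !(condexp_modl EP) !piD !piZ !hipDr !hipZr.
  by rewrite mulrCA -!addrA; congr (_ + _); rewrite addrCA.
have -> : cstar (\sum_i z i) ** \sum_i z i = \sum_i \sum_j cstar (z i) ** z j.
  rewrite (big_morph _ (@cstarD R X) (cstar0 X)).
  rewrite (big_morph (fun y => y ** _) (fun y1 y2 => cmulDl y1 y2 _)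
    (cmul0r _)).
  apply: eq_bigr => i _.
  exact: (big_morph (fun y => _ ** y) (fun y1 y2 => cmulDr _ y1 y2) (cmulr0 _)).
have Esum (F : 'I_n -> X) : E (\sum_i F i) = \sum_i E (F i).
  apply: (big_ind2 (fun y d => E y = d)) => // [|y1 d1 y2 d2 <- <-];
    last exact: (condexpD EP).
  exact: (condexp0 EP).
rewrite Esum pi_sum hip_sumr; apply: eq_bigr => i _.
rewrite Esum pi_sum !hip_sumr; apply: eq_bigr => j _.
exact: zz.
Qed.

(** The tuple (m_j) is a sum of tuples with a single nonzero entry m_l. Each of these is a [column]
    over m_l, where the scalars in [column] stand in for a unit of D. Columns over m_l are stable
    under [x] and positive for [T], so [form_concentrate] extends positivity to the sum. *)
Lemma weakrep_cp (m : 'I_n -> V) :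
  0 <= \sum_i \sum_j pform (m i) (act (G i j) (m j)).
Proof.
pose us (l : 'I_n) : N := fun j => if j == l then embed (m l) else 0.
pose u : N := \sum_l us l.
have uE j : u j = embed (m j).
  rewrite /u fct_sumE (bigD1 j) //= /us eqxx big1 ?addr0 // => l lj.
  by rewrite eq_sym (negPf lj).
have xE w : w - x w = c%:C *: T w by rewrite /x subKr.
have : 0 <= @pform _ tuple_psd u (u - x u).
  apply: (@form_concentrate R tuple_psd x xD xZ x_adj x_ge0 n us) => l k.
  have : column (embed (m l)) (iter k x (us l)).
    elim: k => [|k ih]; last exact: column_x.
    exists (fun j => if j == l then 1 else 0), (fun=> 0) => j.
    rewrite raddf0 addr0 /= /us; case: eqP => _; by rewrite ?scale1r ?scale0r.
  move=> /column_ge0; set w := iter _ _ _ => w0.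
  by rewrite xE pformZr mulr_ge0 // ler0c ltW.
rewrite xE pformZr.
rewrite pmulr_rge0 ?ltcR //; congr (_ <= _); apply: eq_bigr => i _.
rewrite hip_sumr; apply: eq_bigr => j _.
by rewrite !uE starrep_embed hip_embedl.
Qed.

End CompletelyPositive.

(** * The Fock space *)

Section Free.
Context (R : realType) (S : choiceType).
Local Notation free := {freeg S / R[i]}.

Definition fe (s : S) : free := << s >>.

Lemma free_ind (P : free -> Prop) : P 0 ->
  (forall u v, P u -> P v -> P (u + v)) ->
  (forall k u, P u -> P (k *: u)) -> (forall s, P (fe s)) -> forall v, P v.
Proof.
move=> P0 PD PZ Ps v; rewrite -(freeg_sumE v); elim/big_ind: _ => // s _.
have -> : << coeff s v *g s >> = coeff s v *: fe s.
  by apply/eqP/freeg_eqP => t; rewrite coeff_fgscale !coeffU mul1r.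
exact: PZ.
Qed.

Context (M : lmodType R[i]) (f : S -> M).

Definition flift (v : free) : M := fglift f v.

Lemma flift_fe s : flift (fe s) = f s.
Proof. by rewrite /flift liftU scale1r. Qed.

Lemma flift0 : flift 0 = 0.
Proof. by have := lift_is_additive f 0 0; rewrite !subrr. Qed.

Lemma fliftB u v : flift (u - v) = flift u - flift v.
Proof. exact: lift_is_additive. Qed.

Lemma fliftN v : flift (- v) = - flift v.
Proof. by rewrite -sub0r fliftB flift0 sub0r. Qed.

Lemma fliftD u v : flift (u + v) = flift u + flift v.
Proof. by rewrite -{1}(opprK v) fliftB fliftN opprK. Qed.

Lemma fliftZ k v : flift (k *: v) = k *: flift v.
Proof.
have sumE (I : eqType) (r : seq I) (F : I -> free) :
    flift (\sum_(i <- r) F i) = \sum_(i <- r) flift (F i).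
  exact: (big_morph _ fliftD flift0).
have [r [c ->]] : exists (r : seq S) (c : S -> R[i]), v =
  \sum_(z <- r) << c z *g z >>.
  by exists (dom v), (fun z => coeff z v); rewrite freeg_sumE.
rewrite scaler_sumr !sumE scaler_sumr; apply: eq_bigr => s _.
transitivity (flift << k * c s *g s >>); last by rewrite /flift !liftU scalerA.
by congr flift; apply/eqP/freeg_eqP => t; rewrite coeff_fgscale !coeffU mulrA.
Qed.

End Free.

Lemma free_span (R : realType) (S : choiceType) (v : {freeg S / R[i]}) :
  exists n (c : 'I_n -> R[i]) (s : 'I_n -> S), v = \sum_i c i *: fe R (s i).
Proof.
elim/free_ind: v => [|u v [n [c [s ->]]] [m [d [t ->]]]|k u [n [c [s ->]]]|s].
- by exists 0%N, (fun=> 0), (fun i : 'I_0 => match i with Ordinal _ h =>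
    match notF h with end end);
    rewrite big_ord0.
- exists (n + m)%N, (fun i : 'I_(n + m) => match fintype.split i with inl j =>
    c j | inr j => d j end),
    (fun i : 'I_(n + m) => match fintype.split i with inl j => s j | inr j =>
      t j end).
  rewrite big_split_ord /=; congr (_ + _); apply: eq_bigr => i _.
    by rewrite (unsplitK (inl i)).
  by rewrite (unsplitK (inr i)).
- exists n, (fun i => k * c i), s; rewrite scaler_sumr.
  by apply: eq_bigr => i _; rewrite scalerA.
- by exists 1%N, (fun=> 1), (fun=> s); rewrite big_ord1 scale1r.
Qed.

Section KernelForm.
Context (R : realType) (S : choiceType) (k : S -> S -> R[i]).
Hypothesis k_conj : forall s t, k t s = Num.conj (k s t).
Local Notation free := {freeg S / R[i]}.
Local Notation fe := (fe R).
Implicit Types u v w : free.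

(** As [flift] is linear, conjugating before and after it makes the form conjugate linear in u. *)
Let half (u : free) (t : S) : R[i]^o :=
  Num.conj (flift (fun s => Num.conj (k s t) : R[i]^o) u).

Definition fform u v : R[i] := flift (half u) v.

Lemma fformDr u v w : fform u (v + w) = fform u v + fform u w.
Proof. exact: fliftD. Qed.
Lemma fformZr a u v : fform u (a *: v) = a * fform u v.
Proof. exact: fliftZ. Qed.
Lemma fform0r u : fform u 0 = 0.
Proof. exact: flift0. Qed.
Lemma fform_fe s t : fform (fe s) (fe t) = k s t.
Proof. by rewrite /fform flift_fe /half flift_fe conjCK. Qed.

Lemma fformDl u v w : fform (u + v) w = fform u w + fform v w.
Proof.
elim/free_ind: w => [|w w' h h'|a w h|t].
- by rewrite !fform0r addr0.
- by rewrite !fformDr h h' addrACA.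
- by rewrite !fformZr h mulrDr.
- by rewrite /fform !flift_fe /half fliftD rmorphD.
Qed.
Lemma fformZl a u w : fform (a *: u) w = Num.conj a * fform u w.
Proof.
elim/free_ind: w => [|w w' h h'|b w h|t].
- by rewrite !fform0r mulr0.
- by rewrite !fformDr h h' mulrDr.
- by rewrite !fformZr h mulrCA.
- by rewrite /fform !flift_fe /half fliftZ rmorphM.
Qed.
Lemma fform0l w : fform 0 w = 0.
Proof. by have := fformZl 0 0 w; rewrite scaler0 conjC0 mul0r. Qed.

Lemma fform_conj u v : fform v u = Num.conj (fform u v).
Proof.
elim/free_ind: u => [|u u' h h'|a u h|s].
- by rewrite fform0r fform0l conjC0.
- by rewrite fformDr fformDl rmorphD h h'.
- by rewrite fformZr fformZl rmorphM /= conjCK h.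
elim/free_ind: v => [|v v' h h'|a v h|t].
- by rewrite fform0r fform0l conjC0.
- by rewrite fformDr fformDl rmorphD h h'.
- by rewrite fformZr fformZl rmorphM h.
- by rewrite !fform_fe.
Qed.

Lemma fform_sum n (c : 'I_n -> R[i]) (s : 'I_n -> S) :
  let v := \sum_i c i *: fe (s i) in
  fform v v = \sum_i \sum_j Num.conj (c i) * c j * k (s i) (s j).
Proof.
rewrite /= (big_morph (fun u => fform u _) (fun u v => fformDl u v _)
  (fform0l _)).
apply: eq_bigr => i _.
rewrite (big_morph _ (fformDr _) (fform0r _)); apply: eq_bigr => j _.
by rewrite fformZl fformZr fform_fe mulrA.
Qed.

Hypothesis k_ge0 : forall v, 0 <= fform v v.

Definition kernel_psd : psdspace R :=
  @PsdSpace R free fform fformDr fformZr fform_conj k_ge0.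

Lemma kernel_weakrep (X : cstarAlgType R) (act : X -> S -> free)
    (Act := fun a => flift (act a) : free -> free) :
  (forall a s t, fform (act a s) (fe t) = fform (fe s) (act (cstar a) t)) ->
  (forall a b s t, fform (fe s) (act (a + b) t) =
     fform (fe s) (act a t) + fform (fe s) (act b t)) ->
  (forall c a s t, fform (fe s) (act (c *: a) t) = c * fform (fe s) (act a t))
    ->
  (forall a b s t, fform (fe s) (act (a ** b) t) =
    fform (fe s) (Act a (act b t))) ->
  @weakrep R X kernel_psd Act.
Proof.
have test u u' : (forall s, fform (fe s) u = fform (fe s) u') ->
    forall w, fform w u = fform w u'.
  move=> uu' w; elim/free_ind: w => [|w w' h h'|a w h|s] //;
    first by rewrite !fform0l.
    by rewrite !fformDl h h'.
  by rewrite !fformZl h.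
move=> adj add scl mul; split=> /=.
- move=> a u v; elim/free_ind: v => [|v v' h h'|c v h|t].
  + by rewrite /Act flift0 !fform0r.
  + by rewrite /Act fliftD !fformDr h h'.
  + by rewrite /Act fliftZ !fformZr h.
  elim/free_ind: u => [|u u' h h'|c u h|s].
  + by rewrite /Act flift0 !fform0l.
  + by rewrite /Act fliftD !fformDl h h'.
  + by rewrite /Act fliftZ !fformZl h.
  + by rewrite /Act !flift_fe.
- move=> a b u v; elim/free_ind: v => [|v v' h h'|c v h|t].
  + by rewrite /Act !flift0 !fform0r addr0.
  + by rewrite /Act !fliftD !fformDr h h' addrACA.
  + by rewrite /Act !fliftZ !fformZr h mulrDr.
  + rewrite /Act !flift_fe -fformDr; apply: test => s.
    by rewrite fformDr.
- move=> c a u v; elim/free_ind: v => [|v v' h h'|d v h|t].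
  + by rewrite /Act !flift0 !fform0r mulr0.
  + by rewrite /Act !fliftD !fformDr h h' mulrDr.
  + by rewrite /Act !fliftZ !fformZr h mulrCA.
  + rewrite /Act !flift_fe -fformZr; apply: test => s.
    by rewrite fformZr.
- move=> a b u v; elim/free_ind: v => [|v v' h h'|d v h|t].
  + by rewrite /Act !flift0 !fform0r.
  + by rewrite /Act !fliftD !fformDr h h'.
  + by rewrite /Act !fliftZ !fformZr h.
  + by rewrite /Act !flift_fe; apply: test => s.
Qed.

End KernelForm.

(* The way an algebra [X] sees a basis vector: as a vector on which it acts
   freely, as such a vector preceded by a letter from [X], or as a vector of
   some given representation. *)
Variant view (X S : Type) := Plain | Letter of X & S | Other of (X -> S).
Arguments Plain {X S}.

(** * From a representation of D on M to one of X on X (x)_D M *)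

Section Extension.
Context (R : realType) (X D : cstarAlgType R) (phi : {starhom D -> X})
  (E : X -> D).
Hypothesis EP : conditional_expectation phi E.

Definition cen (x : X) : X := x - phi (E x).

Lemma condexp_cen x : E (cen x) = 0.
Proof. by rewrite /cen (condexpB EP) (condexp_id EP) subrr. Qed.
Lemma cen_phi d : cen (phi d) = 0.
Proof. by rewrite /cen (condexp_id EP) subrr. Qed.
Lemma cenD x y : cen (x + y) = cen x + cen y.
Proof. by rewrite /cen (condexpD EP) raddfD opprD addrACA. Qed.
Lemma cenZ c x : cen (c *: x) = c *: cen x.
Proof. by rewrite /cen (condexpZ EP) linearZ scalerBr. Qed.
Lemma cen_phiM d x : cen (phi d ** x) = phi d ** cen x.
Proof. by rewrite /cen (condexp_modl EP) starhomM cmulBr. Qed.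
Lemma cen_cen x : cen (cen x) = cen x.
Proof. by rewrite {1}/cen condexp_cen raddf0 subr0. Qed.
Lemma condexp_phi_cen d x : E (phi d ** cen x) = 0.
Proof. by rewrite (condexp_modl EP) condexp_cen cmulr0. Qed.
Lemma condexp_cen_phi d x : E (cstar (cen x) ** phi d) = 0.
Proof. by rewrite (condexp_modr EP) (condexp_star EP) condexp_cen cstar0 cmul0r.
  Qed.
Lemma condexp_cenr x y : E (cstar (cen x) ** cen y) = E (cstar (cen x) ** y).
Proof. by rewrite {2}/cen cmulBr (condexpB EP) condexp_cen_phi subr0. Qed.
Lemma condexp_cenl x y : E (cstar (cen x) ** cen y) = E (cstar x ** cen y).
Proof.
by rewrite {1}/cen cstarB cmulBl (condexpB EP) -starhom_star condexp_phi_cen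
  subr0.
Qed.

Context (S : choiceType) (k : S -> S -> R[i]) (dact : D -> S -> S).
Hypothesis k_conj : forall s t, k t s = Num.conj (k s t).
Hypothesis k_ge0 : forall v, 0 <= fform k v v.
Hypothesis kD : forall d d' s t, k s (dact (d + d') t) =
  k s (dact d t) + k s (dact d' t).
Hypothesis kZ : forall c d s t, k s (dact (c *: d) t) = c * k s (dact d t).
Hypothesis dactM : forall d d' s, dact (d ** d') s = dact d (dact d' s).
Hypothesis k_dact : forall d s t, k (dact d s) t = k s (dact (cstar d) t).

Context (vw : S -> view X S) (cons : X -> S -> S).
Hypothesis vw_cons : forall x s, vw s = Plain -> vw (cons x s) = Letter x s.
Hypothesis vw_letter : forall s x t, vw s = Letter x t ->
  vw t = Plain /\ forall u, k u s = k u (cons x t).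
Hypothesis vw_dact : forall d s, vw s = Plain -> vw (dact d s) = Plain.
Hypothesis vw_other : forall s g a, vw s = Other g -> vw (g a) =
  Other (fun b => g (b ** a)).
Hypothesis k_cons : forall x y s t, vw s = Plain -> vw t = Plain ->
  k (cons x s) (cons y t) = k s (dact (E (cstar (cen x) ** cen y)) t).
Hypothesis k_plain_cons : forall x s t, vw s = Plain -> vw t = Plain ->
  k s (cons x t) = 0.
Hypothesis k_other : forall s g t, vw s = Other g -> vw t = Plain ->
  k s t = 0 /\ forall x, k s (cons x t) = 0.
Hypothesis k_other_adj : forall a s t g h, vw s = Other g -> vw t = Other h ->
  k (g a) t = k s (h (cstar a)).
Hypothesis k_otherD : forall a b s t g, vw t = Other g ->
  k s (g (a + b)) = k s (g a) + k s (g b).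
Hypothesis k_otherZ : forall c a s t g, vw t = Other g -> k s (g (c *: a)) =
  c * k s (g a).
Hypothesis k_dcons : forall d x s t, vw t = Plain ->
  k s (dact d (cons x t)) = k s (cons (phi d ** x) t).
Hypothesis k_other_phi : forall d s t g, vw t = Other g -> k s (g (phi d)) =
  k s (dact d t).

Local Notation free := {freeg S / R[i]}.
Local Notation fe := (fe R).
Local Notation ff := (fform k).

(** The elementary tensor a (x) t along X (x)_D M = M + X'M, with X' the kernel of E. The letter in
    [cons] stays uncentred, since by [k_cons] the kernel [k] centres it. *)
Definition block (a : X) (t : S) : free := fe (dact (E a) t) + fe (cons a t).

Definition ext_act (a : X) (s : S) : free :=
  match vw s with
  | Plain => block a s
  | Letter x t => block (a ** cen x) t
  | Other g => fe (g a)
  end.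

Let k0 s t : k s (dact 0 t) = 0.
Proof. by have := kZ 0 0 s t; rewrite scaler0 mul0r. Qed.

Let k_cons_plain x s t : vw s = Plain -> vw t = Plain -> k (cons x s) t = 0.
Proof. by move=> hs ht; rewrite k_conj k_plain_cons // conjC0. Qed.

Let k_letterl s x t u : vw s = Letter x t -> k s u = k (cons x t) u.
Proof. by move=> /vw_letter[_ h]; rewrite k_conj h -k_conj. Qed.

Let k_block_plain a s t : vw s = Plain -> vw t = Plain ->
  ff (fe s) (block a t) = k s (dact (E a) t).
Proof. by move=> hs ht; rewrite fformDr !fform_fe // k_plain_cons // addr0. Qed.

Let k_block_letter a s x r t : vw s = Letter x r -> vw t = Plain ->
  ff (fe s) (block a t) = k r (dact (E (cstar (cen x) ** cen a)) t).
Proof.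
move=> hs ht; have [hr _] := vw_letter hs.
rewrite fformDr !fform_fe // !(k_letterl _ hs) k_cons //.
by rewrite k_cons_plain ?add0r // vw_dact.
Qed.

Let k_block_other a s g t : vw s = Other g -> vw t = Plain ->
  ff (fe s) (block a t) = 0.
Proof.
move=> hs ht; have [h1 h2] := k_other hs (vw_dact (E a) ht).
by rewrite fformDr !fform_fe // h1 add0r; have [_ ->] := k_other hs ht.
Qed.

(** Splitting c = phi(E c) + cen c, the action of a produces the blocks of a phi(E c) and of a cen
    c; their inner products with any s add up to those of a c by the bimodule law. *)
Let block_act a c t : vw t = Plain -> forall s,
  ff (fe s) (flift (ext_act a) (block c t)) = ff (fe s) (block (a ** c) t).
Proof.
move=> ht s; rewrite fliftD !flift_fe /ext_act vw_dact // vw_cons //.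
case hs : (vw s) => [|x r|g].
- rewrite fformDr !k_block_plain ?vw_dact // -dactM -kD; congr (k _ (dact _ _)).
  by rewrite /cen cmulBr (condexpB EP) (condexp_modr EP) addrC subrK.
- have [hr _] := vw_letter hs.
  rewrite fformDr !(k_block_letter _ hs) ?vw_dact // -dactM -kD;
    congr (k _ (dact _ _)).
  have acE : a ** cen c = a ** c - a ** phi (E c) by rewrite cmulBr.
  rewrite !condexp_cenr acE [_ ** (_ - _)]cmulBr (condexpB EP)
    [_ ** (a ** phi _)]cmulA.
  by rewrite (condexp_modr EP) addrC subrK.
- by rewrite fformDr !(k_block_other _ hs) ?vw_dact // addr0.
Qed.

Let ffD s a b t : vw t = Plain ->
  ff (fe s) (block (a + b) t) = ff (fe s) (block a t) + ff (fe s) (block b t).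
Proof.
move=> ht; case hs : (vw s) => [|x r|g].
- by rewrite !k_block_plain // (condexpD EP) kD.
- by rewrite !(k_block_letter _ hs) // cenD cmulDr (condexpD EP) kD.
- by rewrite !(k_block_other _ hs) // addr0.
Qed.

Let ffZ s c a t : vw t = Plain ->
  ff (fe s) (block (c *: a) t) = c * ff (fe s) (block a t).
Proof.
move=> ht; case hs : (vw s) => [|x r|g].
- by rewrite !k_block_plain // (condexpZ EP) kZ.
- by rewrite !(k_block_letter _ hs) // cenZ -cscaleAr (condexpZ EP) kZ.
- by rewrite !(k_block_other _ hs) // mulr0.
Qed.

(** Plain vectors and letters together make up X (x)_D M. The vectors of type [Other] are orthogonal
    to these and remain of that type under the action, so all mixed terms with them vanish. *)
Lemma ext_weakrep : @weakrep R X (kernel_psd k_conj k_ge0)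
  (fun a => flift (ext_act a)).
Proof.
have other_plain s g t a : vw s = Other g -> vw t = Plain -> k (g a) t = 0.
  by move=> /(vw_other a) hga ht; have [-> _] := k_other hga ht.
have other_letter s g t a y q : vw s = Other g -> vw t = Letter y q ->
  k (g a) t = 0.
  move=> /(vw_other a) hga /vw_letter[hq ->].
  by have [_ ->] := k_other hga hq.
have block_l s a t : ff (block a t) (fe s) = Num.conj (ff (fe s) (block a t)).
  exact: fform_conj.
apply: kernel_weakrep => // [a s t|a b s t|c a s t|a b s t].
- rewrite /ext_act; case hs : (vw s) => [|x r|g]; case ht : (vw t) => [|y q|h].
  + rewrite block_l !k_block_plain // -k_conj k_dact.
    by rewrite (condexp_star EP).
  + have [hq _] := vw_letter ht.
    rewrite block_l (k_block_letter _ ht) // k_block_plain // -k_conj k_dact.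
    rewrite -(condexp_star EP) cstarM cstarK condexp_cenl.
    by [].
  + rewrite block_l (k_block_other _ ht) // conjC0 fform_fe //.
    by rewrite k_conj (other_plain _ _ _ _ ht) // conjC0.
  + have [hr _] := vw_letter hs.
    rewrite block_l k_block_plain // (k_block_letter _ hs) // -k_conj k_dact.
    by rewrite condexp_cenr -(condexp_star EP) cstarM.
  + have [hr _] := vw_letter hs; have [hq _] := vw_letter ht.
    rewrite block_l !(k_block_letter _ hs, k_block_letter _ ht) // -k_conj
      k_dact.
    rewrite -(condexp_star EP) cstarM cstarK condexp_cenl condexp_cenr cstarM.
    by rewrite -cmulA.
  + have [hr _] := vw_letter hs.
    rewrite block_l (k_block_other _ ht) // conjC0 fform_fe //.
    by rewrite k_conj (other_letter _ _ _ _ _ _ ht hs) // conjC0.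
  + by rewrite fform_fe // (k_block_other _ hs) // (other_plain _ _ _ _ hs).
  + have [hq _] := vw_letter ht.
    by rewrite fform_fe // (k_block_other _ hs) //
      (other_letter _ _ _ _ _ _ hs ht).
  + by rewrite !fform_fe // (k_other_adj _ hs ht).
- rewrite /ext_act; case ht : (vw t) => [|y q|h].
  + exact: ffD.
  + by have [hq _] := vw_letter ht; rewrite cmulDl ffD.
  + by rewrite !fform_fe // (k_otherD _ _ _ ht).
- rewrite /ext_act; case ht : (vw t) => [|y q|h].
  + exact: ffZ.
  + by have [hq _] := vw_letter ht; rewrite -cscaleAl ffZ.
  + by rewrite !fform_fe // (k_otherZ _ _ _ ht).
- case ht : (vw t) => [|y q|h]; rewrite {1 3}/ext_act ht.
  + by rewrite block_act.
  + by have [hq _] := vw_letter ht; rewrite block_act // cmulA.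
  + by rewrite flift_fe /ext_act (vw_other _ ht).
Qed.

(** The right side mentions neither X nor its view of the words, so this is what makes the actions
    of A and B agree over D. *)
Lemma ext_act_phi d s t : ff (fe s) (ext_act (phi d) t) = k s (dact d t).
Proof.
rewrite /ext_act; case ht : (vw t) => [|y q|h].
- case hs : (vw s) => [|x r|g].
  + by rewrite k_block_plain // (condexp_id EP).
  + rewrite (k_block_letter _ hs) // cen_phi cmulr0 (condexp0 EP) k0.
    rewrite (k_letterl _ hs) k_conj.
    have [hr _] := vw_letter hs.
    by rewrite k_plain_cons ?vw_dact // conjC0.
  + by rewrite (k_block_other _ hs) //; have [-> _] :=
    k_other hs (vw_dact d ht).
- have [hq hk] := vw_letter ht.
  have -> : k s (dact d t) = k s (cons (phi d ** y) q).
    by rewrite -k_dcons // -[d]cstarK -!k_dact hk.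
  case hs : (vw s) => [|x r|g].
  + by rewrite k_block_plain // condexp_phi_cen k0 k_plain_cons.
  + have [hr _] := vw_letter hs.
    rewrite (k_block_letter _ hs) // (k_letterl _ hs) k_cons //.
    by rewrite !cen_phiM cen_cen.
  + by rewrite (k_block_other _ hs) //; have [_ ->] := k_other hs hq.
- by rewrite fform_fe // (k_other_phi _ _ ht).
Qed.

End Extension.

(** * Words, their inner product, and the actions of A and B *)

Section Fock.
Context (R : realType) (A B D : cstarAlgType R).
Context (phiA : {starhom D -> A}) (phiB : {starhom D -> B}) (EA : A -> D)
  (EB : B -> D).
Hypothesis EAP : conditional_expectation phiA EA.
Hypothesis EBP : conditional_expectation phiB EB.
Context (psi : B -> R[i]).
Hypothesis psiP : positive_functional psi.

(* A word l_n ... l_1 x with x in B stands for an elementary tensor whose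
   letters alternately lie in the kernels of EA and EB, l_1 coming from A.  Only
   the component of a letter selected by its position matters, and arbitrary
   elements are tacitly centred. *)
Local Notation word := (seq (A * B) * B)%type.

Definition letter_ip (i : bool) (l l' : A * B) : D :=
  if i then EB (cstar (cen phiB EB l.2) ** cen phiB EB l'.2)
  else EA (cstar (cen phiA EA l.1) ** cen phiA EA l'.1).

(** Both components of the leftmost letter are multiplied alike, so that no distinction by position
    is made. *)
Definition dact (d : D) (s : word) : word :=
  match s.1 with
  | [::] => ([::], phiB d ** s.2)
  | l :: w => ((phiA d ** l.1, phiB d ** l.2) :: w, s.2)
  end.

(** The inner product of an interior tensor product: <l w, l' w'> = <w, E(l^* l') w'>. A letter
    standing before an even number of others is from A, otherwise from B, whence the parity of
    [size w]. *)
Fixpoint word_ip (w : seq (A * B)) (x : B) (t : word) : R[i] :=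
  match w, t.1 with
  | [::], [::] => psi (cstar x ** t.2)
  | l :: w, l' :: w' => word_ip w x
    (dact (letter_ip (odd (size w)) l l') (w', t.2))
  | _, _ => 0
  end.

Definition wk (s t : word) := word_ip s.1 s.2 t.

Implicit Types (s t : word) (d : D).

Lemma wk_nil x y : wk ([::], x) ([::], y) = psi (cstar x ** y).
Proof. by []. Qed.

Lemma wk_cons l w x l' w' y : wk (l :: w, x) (l' :: w', y) =
  wk (w, x) (dact (letter_ip (odd (size w)) l l') (w', y)).
Proof. by []. Qed.

Lemma size_dact d s : size (dact d s).1 = size s.1.
Proof. by case: s => [[|l w] x]. Qed.

Lemma wk_size s t : size s.1 != size t.1 -> wk s t = 0.
Proof.
case: s => w x; elim: w t => [|l w ih] [[|l' w'] y] //= st.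
by rewrite wk_cons ih // size_dact.
Qed.

Lemma dactM d d' s : dact (d ** d') s = dact d (dact d' s).
Proof. by case: s => [[|l w] x] /=; rewrite /dact /= !starhomM ?cmulA. Qed.

Let letter_ipDr i l l1 l2 : letter_ip i l (l1.1 + l2.1, l1.2 + l2.2) =
  letter_ip i l l1 + letter_ip i l l2.
Proof.
case: i; rewrite /letter_ip /=.
  by rewrite (cenD EBP) cmulDr (condexpD EBP).
by rewrite (cenD EAP) cmulDr (condexpD EAP).
Qed.

Let letter_ipZr i l c l1 : letter_ip i l (c *: l1.1, c *: l1.2) = c *:
  letter_ip i l l1.
Proof.
case: i; rewrite /letter_ip /=.
  by rewrite (cenZ EBP) -cscaleAr (condexpZ EBP).
by rewrite (cenZ EAP) -cscaleAr (condexpZ EAP).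
Qed.

Let letter_ip_star i l l' : cstar (letter_ip i l l') = letter_ip i l' l.
Proof.
case: i; rewrite /letter_ip.
  by rewrite -(condexp_star EBP) cstarM cstarK.
by rewrite -(condexp_star EAP) cstarM cstarK.
Qed.

Let letter_ip_dact i d l l' :
  letter_ip i (phiA d ** l.1, phiB d ** l.2) l' =
  letter_ip i l (phiA (cstar d) ** l'.1, phiB (cstar d) ** l'.2).
Proof.
case: i; rewrite /letter_ip /=.
  by rewrite !(cen_phiM EBP) cstarM -starhom_star cmulA.
by rewrite !(cen_phiM EAP) cstarM -starhom_star cmulA.
Qed.

Lemma wkD d d' s t : wk s (dact (d + d') t) =
  wk s (dact d t) + wk s (dact d' t).
Proof.
case: s => w x; elim: w d d' t => [|l w ih] d d' [[|l' w'] y] /=.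
- by rewrite /dact /= !wk_nil raddfD cmulDl cmulDr (pfD psiP).
- by rewrite /wk /= addr0.
- by rewrite /wk /= addr0.
- rewrite /dact /= !wk_cons -ih; congr (wk _ (dact _ _)).
  by rewrite -letter_ipDr /= !raddfD /= !cmulDl.
Qed.

Lemma wkZ c d s t : wk s (dact (c *: d) t) = c * wk s (dact d t).
Proof.
case: s => w x; elim: w d t => [|l w ih] d [[|l' w'] y] /=.
- by rewrite /dact /= !wk_nil linearZ_LR -cscaleAl -cscaleAr (pfZ psiP).
- by rewrite /wk /= mulr0.
- by rewrite /wk /= mulr0.
- rewrite /dact /= !wk_cons -ih; congr (wk _ (dact _ _)).
  by rewrite -letter_ipZr /= !linearZ_LR /= -!cscaleAl.
Qed.

Lemma wk_dact d s t : wk (dact d s) t = wk s (dact (cstar d) t).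
Proof.
case: s t => [[|l w] x] [[|l' w'] y] //.
  by rewrite /dact /= !wk_nil cstarM starhom_star cmulA.
by rewrite /dact /= !wk_cons letter_ip_dact.
Qed.

Lemma wk_conj s t : wk t s = Num.conj (wk s t).
Proof.
have [st|st] := eqVneq (size s.1) (size t.1); last first.
  by rewrite (wk_size st) wk_size 1?eq_sym // conjC0.
case: s t st => w x [w' y] /= st.
elim: w w' x y st => [|l w ih] [|l' w'] x y //= st.
  by rewrite !wk_nil -(pf_star psiP) cstarM cstarK.
rewrite !wk_cons; case: st => st.
set e := letter_ip _ l l'.
have -> : letter_ip (odd (size w')) l' l = cstar e by rewrite letter_ip_star st.
rewrite -wk_dact; case E : (dact e (w', y)) => [w2 y2].
by apply: ih; have := size_dact e (w', y); rewrite E /= => ->.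
Qed.

(** Words of different lengths are orthogonal. Isolating one length allows positivity to be proved
    by induction on it. *)
Definition lk n s t : R[i] := if size s.1 == n then wk s t else 0.

Lemma lk_conj n s t : lk n t s = Num.conj (lk n s t).
Proof.
rewrite /lk; have [st|st] := eqVneq (size s.1) (size t.1).
  by rewrite st; case: eqP => _; [exact: wk_conj|rewrite conjC0].
by rewrite (wk_size st) wk_size 1?eq_sym // !if_same conjC0.
Qed.

Let dvec d s : {freeg word / R[i]} := fe R (dact d s).

Lemma lk_weakrep n (pos : forall v, 0 <= fform (lk n) v v) :
  @weakrep R D (kernel_psd (@lk_conj n) pos) (fun d => flift (dvec d)).
Proof.
apply: kernel_weakrep => [d s t|d d' s t|c d s t|d d' s t].
- by rewrite !fform_fe /lk size_dact wk_dact.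
- by rewrite !fform_fe /lk wkD; case: eqP => //; rewrite addr0.
- by rewrite !fform_fe /lk wkZ; case: eqP => //; rewrite mulr0.
- by rewrite flift_fe /dvec dactM.
Qed.

(** For length 0 this is positivity of [psi]. For n + 1, take off the first letters l_i: the form
    becomes the sum of the <m_i, E(l_i^* l_j) m_j> over words of length n, on which D acts by
    [lk_weakrep], so [weakrep_cp] applies. *)
Lemma lk_ge0 n v : 0 <= fform (lk n) v v.
Proof.
elim: n v => [|n ih] v; have [m [c [s ->]]] := free_span v.
  pose x i := if size (s i).1 == 0%N then (s i).2 else 0.
  rewrite fform_sum; have := pf_ge0 psiP (\sum_i c i *: x i); congr (_ <= _).
  have psi0 : psi 0 = 0 by have := pfZ psiP 0 0; rewrite scaler0 mul0r.
  rewrite (big_morph _ (@cstarD R B) (cstar0 B)).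
  rewrite (big_morph (fun y => y ** _) (fun y1 y2 => cmulDl y1 y2 _)
    (cmul0r _)).
  rewrite (big_morph _ (pfD psiP) psi0); apply: eq_bigr => i _.
  rewrite (big_morph (fun y => _ ** y) (fun y1 y2 => cmulDr _ y1 y2)
    (cmulr0 _)).
  rewrite (big_morph _ (pfD psiP) psi0); apply: eq_bigr => j _.
  rewrite cstarZ -cscaleAl -cscaleAr !(pfZ psiP) mulrA; congr (_ * _).
  rewrite /x /lk; case: (s i) (s j) => [[|l w] y] [[|l' w'] z] //=.
  - by rewrite cmulr0.
  - by rewrite cstar0 cmul0r.
  - by rewrite cstar0 cmul0r.
pose hd i := head (0, 0) (s i).1.
(* Words of any other length get the coefficient 0, so the default values in [hd] and [behead] do no
   harm. *)
pose c' i := if size (s i).1 == n.+1 then c i else 0.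
pose m' i : {freeg word / R[i]} := c' i *: fe R (behead (s i).1, (s i).2).
rewrite fform_sum.
have term i j (G : D) : letter_ip (odd n) (hd i) (hd j) = G ->
    fform (lk n) (m' i) (flift (dvec G) (m' j)) =
    Num.conj (c i) * c j * lk n.+1 (s i) (s j).
  move=> GE; rewrite /m' fliftZ flift_fe fformZl fformZr.
  rewrite fform_fe.
  rewrite /c' /lk size_behead; move: GE; rewrite /hd.
  case: (s i) (s j) => [[|l w] x] [[|l' w'] y] /=.
  - by rewrite conjC0 mul0r mulr0.
  - by rewrite conjC0 mul0r mulr0.
  - by rewrite mul0r mulr0 /wk /= if_same mulr0.
  - rewrite !eqSS; case: eqP => [wn|wn] GE; last by rewrite conjC0 mul0r mulr0.
    case: eqP => [w'n|w'n].
      by rewrite wk_cons wn GE mulrA.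
    by rewrite mul0r mulr0 wk_size ?mulr0 //= wn eqSS eq_sym; apply/eqP.
have [i0|i1] := boolP (odd n).
  have := @weakrep_cp R B D phiB EB EBP _ _ (lk_weakrep ih) m
    (fun i => cen phiB EB (hd i).2) m'.
  congr (_ <= _); apply: eq_bigr => i _; apply: eq_bigr => j _.
  by apply: term; rewrite i0.
have := @weakrep_cp R A D phiA EA EAP _ _ (lk_weakrep ih) m
  (fun i => cen phiA EA (hd i).1) m'.
congr (_ <= _); apply: eq_bigr => i _; apply: eq_bigr => j _.
by apply: term; rewrite (negPf i1).
Qed.

Lemma wk_ge0 v : 0 <= fform wk v v.
Proof.
have [m [c [s ->]]] := free_span v; set u := \sum_i _.
(* Beyond all lengths that occur, so that the kernel is a finite sum of its restrictions. *)
pose N := (\max_i size (s i).1).+1.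
have wkE i j : wk (s i) (s j) = \sum_(n < N) lk n (s i) (s j).
  have iN : (size (s i).1 < N)%N by rewrite ltnS (leq_bigmax i).
  rewrite (bigD1 (Ordinal iN)) //= {1}/lk eqxx big1 ?addr0 // => n ni.
  by rewrite /lk; case: eqP => // si; case/eqP: ni; exact: val_inj.
have -> : fform wk u u = \sum_(n < N) fform (lk n) u u.
  rewrite fform_sum.
  rewrite (eq_bigr (fun i => \sum_(n < N) \sum_j Num.conj (c i) * c j * lk n
    (s i) (s j))).
    rewrite exchange_big; apply: eq_bigr => n _.
    by rewrite fform_sum.
  move=> i _; rewrite exchange_big; apply: eq_bigr => j _.
  by rewrite wkE mulr_sumr.
by apply: sumr_ge0 => n _; exact: lk_ge0.
Qed.

Definition viewA s : view A word :=
  match s.1 with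
  | [::] => Plain
  | l :: w => if odd (size w) then Plain else Letter l.1 (w, s.2)
  end.
(** The component that the position does not select is filled with 0. Removing a letter and putting
    it back may therefore change the word, but none of its inner products. *)
Definition consA (a : A) s : word := ((a, 0) :: s.1, s.2).

(** The empty word is [Other] for B, though [Plain] for A: K carries its own action of B, by left
    multiplication, and is kept apart from the part of the form B (x)_D M. *)
Definition viewB s : view B word :=
  match s.1 with
  | [::] => Other (fun b => ([::], b ** s.2))
  | l :: w => if odd (size w) then Letter l.2 (w, s.2) else Plain
  end.
Definition consB (b : B) s : word := ((0, b) :: s.1, s.2).

Lemma viewA_plain s : viewA s = Plain -> odd (size s.1) = false.
Proof. by case: s => [[|l w] x] //=; rewrite /viewA /=; case: odd. Qed.

Lemma viewB_plain s : viewB s = Plain -> odd (size s.1).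
Proof. by case: s => [[|l w] x] //=; rewrite /viewB /=; case: odd. Qed.

Lemma viewA_other s g : viewA s <> Other g.
Proof. by case: s => [[|l w] x] //=; rewrite /viewA /=; case: odd. Qed.

Lemma viewB_other s g : viewB s = Other g -> exists x, s = ([::], x) /\
  g = fun b => ([::], b ** x).
Proof.
case: s => [[|l w] x]; rewrite /viewB /=; last by case: odd.
by case=> <-; exists x.
Qed.

Lemma wk_parity s t : odd (size s.1) != odd (size t.1) -> wk s t = 0.
Proof. by move=> st; apply: wk_size; apply: contraNneq st => ->. Qed.

Definition fock : psdspace R := kernel_psd wk_conj wk_ge0.

Definition actA (a : A) : fock -> fock :=
  flift (ext_act phiA EA dact viewA consA a).
Definition actB (b : B) : fock -> fock :=
  flift (ext_act phiB EB dact viewB consB b).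

Let factsA :
  [/\ forall x s, viewA s = Plain -> viewA (consA x s) = Letter x s,
   forall s x t, viewA s = Letter x t -> viewA t = Plain /\ forall u, wk u s =
     wk u (consA x t),
   forall d s, viewA s = Plain -> viewA (dact d s) = Plain,
   forall x y s t, viewA s = Plain -> viewA t = Plain ->
     wk (consA x s) (consA y t) =
       wk s (dact (EA (cstar (cen phiA EA x) ** cen phiA EA y)) t) &
   forall x s t, viewA s = Plain -> viewA t = Plain -> wk s (consA x t) = 0].
Proof.
split.
- by move=> x [w y] /viewA_plain /= h; rewrite /viewA /consA /= h.
- move=> [[|l w] y] x t; rewrite /viewA //=; case: ifP => // h [<- <-].
  split=> [|[w' y']]; first by case: w h => [|l2 w2] //= /negbT;
    rewrite negbK => ->.
  have [st|st] := eqVneq (size w') (size w).+1; last by rewrite !wk_size.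
  by case: w' st => [|l' w'] //= [st]; rewrite !wk_cons /letter_ip st h.
- by move=> d [[|l w] y]; rewrite /viewA //=; case: ifP.
- move=> x y [w x'] [w' y'] /viewA_plain /= h _.
  by rewrite /consA wk_cons /letter_ip h.
- move=> x s t /viewA_plain hs /viewA_plain ht.
  by apply: wk_parity; rewrite /= hs ht.
Qed.

Let factsB :
  [/\ forall x s, viewB s = Plain -> viewB (consB x s) = Letter x s,
   forall s x t, viewB s = Letter x t -> viewB t = Plain /\ forall u, wk u s =
     wk u (consB x t),
   forall d s, viewB s = Plain -> viewB (dact d s) = Plain,
   forall x y s t, viewB s = Plain -> viewB t = Plain ->
     wk (consB x s) (consB y t) =
       wk s (dact (EB (cstar (cen phiB EB x) ** cen phiB EB y)) t) &
   forall x s t, viewB s = Plain -> viewB t = Plain -> wk s (consB x t) = 0].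
Proof.
split.
- by move=> x [w y] /viewB_plain /= h; rewrite /viewB /consB /= h.
- move=> [[|l w] y] x t; rewrite /viewB //=; case: ifP => // h [<- <-].
  split=> [|[w' y']]; first by case: w h => [|l2 w2] //= /negbTE ->.
  have [st|st] := eqVneq (size w') (size w).+1; last by rewrite !wk_size.
  by case: w' st => [|l' w'] //= [st]; rewrite !wk_cons /letter_ip st h.
- by move=> d [[|l w] y]; rewrite /viewB //=; case: ifP.
- move=> x y [w x'] [w' y'] /viewB_plain /= h _.
  by rewrite /consB wk_cons /letter_ip h.
- move=> x s t /viewB_plain hs /viewB_plain ht.
  by apply: wk_parity; rewrite /= hs ht.
Qed.

Lemma actA_weakrep : weakrep actA.
Proof.
have [h1 h2 h3 h4 h5] := factsA.
by apply: (ext_weakrep EAP) => //; try (exact: wkD || exact: wkZ || exact: dactM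
  || exact: wk_dact); move=> *; exfalso; apply: viewA_other; eassumption.
Qed.

Lemma actB_weakrep : weakrep actB.
Proof.
have [h1 h2 h3 h4 h5] := factsB.
apply: (ext_weakrep EBP) => //; try (exact: wkD || exact: wkZ || exact: dactM
  || exact: wk_dact).
- move=> s g a /viewB_other[x [_ ->]]; rewrite /viewB /=; congr Other.
  by apply/funext => b; rewrite cmulA.
- move=> s g t /viewB_other[x [-> _]] /viewB_plain ht; split=> [|y].
    by rewrite wk_parity //= ht.
  by rewrite wk_size.
- move=> a s t g h /viewB_other[x [-> ->]] /viewB_other[y [-> ->]].
  by rewrite !wk_nil cstarM cmulA.
- move=> a b s t g /viewB_other[y [_ ->]].
  case: s => [[|l w] x]; last by rewrite /wk /= addr0.
  by rewrite !wk_nil cmulDl cmulDr (pfD psiP).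
- move=> c a s t g /viewB_other[y [_ ->]].
  case: s => [[|l w] x]; last by rewrite /wk /= mulr0.
  by rewrite !wk_nil -cscaleAl -cscaleAr (pfZ psiP).
Qed.

(** On basis vectors both sides are the inner product with [dact d]. This is the compatibility over
    D that the universal property asks for. *)
Lemma act_agree d u v : pform u (actA (phiA d) v) = pform u (actB (phiB d) v).
Proof.
have [h1 h2 h3 h4 h5] := factsA; have [k1 k2 k3 k4 k5] := factsB.
rewrite /= /actA /actB; elim/free_ind: v => [|v v' h h'|c v h|t].
- by rewrite !flift0.
- by rewrite !fliftD !fformDr h h'.
- by rewrite !fliftZ !fformZr h.
rewrite !flift_fe; elim/free_ind: u => [|u u' h h'|c u h|s].
- by rewrite !fform0l.
- by rewrite !fformDl h h'.
- by rewrite !fformZl h.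
transitivity (wk s (dact d t)).
  apply: (ext_act_phi EAP) => //; try (exact: wkD || exact: wkZ || exact: dactM
    || exact: wk_dact || exact: wk_conj); try by move=> *; exfalso;
      apply: viewA_other; eassumption.
  by move=> d' x s' t' _; rewrite /consA /dact /= cmulr0.
apply/esym; apply: (ext_act_phi EBP) => //;
  try (exact: wkD || exact: wkZ || exact: dactM
  || exact: wk_dact || exact: wk_conj).
- move=> s' g t' /viewB_other[x [-> _]] /viewB_plain ht; split=> [|y].
    by rewrite wk_parity //= ht.
  by rewrite wk_size.
- by move=> d' x s' t' _; rewrite /consB /dact /= cmulr0.
- by move=> d' s' t' g /viewB_other[x [-> ->]].
Qed.

Definition vac (x : B) : fock := fe R ([::], x).

Lemma actB_vac b x : actB b (vac x) = vac (b ** x).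
Proof. by rewrite /actB flift_fe. Qed.

(** The centred part of a yields a word of length 1, orthogonal to the words of length 0; only E(a)
    survives the compression to K. *)
Lemma actA_vac a x y : pform (vac x) (actA a (vac y)) =
  psi (cstar x ** (phiB (EA a) ** y)).
Proof.
rewrite /actA /= flift_fe /ext_act /= /block fformDr !fform_fe.
by rewrite /dact /= wk_nil [X in _ + X]wk_size ?addr0.
Qed.

End Fock.

(** * The amalgamated free product *)

Section Separation.
Context (R : realType) (A B D : cstarAlgType R).
Context (phiA : {starhom D -> A}) (phiB : {starhom D -> B}) (EA : A -> D)
  (EB : B -> D).
Hypothesis EAP : conditional_expectation phiA EA.
Hypothesis EBP : conditional_expectation phiB EB.
Context (F : cstarAlgType R) (sigmaA : {starhom A -> F})
  (sigmaB : {starhom B -> F}).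
Hypothesis F_afp : full_amalgamated_free_product phiA phiB sigmaA sigmaB.

Lemma afp_condexp (a a' : A) (b b' : B) :
  sigmaA a ** sigmaB b = sigmaA a' ** sigmaB b' ->
  phiB (EA a) ** b = phiB (EA a') ** b'.
Proof.
move=> ab; apply/eqP; rewrite -subr_eq0; apply/eqP; set Z := _ - _.
have [//|Z0] := eqVneq Z 0.
(* Vectors of K come from elements of B, which may have no unit, so Z is tested between the vectors
   of h and of Z^*. The coefficient is psi at h^* Z Z^* = h^* h, where [psi] can be chosen
   nonzero. *)
pose h := Z ** cstar Z.
have h0 : h != 0.
  apply: contra_neq Z0 => Zh; rewrite -[Z]cstarK.
  by rewrite (cstar_cmul_eq0 (x := cstar Z)) ?cstar0 // cstarK.
have [psi psiP] := positive_functional_exists h0.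
pose V := fock EAP EBP psiP.
pose piA := starrep (actA_weakrep EAP EBP psiP).
pose piB := starrep (actB_weakrep EAP EBP psiP).
have [|pi [piA_E piB_E]] := afp_univ F_afp (C := adjop (hilbert V)) (piA := piA)
  (piB := piB).
  apply/funext => d; apply: adjopP => g; apply: hilbP => x.
  rewrite /= -!starhom_star; apply: hfun_weak => u; exact: act_agree.
have piab x y : pi (sigmaA x ** sigmaB y) = piA x ** piB y.
  by rewrite starhomM -piA_E -piB_E.
have psi_ab x y u u' : hip (embed (vac EAP EBP psiP u'))
    ((piA x ** piB y) (embed (vac EAP EBP psiP u))) =
    psi (cstar u' ** (phiB (EA x) ** (y ** u))).
  rewrite -(actA_vac EAP EBP psiP) -(actB_vac EAP EBP psiP).
  have -> : (piA x ** piB y) (embed (vac EAP EBP psiP u)) =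
      piA x (piB y (embed (vac EAP EBP psiP u))) by [].
  by rewrite !starrep_embed hip_embedl.
move=> /eqP[]; have Zu : cstar h ** h = cstar h ** (Z ** cstar Z) by [].
rewrite Zu /Z cmulBl cmulBr -!cmulA.
have psiB u v : psi (u - v) = psi u - psi v.
  by rewrite (pfD psiP) -scaleN1r (pfZ psiP) mulN1r.
by rewrite psiB -!psi_ab -!piab ab subrr.
Qed.

End Separation.

Theorem proposition3p2 (R : realType) (A B D At Bt Dt : cstarAlgType R)
  (iA : {starhom A -> At}) (iB : {starhom B -> Bt}) (iD : {starhom D -> Dt})
  (phiA : {starhom D -> A}) (phiB : {starhom D -> B})
  (phiAt : {starhom Dt -> At}) (phiBt : {starhom Dt -> Bt})
  (iA_inj : injective iA) (iB_inj : injective iB) (iD_inj : injective iD)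
  (phiA_inj : injective phiA) (phiB_inj : injective phiB)
  (phiAt_inj : injective phiAt) (phiBt_inj : injective phiBt)
  (compatA : iA \o phiA = phiAt \o iD) (compatB : iB \o phiB = phiBt \o iD)
  (F : cstarAlgType R) (sigmaA : {starhom A -> F}) (sigmaB : {starhom B -> F})
  (F_afp : full_amalgamated_free_product phiA phiB sigmaA sigmaB)
  (Ft : cstarAlgType R)
  (sigmaAt : {starhom At -> Ft}) (sigmaBt : {starhom Bt -> Ft})
  (Ft_afp : full_amalgamated_free_product phiAt phiBt sigmaAt sigmaBt)
  (lambda : {starhom F -> Ft})
  (lambdaA : lambda \o sigmaA = sigmaAt \o iA)
  (lambdaB : lambda \o sigmaB = sigmaBt \o iB)
  (EA : A -> D) (EB : B -> D)
  (EA_condexp : conditional_expectation phiA EA)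
  (EB_condexp : conditional_expectation phiB EB)
  (EB_faithful : faithful EB)
  (dt : Dt) (a : A) (b : B)
  (* adt and dtb are the elements a * dt of A and dt * b of B *)
  (adt : A) (adtE : iA adt = iA a ** phiAt dt)
  (dtb : B) (dtbE : iB dtb = phiBt dt ** iB b)
  (trivial_meet : [set phiB d ** dtb | d in [set: D]]
                    `&` [set phiB d ** b | d in [set: D]] = [set 0])
  (nonzero : phiB (EA (cstar adt ** adt)) ** b <> 0) :
  ~ injective lambda.
Proof.
move=> lambda_inj.
have adtb : sigmaA adt ** sigmaB b = sigmaA a ** sigmaB dtb.
  apply: lambda_inj; rewrite !starhomM.
  have lA x : lambda (sigmaA x) =
    sigmaAt (iA x) by rewrite -[LHS]/((lambda \o sigmaA) x) lambdaA.
  have lB x : lambda (sigmaB x) =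
    sigmaBt (iB x) by rewrite -[LHS]/((lambda \o sigmaB) x) lambdaB.
  have amalg d : sigmaAt (phiAt d) = sigmaBt (phiBt d).
    by rewrite -[LHS]/((sigmaAt \o phiAt) d) (afp_amalg Ft_afp).
  by rewrite !lA !lB adtE dtbE !starhomM amalg cmulA.
have Eb : phiB (EA (cstar adt ** adt)) ** b = phiB (EA (cstar adt ** a)) ** dtb.
  apply: (afp_condexp EA_condexp EB_condexp F_afp).
  by rewrite !starhomM -!cmulA adtb.
apply: nonzero.
have : ([set phiB d ** dtb | d in [set: D]] `&`
  [set phiB d ** b | d in [set: D]])
    (phiB (EA (cstar adt ** adt)) ** b).
  by split; [rewrite Eb; exists (EA (cstar adt ** a))|exists
    (EA (cstar adt ** adt))].
by rewrite trivial_meet.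
Qed.
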